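(* For every admissible pair $(Q,f)$ there exist positive integers $d,d_1,d_2$ satisfying $$d-d_1>0,\quad d-d_2>0,\quad d_0:=d_1+d_2-d>0,$$ and a universal Massey system $\mathbf{c}$ for $(\mathcal{L}_1,\mathcal{L}_2,\mathcal{L})$, where $$\mathcal{L}_1=\mathcal{L}(d_1)[0,0],\quad \mathcal{L}_2=\mathcal{L}(d_2)[0,0],\quad \mathcal{L}=\mathcal{L}(d)[0,0]$$ on the standard family of elliptic curves $\mathcal{E}\to\mathfrak{H}$ over the upper half-plane, such that, as functions of $\tau\in\mathfrak{H}$ with $q=\exp(2\pi i\tau)$, $$\Theta_{Q,f}(q)=\sum_{l\in\mathbb{Z}/d_0\mathbb{Z}}MP(\mathbf{c})_l.$$
   Context: **Indefinite theta series.** A lattice in $\mathbb{Q}^2$ is a free abelian subgroup of rank 2. A function $f:\mathbb{Q}^2\to\mathbb{C}$ is *doubly periodic* if there are lattices $\Lambda_1\subset\Lambda_2\subset\mathbb{Q}^2$ such that $f$ is supported on $\Lambda_2$ and is $\Lambda_1$-periodic. Call $(Q,f)$ an *admissible pair* if $Q(m,n)=am^2+2bmn+cn^2$ with $a,b,c$ positive rational numbers and $b^2>ac$, $f$ is doubly periodic, and $f(A\mathbf{x})=f(B\mathbf{x})=-f(\mathbf{x})$ for all $\mathbf{x}\in\mathbb{Q}^2$ (column vectors), where $A=\begin{pmatrix}-1&-2b/a\\0&1\end{pmatrix}$, $B=\begin{pmatrix}1&0\\-2b/c&-1\end{pmatrix}$. For an admissible pair put $$\Theta_{Q,f}(q)=\Big(\sum_{m\ge0,n\ge0}-\sum_{m<0,n<0}\Big)f(m,n)\,q^{Q(m,n)/2}$$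 (the sums are over $(m,n)\in\mathbb{Q}^2$; $q^{r}=\exp(2\pi i r\tau)$ for $r\in\mathbb{Q}$; the series converges for $|q|<1$). **Line bundles.** $\mathcal{E}=(\mathfrak{H}\times\mathbb{C})/\mathbb{Z}^2$, $(m,n)$ acting by $(\tau,z)\mapsto(\tau,z+m\tau+n)$; the fiber over $\tau$ is $E_\tau=\mathbb{C}/(\mathbb{Z}\tau+\mathbb{Z})$. For $N\in\mathbb{Z}$, $\mathcal{L}(N)[0,0]$ is the quotient of $\mathfrak{H}\times\mathbb{C}\times\mathbb{C}$ by $$(m,n)\cdot(\tau,z,\lambda)=(\tau,z+m\tau+n,\lambda\exp(-\pi iNm^2\tau-2\pi iNmz)).$$ It has relative degree $N$, and $\mathcal{L}(N)[0,0]\otimes\mathcal{L}(N')[0,0]=\mathcal{L}(N+N')[0,0]$ canonically. For $N>0$, $k\in\mathbb{Z}/N\mathbb{Z}$ let $$F_{N,k}=\sum_{m\in N\mathbb{Z}+k}\exp\left(\pi i\tfrac{\tau}{N}m^2+2\pi imz\right);$$ for each $\tau$ these form a basis of $H^0(E_\tau,\mathcal{L}(N)[0,0]|_{E_\tau})$. **Bases used.** Put $\mathcal{L}_0=\mathcal{L}_1\otimes\mathcal{L}_2\otimes\mathcal{L}^{-1}=\mathcal{L}(d_0)[0,0]$. Fix $\tau$ and let $L_1,L_2,L,L_0$ be the restrictions of $\mathcal{L}_1,\mathcal{L}_2,\mathcal{L},\mathcal{L}_0$ to $E=E_\tau$. Use the bases $e_i=F_{d_1,i}$ of $H^0(L_1)$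 ($i\in\mathbb{Z}/d_1\mathbb{Z}$), $f_k=F_{d_2,k}$ of $H^0(L_2)$ ($k\in\mathbb{Z}/d_2\mathbb{Z}$), $h_l=F_{d_0,l}$ of $H^0(L_0)$ ($l\in\mathbb{Z}/d_0\mathbb{Z}$). The basis $(g_j)_{j\in\mathbb{Z}/d\mathbb{Z}}$ of $H^1(L^{-1})$ is such that $g_j$ is the element dual to $F_{d,-j}$ in the basis dual to $(F_{d,k})_k$ of $H^0(L)$ under Serre duality $H^1(L^{-1})\simeq H^0(L)^*$, where the canonical bundle of $E_\tau$ is trivialized by a fixed constant multiple (independent of $\tau$) of $dz$. **Massey product.** With $m_2$ the natural product on cohomology, let $$K=\ker\Big((m_2\otimes\mathrm{id},\mathrm{id}\otimes m_2):H^0(L_1)\otimes H^1(L^{-1})\otimes H^0(L_2)\to H^1(L_1\otimes L^{-1})\otimes H^0(L_2)\oplus H^0(L_1)\otimes H^1(L^{-1}\otimes L_2)\Big).$$ The triple Massey product is the linear map $MP:K\to H^0(L_0)$ defined as follows. Given $\sum_ix_i\otimes y_i\otimes z_i\in K$, represent $y_i$ by $(0,1)$-forms $\tilde y_i$ with values in $L^{-1}$ and write $\sum_i x_i\tilde y_i\otimes z_i=\sum_j\bar\partial(t_j)\otimes z'_j$ and $\sum_ix_i\otimes\tilde y_iz_i=\sum_kx'_k\otimes\bar\partial(s_k)$ with $x_k'\in H^0(L_1)$, $z_j'\in H^0(L_2)$, $t_j\in C^\infty(L_1\otimes L^{-1})$, $s_k\in C^\infty(L^{-1}\otimes L_2)$;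 then $MP(\sum_ix_i\otimes y_i\otimes z_i)=\sum_jt_jz_j'-\sum_kx_k's_k\in H^0(L_0)$ (well defined). **Universal Massey systems.** A collection of complex constants $\mathbf{c}=(c_{ijk})$, $(i,j,k)\in\mathbb{Z}/d_1\mathbb{Z}\times\mathbb{Z}/d\mathbb{Z}\times\mathbb{Z}/d_2\mathbb{Z}$, independent of $\tau$, is a *universal Massey system* for $(\mathcal{L}_1,\mathcal{L}_2,\mathcal{L})$ if $\sum_{ijk}c_{ijk}\,e_i\otimes g_j\otimes f_k\in K$ for every $\tau\in\mathfrak{H}$. Then $MP(\mathbf{c})_l$ is the function on $\mathfrak{H}$ whose value at $\tau$ is the coefficient of $h_l$ in the expansion of $MP(\sum_{ijk}c_{ijk}\,e_i\otimes g_j\otimes f_k)\in H^0(L_0)$ in the basis $(h_l)$. *)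

(* Defs.v *)
From HB Require Import structures.
From mathcomp Require Import all_boot all_order all_algebra.
From mathcomp Require Import generic_quotient ring_quotient.
From mathcomp Require Import all_classical all_reals all_analysis.
From mathcomp.analysis.showcase Require summability.
From mathcomp Require Import complex ring.

Set Implicit Arguments.
Unset Strict Implicit.
Unset Printing Implicit Defensive.

Import Order.TTheory GRing.Theory Num.Theory.
Import numFieldNormedType.Exports.

Local Open Scope classical_set_scope.
Local Open Scope quotient_scope.
Local Open Scope complex_scope.
Local Open Scope ring_scope.

Fact dzbarD_aux (K : comNzRingType) (h i a b c d : K) :
  h * (a + b + i * (c + d)) = h * (a + i * c) + h * (b + i * d).
Proof. ring. Qed.

Fact dzbarM_aux (K : comNzRingType) (h i a b c d x y : K) :
  h * (a * x + y * b + i * (c * x + y * d)) =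
  h * (a + i * c) * x + y * (h * (b + i * d)).
Proof. ring. Qed.

Section ComplexPreliminaries.
Variable R : realType.
Local Notation C := R[i].
Implicit Types (f g : C -> C) (z w : C) (u v : R * R -> R).

Definition expC z : C :=
  (expR (complex.Re z) * cos (complex.Im z))
  +i* (expR (complex.Re z) * sin (complex.Im z)).

Definition pii : C := 0 +i* pi.

(* The sum of a complex family over an arbitrary index set is the limit of the
   net of its finite partial sums, taken on real and imaginary parts. *)
Definition csum (I : choiceType) (x : I -> C) : C :=
  summability.sum (fun i => complex.Re (x i))
  +i* summability.sum (fun i => complex.Im (x i)).

Definition coords z : R * R := (complex.Re z, complex.Im z).
Definition reC f : R * R -> R := fun p => complex.Re (f (p.1 +i* p.2)).
Definition imC f : R * R -> R := fun p => complex.Im (f (p.1 +i* p.2)).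

Fixpoint Cn (n : nat) u : Prop :=
  continuous u /\
  if n is m.+1 then
    [/\ forall p, derivable u p (1, 0), forall p, derivable u p (0, 1),
        Cn m (fun p => 'D_(1, 0) u p) & Cn m (fun p => 'D_(0, 1) u p)]
  else True.

Definition smooth f : Prop := forall n, Cn n (reC f) /\ Cn n (imC f).

Definition partialC (e : R * R) f : C -> C := fun z =>
  'D_e (reC f) (coords z) +i* 'D_e (imC f) (coords z).

(* d/d(zbar) = (d/dx + i d/dy) / 2 *)
Definition dzbar f : C -> C := fun z =>
  2^-1 * (partialC (1, 0) f z + (0 +i* 1) * partialC (0, 1) f z).

Lemma mulCE (a b c d : R) :
  (a +i* b) * (c +i* d) = (a * c - b * d) +i* (a * d + b * c) :> C.
Proof. by []. Qed.

Lemma addCE (a b c d : R) : (a +i* b) + (c +i* d) = (a + c) +i* (b + d) :> C.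
Proof. by []. Qed.

Lemma coordsE f p : f (p.1 +i* p.2) = reC f p +i* imC f p.
Proof. by rewrite /reC /imC; case: (f _). Qed.

Lemma CnW n u : Cn n.+1 u -> Cn n u.
Proof.
elim: n u => [|n IH] u [uc [u1 u2 c1 c2]]; first exact: (conj uc I).
split; first exact: uc.
by split; [exact: u1|exact: u2|exact: (IH _ c1)|exact: (IH _ c2)].
Qed.

Lemma Cn_cst n (k : R) : Cn n (fun _ => k).
Proof.
elim: n k => [|n IH] k; split; [exact: cst_continuous|exact: I|exact: cst_continuous|].
have E (e : R * R) : (fun p => 'D_e (fun _ : R * R => k) p) = (fun _ => 0).
  by apply/funext => p; rewrite derive_cst.
by split=> [p|p||]; [exact: derivable_cst|exact: derivable_cst|rewrite E; exact: IH|rewrite E; exact: IH].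
Qed.

Lemma CnD n u v : Cn n u -> Cn n v -> Cn n (u \+ v).
Proof.
elim: n u v => [|n IH] u v /=.
  case=> [uc _] [vc _]; split; last exact: I.
  by move=> p; apply: continuousD; [exact: uc|exact: vc].
case=> [uc [u1 u2 cu1 cu2]] [vc [v1 v2 cv1 cv2]].
split; first by move=> p; apply: continuousD; [exact: uc|exact: vc].
split=> [p|p||].
- by apply: derivableD; [exact: u1|exact: v1].
- by apply: derivableD; [exact: u2|exact: v2].
- rewrite (_ : (fun p => _) =
    (fun p => 'D_(1, 0) u p) \+ (fun p => 'D_(1, 0) v p)); first exact: IH.
  by apply/funext => p; apply: deriveD; [exact: u1|exact: v1].
- rewrite (_ : (fun p => _) =
    (fun p => 'D_(0, 1) u p) \+ (fun p => 'D_(0, 1) v p)); first exact: IH.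
  by apply/funext => p; apply: deriveD; [exact: u2|exact: v2].
Qed.

Lemma CnM n u v : Cn n u -> Cn n v -> Cn n (u \* v).
Proof.
elim: n u v => [|n IH] u v.
  case=> [uc _] [vc _]; split; last exact: I.
  by move=> p; apply: continuousM; [exact: uc|exact: vc].
move=> Cu Cv; have Cu' := CnW Cu; have Cv' := CnW Cv; move: Cu Cv.
case=> [uc [u1 u2 cu1 cu2]] [vc [v1 v2 cv1 cv2]].
split; first by move=> p; apply: continuousM; [exact: uc|exact: vc].
split=> [p|p||].
- by apply: derivableM; [exact: u1|exact: v1].
- by apply: derivableM; [exact: u2|exact: v2].
- rewrite (_ : (fun p => _) = (u \* (fun p => 'D_(1, 0) v p))
    \+ (v \* (fun p => 'D_(1, 0) u p))); first by apply: CnD; apply: IH.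
  by apply/funext => p; apply: deriveM; [exact: u1|exact: v1].
- rewrite (_ : (fun p => _) = (u \* (fun p => 'D_(0, 1) v p))
    \+ (v \* (fun p => 'D_(0, 1) u p))); first by apply: CnD; apply: IH.
  by apply/funext => p; apply: deriveM; [exact: u2|exact: v2].
Qed.

Lemma reCD f g : reC (f + g) = reC f \+ reC g.
Proof. by apply/funext => p; rewrite /reC /= addrfctE; case: (f _); case: (g _). Qed.

Lemma imCD f g : imC (f + g) = imC f \+ imC g.
Proof. by apply/funext => p; rewrite /imC /= addrfctE; case: (f _); case: (g _). Qed.

Lemma reCM f g :
  reC (f * g) = (reC f \* reC g) \+ ((fun _ => -1) \* (imC f \* imC g)).
Proof.
apply/funext => p; rewrite /reC /imC /= mulrfctE.
by case: (f _) => a b; case: (g _) => c d; rewrite mulN1r.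
Qed.

Lemma imCM f g : imC (f * g) = (reC f \* imC g) \+ (imC f \* reC g).
Proof.
apply/funext => p; rewrite /reC /imC /= mulrfctE.
by case: (f _) => a b; case: (g _) => c d.
Qed.

Lemma smooth_cst (k : C) : smooth (fun _ => k).
Proof. by move=> n; split; apply: Cn_cst. Qed.

Lemma smoothD f g : smooth f -> smooth g -> smooth (f + g).
Proof.
move=> sf sg n; have [f1 f2] := sf n; have [g1 g2] := sg n.
by rewrite reCD imCD; split; apply: CnD.
Qed.

Lemma smoothM f g : smooth f -> smooth g -> smooth (f * g).
Proof.
move=> sf sg n; have [f1 f2] := sf n; have [g1 g2] := sg n.
rewrite reCM imCM; split; first apply: CnD; first exact: CnM.
  by apply: CnM; [exact: Cn_cst|exact: CnM].
by apply: CnD; apply: CnM.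
Qed.

Lemma scaleC_mul (k : C) f : k *: f = (fun _ => k) * f.
Proof. by []. Qed.

Lemma smooth_dzbar f : smooth f -> smooth (dzbar f).
Proof.
move=> sf; rewrite (_ : dzbar f = (fun _ => 2^-1) *
  (partialC (1, 0) f + (fun _ => 0 +i* 1) * partialC (0, 1) f)) //.
apply: smoothM; first exact: smooth_cst.
apply: smoothD.
  move=> n; have [[_ [_ _ f1 _]] [_ [_ _ f2 _]]] := sf n.+1.
  rewrite /reC /imC /partialC /coords /=.
  by split; [move: f1|move: f2]; congr (Cn _ _); apply/funext => -[].
apply: smoothM; first exact: smooth_cst.
move=> n; have [[_ [_ _ _ f1]] [_ [_ _ _ f2]]] := sf n.+1.
rewrite /reC /imC /partialC /coords /=.
by split; [move: f1|move: f2]; congr (Cn _ _); apply/funext => -[].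
Qed.

Definition cderivable f : Prop := forall p,
  [/\ derivable (reC f) p (1, 0), derivable (reC f) p (0, 1),
      derivable (imC f) p (1, 0) & derivable (imC f) p (0, 1)].

Lemma smooth_cderivable f : smooth f -> cderivable f.
Proof.
by move=> /(_ 1%N) [[_ [f1 f2 _ _]] [_ [f3 f4 _ _]]] p.
Qed.

Lemma partialCD (e : R * R) f g z :
    derivable (reC f) (coords z) e -> derivable (imC f) (coords z) e ->
    derivable (reC g) (coords z) e -> derivable (imC g) (coords z) e ->
  partialC e (f + g) z = partialC e f z + partialC e g z.
Proof.
by move=> f1 f2 g1 g2; rewrite /partialC reCD imCD !deriveD.
Qed.

Lemma partialCM (e : R * R) f g z :
    derivable (reC f) (coords z) e -> derivable (imC f) (coords z) e ->
    derivable (reC g) (coords z) e -> derivable (imC g) (coords z) e ->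
  partialC e (f * g) z = partialC e f z * g z + f z * partialC e g z.
Proof.
move=> f1 f2 g1 g2; rewrite /partialC reCM imCM.
have dc : derivable (fun _ : R * R => -1 : R) (coords z) e.
  exact: derivable_cst.
have d1 := derivableM f1 g1; have d2 := derivableM f2 g2.
have d3 := derivableM dc d2.
have d4 := derivableM f1 g2; have d5 := derivableM f2 g1.
rewrite (deriveD d1 d3) (deriveD d4 d5) (deriveM dc d2).
rewrite (deriveM f1 g1) (deriveM f2 g2) (deriveM f1 g2) (deriveM f2 g1).
rewrite derive_cst.
have := coordsE f (coords z); have := coordsE g (coords z).
rewrite /coords /=; case: z {f1 f2 g1 g2 d1 d2 dc d3 d4 d5} => x y /= -> ->.
rewrite !mulCE addCE.
move: ('D_e _ _) ('D_e _ _) ('D_e _ _) ('D_e _ _) => a b c d.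
rewrite /GRing.scale /=; congr (_ +i* _); ring.
Qed.

Lemma dzbarD f g z : cderivable f -> cderivable g ->
  dzbar (f + g) z = dzbar f z + dzbar g z.
Proof.
move=> /(_ (coords z)) [f1 f2 f3 f4] /(_ (coords z)) [g1 g2 g3 g4].
rewrite /dzbar (partialCD f1 f3 g1 g3) (partialCD f2 f4 g2 g4).
exact: dzbarD_aux.
Qed.

Lemma dzbarM f g z : cderivable f -> cderivable g ->
  dzbar (f * g) z = dzbar f z * g z + f z * dzbar g z.
Proof.
move=> /(_ (coords z)) [f1 f2 f3 f4] /(_ (coords z)) [g1 g2 g3 g4].
rewrite /dzbar (partialCM f1 f3 g1 g3) (partialCM f2 f4 g2 g4).
exact: dzbarM_aux.
Qed.

Lemma dzbar_cst (k : C) z : dzbar (fun _ => k) z = 0.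
Proof.
rewrite /dzbar /partialC /reC /imC !derive_cst.
by rewrite -[0 +i* 0]/(0 : C) mulr0 addr0 mulr0.
Qed.

Lemma dzbar_shift f w z : dzbar (fun y => f (y + w)) z = dzbar f (z + w).
Proof.
have E (e : R * R) (u u' : R * R -> R) : (forall p, u' p = u (p + coords w)) ->
    'D_e u' (coords z) = 'D_e u (coords (z + w)).
  move=> uu'; rewrite /derive.
  have zw : coords (z + w) = coords z + coords w by case: (z) (w) => ? ? [].
  congr (lim (_ @ 0^')); apply/funext => h /=.
  by rewrite !uu' zw addrA.
have Er (e : R * R) : 'D_e (reC (fun y => f (y + w))) (coords z) =
    'D_e (reC f) (coords (z + w)).
  by apply: E => -[a b]; rewrite /reC; case: (w).
have Ei (e : R * R) : 'D_e (imC (fun y => f (y + w))) (coords z) =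
    'D_e (imC f) (coords (z + w)).
  by apply: E => -[a b]; rewrite /imC; case: (w).
by rewrite /dzbar /partialC !Er !Ei.
Qed.

Lemma expCD z w : expC (z + w) = expC z * expC w.
Proof.
case: z w => [a b] [c d]; rewrite /expC /= expRD cosD sinD.
rewrite mulCE; congr (_ +i* _); ring.
Qed.

Lemma is_derive_line (u : R * R -> R) (p e : R * R) (G : R -> R) (d : R) :
  (forall h : R, u (h *: e + p) = G h) -> is_derive (0 : R) 1 G d ->
  is_derive p e u d.
Proof.
move=> uG [dG <-].
have E : (fun h : R => h^-1 *: ((u \o shift p) (h *: e) - u p)) =
         (fun h : R => h^-1 *: ((G \o shift 0) (h *: 1) - G 0)).
  apply/funext => h /=; rewrite uG -(uG 0) scale0r add0r addr0.
  by rewrite [h *: 1]mulr1.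
by split; [rewrite /derivable E; exact: dG|rewrite /derive E].
Qed.

Lemma expC_line (a b c d : R) :
  is_derive (0 : R) 1 (fun h => expR (a + h * b) * cos (c + h * d))
    (b * (expR a * cos c) - d * (expR a * sin c)) /\
  is_derive (0 : R) 1 (fun h => expR (a + h * b) * sin (c + h * d))
    (b * (expR a * sin c) + d * (expR a * cos c)).
Proof.
have lin (x y : R) : is_derive (0 : R) 1 (fun h : R => x + h * y) y.
  by apply: is_derive_eq; rewrite add0r mul1r scaler0 add0r [_%:A]mulr1.
have ex : is_derive (0 : R) 1 (fun h => expR (a + h * b)) (b * expR a).
  have := @is_derive1_comp R expR (fun h => a + h * b) 0 _ _
    (is_derive_expR _) (lin a b).
  by rewrite mul0r addr0 mulrC.
have co : is_derive (0 : R) 1 (fun h => cos (c + h * d)) (- (d * sin c)).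
  have := @is_derive1_comp R cos (fun h => c + h * d) 0 _ _
    (is_derive_cos _) (lin c d).
  by rewrite mul0r addr0 mulNr mulrC.
have si : is_derive (0 : R) 1 (fun h => sin (c + h * d)) (d * cos c).
  have := @is_derive1_comp R sin (fun h => c + h * d) 0 _ _
    (is_derive_sin _) (lin c d).
  by rewrite mul0r addr0 mulrC.
split.
  apply: (is_derive_eq (is_deriveM ex co)).
  rewrite mul0r mul0r !addr0 /GRing.scale /=; ring.
apply: (is_derive_eq (is_deriveM ex si)).
rewrite mul0r mul0r !addr0 /GRing.scale /=; ring.
Qed.

Lemma expC_lin (alpha beta : C) (p e : R * R) :
  let E z := expC (alpha * z + beta) in
  let D := alpha * (e.1 +i* e.2) * E (p.1 +i* p.2) in
  is_derive p e (reC E) (complex.Re D) /\ is_derive p e (imC E) (complex.Im D).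
Proof.
case: alpha beta p e => [a b] [c d] [x y] [s t] E D.
have [K1 K2] := expC_line (a * x - b * y + c) (a * s - b * t)
  (a * y + b * x + d) (a * t + b * s).
split.
  apply: is_derive_eq (is_derive_line _ K1) _ => [h|].
    rewrite /reC /E /expC /= /GRing.scale /=; congr (expR _ * cos _); ring.
  rewrite /D /E /expC /=; ring.
apply: is_derive_eq (is_derive_line _ K2) _ => [h|].
  rewrite /imC /E /expC /= /GRing.scale /=; congr (expR _ * sin _); ring.
rewrite /D /E /expC /=; ring.
Qed.

Lemma expC_cderivable (alpha beta : C) :
  cderivable (fun z => expC (alpha * z + beta)).
Proof.
move=> p; have [[a _] [b _]] := expC_lin alpha beta p (1, 0).
have [[c _] [d _]] := expC_lin alpha beta p (0, 1).
by split; [exact: a|exact: c|exact: b|exact: d].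
Qed.

Lemma dzbar_expC (alpha beta : C) z :
  dzbar (fun z => expC (alpha * z + beta)) z = 0.
Proof.
have [[_ a] [_ b]] := expC_lin alpha beta (coords z) (1, 0).
have [[_ c] [_ d]] := expC_lin alpha beta (coords z) (0, 1).
rewrite /dzbar /partialC a b c d /=.
set w := expC _; case: alpha w {a b c d} => [a b] [c d].
apply/eqP; rewrite mulf_eq0; apply/orP; right; apply/eqP.
rewrite !(mulCE, addCE) /=; congr (_ +i* _); ring.
Qed.

End ComplexPreliminaries.

Section LineBundles.
Variables (R : realType) (tau : R[i]).
Local Notation C := R[i].

Definition automorphy (N m : int) (z : C) : C :=
  expC (- (pii R * N%:~R * m%:~R ^+ 2 * tau)
        - 2 * pii R * N%:~R * m%:~R * z).

Section FixedDegree.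
Variable N : int.

Definition is_section : {pred C -> C} := fun s : C -> C =>
  `[< smooth s /\ forall (m n : int) (z : C),
        s (z + m%:~R * tau + n%:~R) = s z * automorphy N m z >].

Lemma is_section_submod : submod_closed is_section.
Proof.
split=> [|k f g /asboolP[sf qf] /asboolP[sg qg]]; apply/asboolP; split.
- exact: smooth_cst.
- by move=> m n z; rewrite mul0r.
- by rewrite scaleC_mul; apply: smoothD sg; apply: smoothM sf; apply: smooth_cst.
- by move=> m n z; rewrite !addrfctE !scalrfctE qf qg mulrDl /GRing.scale /= mulrA.
Qed.
HB.instance Definition _ :=
  GRing.isSubmodClosed.Build C (C -> C) is_section is_section_submod.

(* C^oo sections of L(N)[0,0] over E_tau, as functions of z.  The form d(zbar)
   is invariant under translations, so a (0,1)-form with values in L(N)[0,0] is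
   a d(zbar) for a unique such section a, and is represented by a. *)
Record csec : Type := CSec { csec_fun :> C -> C; _ : csec_fun \in is_section }.
HB.instance Definition _ := [isSub for csec_fun].
HB.instance Definition _ := [Choice of csec by <:].
HB.instance Definition _ := [SubChoice_isSubLmodule of csec by <:].

Lemma csecP (s : csec) : smooth s /\ forall (m n : int) (z : C),
  s (z + m%:~R * tau + n%:~R) = s z * automorphy N m z.
Proof. by case: s => f /= /asboolP. Qed.

End FixedDegree.
End LineBundles.

Section Cohomology.
Variables (R : realType) (tau : R[i]).
Local Notation C := R[i].

Section FixedDegreeOperators.
Variable N : int.
Local Notation csec := (csec tau N).

Lemma automorphy_affine (m : int) : exists alpha beta : C,
  automorphy tau N m = fun z => expC (alpha * z + beta).
Proof.
exists (- (2 * pii R * N%:~R * m%:~R)), (- (pii R * N%:~R * m%:~R ^+ 2 * tau)).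
by apply/funext => z; rewrite /automorphy mulNr addrC.
Qed.

Lemma dzbar_is_section (s : csec) : dzbar s \in is_section tau N.
Proof.
have [ss qs] := csecP s; apply/asboolP; split; first exact: smooth_dzbar.
move=> m n z; rewrite -addrA -dzbar_shift.
have [alpha [beta E]] := automorphy_affine m.
rewrite (_ : (fun y => s (y + (m%:~R * tau + n%:~R))) =
  (s : C -> C) * (fun z => expC (alpha * z + beta))); last first.
  by apply/funext => y; rewrite addrA qs E.
rewrite dzbarM; [|exact: smooth_cderivable|exact: expC_cderivable].
by rewrite dzbar_expC mulr0 addr0 E.
Qed.

Definition dbar (s : csec) : csec := CSec (dzbar_is_section s).

Lemma dbar_is_linear : linear dbar.
Proof.
move=> k s t; apply/val_inj/funext => z /=.
have [ss _] := csecP s; have [st _] := csecP t.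
have sk : smooth (fun _ : C => k) by exact: smooth_cst.
rewrite (_ : dzbar _ z =
  dzbar ((fun _ : C => k) * (s : C -> C) + (t : C -> C)) z) //.
rewrite dzbarD; [|exact/smooth_cderivable/smoothM|exact: smooth_cderivable].
rewrite dzbarM; [|exact: smooth_cderivable|exact: smooth_cderivable].
by rewrite dzbar_cst mul0r add0r.
Qed.
HB.instance Definition _ := GRing.isLinear.Build C csec csec _ dbar dbar_is_linear.

Definition is_holomorphic : {pred csec} := fun s => dbar s == 0.

Lemma is_holomorphic_submod : submod_closed is_holomorphic.
Proof.
split=> [|k s t /eqP s0 /eqP t0]; apply/eqP; first exact: linear0.
by rewrite linearP /= s0 t0 scaler0 addr0.
Qed.
HB.instance Definition _ :=
  GRing.isSubmodClosed.Build C csec is_holomorphic is_holomorphic_submod.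

Record H0 : Type := HolSec { hol_csec :> csec; _ : hol_csec \in is_holomorphic }.
HB.instance Definition _ := [isSub for hol_csec].
HB.instance Definition _ := [Choice of H0 by <:].
HB.instance Definition _ := [SubChoice_isSubLmodule of H0 by <:].

Definition is_exact : {pred csec} := fun a => `[< exists t, a = dbar t >].

Lemma is_exact_submod : submod_closed is_exact.
Proof.
split=> [|k a b /asboolP[s ->] /asboolP[t ->]]; apply/asboolP.
  by exists 0; rewrite linear0.
by exists (k *: s + t); rewrite linearP.
Qed.
HB.instance Definition _ :=
  GRing.isSubmodClosed.Build C csec is_exact is_exact_submod.

(* Dolbeault: (0,1)-forms modulo d-bar of sections; on a curve all (0,1)-forms
   are closed. *)
Definition H1 : Type := Quotient.quot is_exact.
HB.instance Definition _ := GRing.Zmodule.on H1.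
HB.instance Definition _ := EqQuotient.on H1.

Definition cls (a : csec) : H1 := \pi_H1 a.

Lemma cls_eq (a b : csec) : cls a = cls b <-> exists t, a - b = dbar t.
Proof.
rewrite /cls; split=> [/eqP|ab].
  by rewrite -[_ == _]Quotient.idealrBE => /asboolP.
by apply/eqP; rewrite -Quotient.idealrBE; apply/asboolP.
Qed.

Lemma cls_repr (y : H1) : cls (repr y) = y.
Proof. exact: reprK. Qed.

Lemma clsD (a b : csec) : cls (a + b) = cls a + cls b.
Proof. by rewrite /cls piE. Qed.

Definition H1_scale (k : C) (y : H1) : H1 := cls (k *: repr y).

Lemma H1_scale_cls (k : C) (a : csec) : H1_scale k (cls a) = cls (k *: a).
Proof.
have [t at_] := (cls_eq (repr (cls a)) a).1 (cls_repr _).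
by apply/cls_eq; exists (k *: t); rewrite -scalerBr at_ linearZ.
Qed.

Fact H1_scalerA (a b : C) (v : H1) :
  H1_scale a (H1_scale b v) = H1_scale (a * b) v.
Proof. by rewrite -[v]cls_repr !H1_scale_cls scalerA. Qed.
Fact H1_scale1r : left_id 1 H1_scale.
Proof. by move=> v; rewrite -[v]cls_repr !H1_scale_cls scale1r. Qed.
Fact H1_scalerDr : right_distributive H1_scale +%R.
Proof.
move=> k u v; rewrite -[u]cls_repr -[v]cls_repr.
by rewrite -clsD !H1_scale_cls -clsD scalerDr.
Qed.
Fact H1_scalerDl (v : H1) : {morph H1_scale^~ v : a b / a + b}.
Proof. by move=> a b; rewrite -[v]cls_repr !H1_scale_cls -clsD scalerDl. Qed.
HB.instance Definition _ := GRing.Zmodule_isLmodule.Build C H1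
  H1_scalerA H1_scale1r H1_scalerDr H1_scalerDl.

End FixedDegreeOperators.

Section Products.

Lemma automorphyD (N M m : int) (z : C) :
  automorphy tau (N + M) m z = automorphy tau N m z * automorphy tau M m z.
Proof.
rewrite /automorphy -expCD; congr expC; rewrite intrD.
by move: (N%:~R) (M%:~R) (m%:~R) => a b c; ring.
Qed.

Variables N M : int.

Lemma csec_mul_is_section (s : csec tau N) (t : csec tau M) :
  (s : C -> C) * (t : C -> C) \in is_section tau (N + M).
Proof.
have [ss qs] := csecP s; have [st qt] := csecP t.
apply/asboolP; split; first exact: smoothM.
by move=> m n z; rewrite !mulrfctE qs qt automorphyD mulrACA.
Qed.

(* L(N)[0,0] (x) L(M)[0,0] = L(N + M)[0,0] *)
Definition csec_mul (s : csec tau N) (t : csec tau M) : csec tau (N + M) :=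
  CSec (csec_mul_is_section s t).

End Products.

Definition m2l (N M : int) (x : H0 N) (y : H1 M) : H1 (N + M) :=
  cls (csec_mul x (repr y)).

Definition m2r (N M : int) (y : H1 N) (z : H0 M) : H1 (N + M) :=
  cls (csec_mul (repr y) z).

Lemma dbar_H0 (N : int) (x : H0 N) z : dzbar x z = 0.
Proof.
by case: x => s /= /eqP /(congr1 (fun u : csec tau N => (u : C -> C) z)).
Qed.

Lemma m2l_cls (N M : int) (x : H0 N) (a : csec tau M) :
  m2l x (cls a) = cls (csec_mul x a).
Proof.
have [t at_] := (cls_eq (repr (cls a)) a).1 (cls_repr _).
apply/cls_eq; exists (csec_mul x t); apply/val_inj/funext => z.
have [sx _] := csecP x; have [st _] := csecP t.
rewrite /= dzbarM; [|exact: smooth_cderivable|exact: smooth_cderivable].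
have /(congr1 (fun u : csec tau M => (u : C -> C) z)) /= <- := at_.
by rewrite dbar_H0 mul0r add0r; exact: (esym (mulrBr _ _ _)).
Qed.

Lemma m2r_cls (N M : int) (a : csec tau N) (x : H0 M) :
  m2r (cls a) x = cls (csec_mul a x).
Proof.
have [t at_] := (cls_eq (repr (cls a)) a).1 (cls_repr _).
apply/cls_eq; exists (csec_mul t x); apply/val_inj/funext => z.
have [sx _] := csecP x; have [st _] := csecP t.
rewrite /= dzbarM; [|exact: smooth_cderivable|exact: smooth_cderivable].
have /(congr1 (fun u : csec tau N => (u : C -> C) z)) /= <- := at_.
by rewrite dbar_H0 mulr0 addr0; exact: (esym (mulrBl _ _ _)).
Qed.

End Cohomology.

Section Tensors.
Variable K : fieldType.

Definition bilinear_map (U V W : lmodType K) (B : U -> V -> W) : Prop :=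
  (forall v, linear (B^~ v)) /\ (forall u, linear (B u)).

(* \sum_i u_i (x) v_i = \sum_j u'_j (x) v'_j in U (x)_K V, expressed by the
   universal property of the tensor product *)
Definition tensor_eq (U V : lmodType K) (I J : finType)
    (u : I -> U) (v : I -> V) (u' : J -> U) (v' : J -> V) : Prop :=
  forall (W : lmodType K) (B : U -> V -> W), bilinear_map B ->
    \sum_i B (u i) (v i) = \sum_j B (u' j) (v' j).

Definition tensor_eq0 (U V : lmodType K) (I : finType)
    (u : I -> U) (v : I -> V) : Prop :=
  forall (W : lmodType K) (B : U -> V -> W), bilinear_map B ->
    \sum_i B (u i) (v i) = 0.

End Tensors.

Section Massey.
Variables (R : realType) (tau : R[i]) (d1 d2 d : int) (I : finType).
Local Notation C := R[i].
Variables (x : I -> H0 tau d1) (y : I -> H1 tau (- d)) (z : I -> H0 tau d2).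

(* The family (x, y, z) stands for the tensor \sum_i x_i (x) y_i (x) z_i. *)
Definition in_K : Prop :=
  tensor_eq0 (fun i => m2l (x i) (y i)) z /\
  tensor_eq0 x (fun i => m2r (y i) (z i)).

Definition is_massey_value (r : H0 tau (d1 + d2 - d)) : Prop :=
  exists yt : I -> csec tau (- d), (forall i, cls (yt i) = y i) /\
  exists (J J' : finType)
    (t : J -> csec tau (d1 - d)) (z' : J -> H0 tau d2)
    (x' : J' -> H0 tau d1) (s : J' -> csec tau (- d + d2)),
  [/\ tensor_eq (fun i => csec_mul (x i) (yt i)) z (fun j => dbar (t j)) z',
      tensor_eq x (fun i => csec_mul (yt i) (z i)) x' (fun j => dbar (s j))
    & forall w : C,
        r w = \sum_j t j w * z' j w - \sum_j x' j w * s j w].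

(* At most one value exists when d1 < d and d2 < d, since then L_1 (x) L^-1 and
   L^-1 (x) L_2 have no nonzero holomorphic section. *)
Definition massey : H0 tau (d1 + d2 - d) := xget 0 [set r | is_massey_value r].

End Massey.

Section Bases.
Variables (R : realType) (tau : R[i]).
Local Notation C := R[i].

Definition theta_fun (N : nat) (k : nat) (z : C) : C :=
  csum (fun n : int => let m : C := (N%:Z * n + k%:Z)%:~R in
    expC (pii R * (tau / N%:R) * m ^+ 2 + 2 * pii R * m * z)).

(* F_{N,k}, which is a holomorphic section for 0 < N and tau in the upper
   half-plane *)
Definition theta (N : nat) (k : nat) : H0 tau N%:Z :=
  insubd 0 (insubd 0 (theta_fun N k) : csec tau N%:Z).

(* Integral of g against dx /\ dy over E_tau, for g invariant under
   Z tau + Z: the fundamental parallelogram is parametrized by a tau + b with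
   (a, b) in [0, 1]^2, whose Jacobian is Im tau. *)
Definition torus_int (g : C -> C) : C :=
  let int (u : C -> R) : R :=
    \int[lebesgue_measure]_(a in `[0, 1])
      \int[lebesgue_measure]_(b in `[0, 1]) u (a%:C * tau + b%:C) in
  (complex.Im tau)%:C *
  (int (fun w => complex.Re (g w)) +i* int (fun w => complex.Im (g w))).

(* The Serre pairing H^1(L(-N)) x H^0(L(N)) -> C, (a d(zbar), s) |->
   int_E a s kappa dz /\ d(zbar), where kappa dz trivializes the canonical
   bundle; dz /\ d(zbar) = - 2 i dx /\ dy. *)
Definition serre (kappa : C) (N : int) (y : H1 tau (- N)) (s : H0 tau N) : C :=
  torus_int (fun w => (repr y : csec tau (- N)) w * s w * kappa * (0 +i* - 2)).

(* The element of H^1(L(-d)) that is dual to F_{d,-j}; F_{d,k} and F_{d,-j}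
   coincide when d divides j + k. *)
Definition dual_basis (kappa : C) (d : nat) (j : nat) : H1 tau (- d%:Z) :=
  xget 0 [set y | forall k : 'I_d,
    serre kappa y (theta d k) = if (d %| j + k)%N then 1 else 0].

(* The F_{N,k} are linearly independent, so u is unique if it exists. *)
Definition coef (N : nat) (s : C -> C) (l : 'I_N) : C :=
  xget [ffun=> 0] [set u : {ffun 'I_N -> C} |
    forall z : C, s z = \sum_(i < N) u i * theta N i z] l.

End Bases.

Section UniversalMasseySystems.
Variables (R : realType) (kappa : R[i]) (d d1 d2 : nat).
Variable c : 'I_d1 -> 'I_d -> 'I_d2 -> R[i].
Local Notation I := ('I_d1 * 'I_d * 'I_d2)%type.

Definition massey_x (tau : R[i]) (p : I) : H0 tau d1%:Z :=
  c p.1.1 p.1.2 p.2 *: theta tau d1 p.1.1.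
Definition massey_y (tau : R[i]) (p : I) : H1 tau (- d%:Z) :=
  dual_basis tau kappa d p.1.2.
Definition massey_z (tau : R[i]) (p : I) : H0 tau d2%:Z := theta tau d2 p.2.

Definition universal_massey_system : Prop :=
  forall tau : R[i], 0 < complex.Im tau ->
    in_K (massey_x tau) (massey_y tau) (massey_z tau).

Definition MP (l : 'I_(d1 + d2 - d)) (tau : R[i]) : R[i] :=
  coef tau (massey (massey_x tau) (massey_y tau) (massey_z tau)) l.

End UniversalMasseySystems.

Section IndefiniteTheta.
Variable R : realType.
Local Notation C := R[i].

Definition is_lattice (L : set (rat * rat)) : Prop :=
  exists v w : rat * rat,
    (forall m n : int, v *~ m + w *~ n = 0 -> m = 0 /\ n = 0) /\
    L = [set x | exists m n : int, x = v *~ m + w *~ n].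

Definition doubly_periodic (f : rat * rat -> C) : Prop :=
  exists L1 L2 : set (rat * rat),
    [/\ is_lattice L1, is_lattice L2 & L1 `<=` L2] /\
    (forall x, f x != 0 -> L2 x) /\
    (forall x l, L1 l -> f (x + l) = f x).

Definition quadratic_form (a b c : rat) (p : rat * rat) : rat :=
  a * p.1 ^+ 2 + 2 * b * p.1 * p.2 + c * p.2 ^+ 2.

Definition admissible (a b c : rat) (f : rat * rat -> C) : Prop :=
  [/\ 0 < a, 0 < b, 0 < c & a * c < b ^+ 2] /\
  [/\ doubly_periodic f,
      forall m n, f (- m - 2 * b / a * n, n) = - f (m, n)
    & forall m n, f (m, - (2 * b / c) * m - n) = - f (m, n)].

Definition Theta (a b c : rat) (f : rat * rat -> C) (tau : C) : C :=
  let term p : C :=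
    f p * expC (2 * pii R * ratr (quadratic_form a b c p / 2) * tau) in
  csum (fun p : rat * rat => if (0 <= p.1) && (0 <= p.2) then term p else 0)
  - csum (fun p : rat * rat => if (p.1 < 0) && (p.2 < 0) then term p else 0).

End IndefiniteTheta.

(* Main.v *)
(* A smooth section of L(N)[0,0] is 1-periodic, hence given by its Fourier coefficients
   P_n(v), on which d-bar acts as a derivative in v.  In negative degree a (0,1)-form
   is exact if and only if, for all n, the primitive of its n-th coefficient that
   vanishes at -oo also vanishes at +oo; the Serre pairings are the values at +oo.
   Consequently the g_j are represented by a Gaussian in Im z times conjugate theta
   functions, whose primitives are translates of a Gaussian distribution function chi,
   and the t_k and s_i in the Massey product are explicit series in chi.  Their
   existence amounts to the vanishing of certain sums of coefficients c_ijk against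
   powers of q, which is the antisymmetry of f under A and B.

   A coefficient of MP is then a difference of two iterated sums of the same terms
   c(m, n, l) q^(...) chi, summed in different orders.  By the same vanishing, chi may
   be replaced by chi - [Y > 0] in the first and by chi - [X >= 0] in the second, for
   linear forms X in m and Y in l.  The Gaussian tails of chi compensate the
   indefiniteness of the exponent, so both double sums converge absolutely, chi
   cancels, and the indefinite theta series with signs [X >= 0] - [Y > 0] remains. *)
Require Import Defs.
From mathcomp Require Import all_boot all_order all_algebra.
From mathcomp Require Import all_classical all_reals all_analysis.
From mathcomp Require Import complex ring lra zify finmap.
Set Implicit Arguments.
Unset Strict Implicit.
Unset Printing Implicit Defensive.
Import Order.TTheory GRing.Theory Num.Theory.
Import numFieldNormedType.Exports.
Import ComplexField Normc.
Local Open Scope classical_set_scope.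
Local Open Scope complex_scope.
Local Open Scope ring_scope.

(** * Sums of complex families *)

Section ComplexNorm.
Variable R : realType.
Local Notation C := R[i].
Implicit Types (z w : C).

(** The exponent m^2/d1 + l^2/d2 - (s - m - l)^2/d of the Massey series has the critical point (s
    d1/d0, s d2/d0). In coordinates centred there the quadratic form does not depend on s, and after
    reversing the sign of one coordinate its cross term is positive, as in Q. Comparing the three
    coefficients forces d : d1 : d2 = b : b^2/(a + b) : b^2/(b + c). Then a, c > 0 give d1, d2 < d,
    and b^2 > a c is exactly d0 > 0. With s and l fixed the exponent is a quadratic polynomial in m
    and A is its reflection; with s and m fixed, B is the reflection in l. An antisymmetric f
    therefore makes the inner sums cancel in pairs for every tau at once, as constants c_ijk
    independent of tau require. The point (x, y) is proportional to (X, - Y), so [X >= 0] - [Y > 0]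
    is 1 on x, y >= 0, is -1 on x, y < 0 and 0 elsewhere: the strictness of the two signs is
    dictated by Theta. Each s in Z/d0 whose critical point is integral contributes the whole of
    Theta and every other s contributes 0, whence the division of the c_ijk by the number of such
    s. *)

Definition cnorm z : R := normc z.

Lemma cnormM z w : cnorm (z * w) = cnorm z * cnorm w.
Proof. exact: normcM. Qed.

Lemma cnormD z w : cnorm (z + w) <= cnorm z + cnorm w.
Proof. exact: le_normcD. Qed.

Lemma cnormN z : cnorm (- z) = cnorm z.
Proof. exact: normcN. Qed.

Lemma cnormB z w : cnorm (z - w) <= cnorm z + cnorm w.
Proof. by rewrite -(cnormN w) cnormD. Qed.

Lemma cnorm0 : cnorm 0 = 0.
Proof. exact: normc0. Qed.

Lemma cnorm1 : cnorm 1 = 1.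
Proof. exact: normc1. Qed.

Lemma cnormV z : cnorm z^-1 = (cnorm z)^-1.
Proof. exact: normcV. Qed.

Lemma cnorm_ge0 z : 0 <= cnorm z.
Proof. by case: z => a b; rewrite /cnorm /normc sqrtr_ge0. Qed.

Lemma cnorm_eq0 z : (cnorm z == 0) = (z == 0).
Proof. by apply/eqP/eqP => [/eq0_normc//|->]; exact: cnorm0. Qed.

Lemma cnorm_gt0 z : (0 < cnorm z) = (z != 0).
Proof. by rewrite lt_def cnorm_ge0 cnorm_eq0 andbT. Qed.

Lemma cnorm_real (x : R) : cnorm x%:C = `|x|.
Proof. by rewrite /cnorm /normc /= expr0n /= addr0 sqrtr_sqr. Qed.

Lemma cnorm_im (x : R) : cnorm (0 +i* x) = `|x|.
Proof. by rewrite /cnorm /normc /= expr0n /= add0r sqrtr_sqr. Qed.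

Lemma Re_le_cnorm z : `|complex.Re z| <= cnorm z.
Proof.
case: z => a b; rewrite /cnorm /normc /=.
by rewrite -sqrtr_sqr ler_sqrt ?addr_ge0 ?sqr_ge0// lerDl sqr_ge0.
Qed.

Lemma Im_le_cnorm z : `|complex.Im z| <= cnorm z.
Proof.
case: z => a b; rewrite /cnorm /normc /=.
by rewrite -sqrtr_sqr ler_sqrt ?addr_ge0 ?sqr_ge0// lerDr sqr_ge0.
Qed.

Lemma ReDIm z : z = (complex.Re z)%:C + (0 +i* complex.Im z).
Proof. by case: z => a b; rewrite addCE addr0 add0r. Qed.

Lemma cnorm_le z : cnorm z <= `|complex.Re z| + `|complex.Im z|.
Proof. by rewrite {1}(ReDIm z) (le_trans (cnormD _ _))// cnorm_real cnorm_im. Qed.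

Lemma cnorm_sum I (r : seq I) (P : pred I) (F : I -> C) :
  cnorm (\sum_(i <- r | P i) F i) <= \sum_(i <- r | P i) cnorm (F i).
Proof.
elim/big_rec2: _ => [|i y x _ yx]; first by rewrite cnorm0.
by rewrite (le_trans (cnormD _ _))// lerD2l.
Qed.

Lemma cnorm_expC z : cnorm (expC z) = expR (complex.Re z).
Proof.
rewrite /expC /cnorm /normc !exprMn -mulrDr cos2Dsin2 mulr1 sqrtr_sqr.
by rewrite ger0_norm ?expR_ge0.
Qed.

Lemma expC0 : expC (0 : C) = 1.
Proof. by rewrite /expC /= expR0 cos0 sin0 mul1r mulr0. Qed.

Lemma expC_neq0 z : expC z != 0.
Proof. by rewrite -cnorm_gt0 cnorm_expC expR_gt0. Qed.

Lemma expCN z : expC (- z) = (expC z)^-1.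
Proof.
by apply: (mulIf (expC_neq0 z)); rewrite -expCD addNr expC0 mulVf ?expC_neq0.
Qed.

Lemma ReM z w : complex.Re (z * w) =
  complex.Re z * complex.Re w - complex.Im z * complex.Im w.
Proof. by case: z; case: w. Qed.

Lemma ImM z w : complex.Im (z * w) =
  complex.Re z * complex.Im w + complex.Im z * complex.Re w.
Proof. by case: z; case: w. Qed.

Lemma ReD z w : complex.Re (z + w) = complex.Re z + complex.Re w.
Proof. by case: z; case: w. Qed.

Lemma ImD z w : complex.Im (z + w) = complex.Im z + complex.Im w.
Proof. by case: z; case: w. Qed.

Lemma ReN z : complex.Re (- z) = - complex.Re z.
Proof. by case: z. Qed.

Lemma ImN z : complex.Im (- z) = - complex.Im z.
Proof. by case: z. Qed.

Lemma intrC (n : int) : (n%:~R : C) = (n%:~R : R)%:C.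
Proof. by rewrite rmorph_int. Qed.

Lemma natrC (n : nat) : (n%:R : C) = (n%:R : R)%:C.
Proof. by rewrite rmorph_nat. Qed.

Lemma Re_int (n : int) : complex.Re (n%:~R : C) = n%:~R.
Proof. by rewrite intrC. Qed.

Lemma Im_int (n : int) : complex.Im (n%:~R : C) = 0.
Proof. by rewrite intrC. Qed.

Lemma expC_2piint (n : int) : expC (2 * pii R * n%:~R) = 1 :> C.
Proof.
have nat_case (m : nat) : expC (2 * pii R * m%:R) = 1 :> C.
  elim: m => [|m IH]; first by rewrite mulr0 expC0.
  rewrite [m.+1%:R]mulrSr mulrDr expCD IH mul1r mulr1.
  rewrite (_ : 2 * pii R = 0 +i* (pi *+ 2)).
    by rewrite /expC /= expR0 cos2pi sin2pi !mul1r.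
  by rewrite natrC /pii mulCE !mulr0 !mul0r subr0 addr0 mulr_natl.
case: n => m; first exact: nat_case.
by rewrite NegzE mulrNz mulrN expCN nat_case invr1.
Qed.

End ComplexNorm.

(** * Unconditional sums: domination, Tannery, reindexing, Fubini *)

Section Sums.
Variable R : realType.
Local Notation C := R[i].

(** Convergence of the net of finite partial sums. [csum] is a limit operator, with an arbitrary
    value where there is no limit, so it is always evaluated through this relation and
    [has_sum_csum]. *)
Definition has_sum (I : choiceType) (x : I -> C) (s : C) : Prop :=
  forall e : R, 0 < e -> exists A : {fset I}, forall B : {fset I},
    (A `<=` B)%fset -> cnorm (\sum_(i <- B) x i - s) < e.

(** Summable majorants: for nonnegative families, bounded finite partial sums are all that absolute
    convergence asks for. *)
Definition bsum (I : choiceType) (M : I -> R) : Prop :=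
  (forall i, 0 <= M i) /\ exists K, forall B : {fset I}, \sum_(i <- B) M i <= K.

Lemma fsum_setM (V : nmodType) (I J : choiceType) (A : {fset I}) (B : {fset J})
    (F : I * J -> V) :
  \sum_(p <- (A `*` B)%fset) F p = \sum_(i <- A) \sum_(j <- B) F (i, j).
Proof.
rewrite -[RHS](big_allpairs (F := F)); apply/perm_big/uniq_perm; first exact: fset_uniq.
  by apply: allpairs_uniq => // -[? ?] [? ?].
move=> [i j]; rewrite !inE /=; apply/idP/allpairsP => [/andP[iA jB]|].
  by exists (i, j).
by move=> [[i' j'] /= [iA jB [-> ->]]]; rewrite iA jB.
Qed.

Section OneIndex.
Variable I : choiceType.
Implicit Types (x y : I -> C) (s : C) (M N : I -> R).

Lemma bsumW M N : bsum N -> (forall i, 0 <= M i <= N i) -> bsum M.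
Proof.
move=> [N0 [K NK]] MN; split=> [i|]; first by case/andP: (MN i).
exists K => B; apply: le_trans (NK B); apply: ler_sum => i _.
by case/andP: (MN i).
Qed.

Lemma bsumZ (k : R) M : 0 <= k -> bsum M -> bsum (fun i => k * M i).
Proof.
move=> k0 [M0 [K MK]]; split=> [i|]; first exact: mulr_ge0.
by exists (k * K) => B; rewrite -mulr_sumr ler_wpM2l.
Qed.

Lemma bsumD M N : bsum M -> bsum N -> bsum (fun i => M i + N i).
Proof.
move=> [M0 [K MK]] [N0 [L NL]]; split=> [i|]; first exact: addr_ge0.
by exists (K + L) => B; rewrite big_split lerD.
Qed.

Lemma fsum_setU (V : nmodType) (A B : {fset I}) (F : I -> V) :
  [disjoint A & B]%fset ->
  \sum_(i <- (A `|` B)%fset) F i = \sum_(i <- A) F i + \sum_(i <- B) F i.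
Proof.
move=> dAB; rewrite -big_cat; apply/perm_big/uniq_perm; first exact: fset_uniq.
  rewrite cat_uniq !fset_uniq /= andbT -all_predC; apply/allP => i iB /=.
  by move: dAB; rewrite fdisjoint_sym => /fdisjointP; apply.
by move=> i; rewrite mem_cat inE.
Qed.

Lemma fsum_setD (V : nmodType) (A B : {fset I}) (F : I -> V) :
  (A `<=` B)%fset ->
  \sum_(i <- B) F i = \sum_(i <- A) F i + \sum_(i <- (B `\` A)%fset) F i.
Proof.
move=> AB; rewrite -fsum_setU; last first.
  by apply/fdisjointP => i iA; rewrite inE iA.
congr (\sum_(i <- enum_fset _) _); apply/fsetP => i; rewrite !inE.
by case: (boolP (i \in A)) => //= /(fsubsetP AB) ->.
Qed.

Lemma bsum_tail M (e : R) : bsum M -> 0 < e ->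
  exists A : {fset I}, forall B : {fset I},
    [disjoint A & B]%fset -> \sum_(i <- B) M i < e.
Proof.
move=> [M0 [K MK]] e0.
pose S : set R := [set r | exists B : {fset I}, r = \sum_(i <- B) M i].
have hS : has_sup S.
  split; first by exists (\sum_(i <- fset0) M i), fset0.
  by exists K => _ [B ->].
have [_ [A ->] sA] := sup_adherent e0 hS.
exists A => B dAB; rewrite -(ltrD2l (\sum_(i <- A) M i)) -fsum_setU//.
apply: le_lt_trans (_ : sup S < _); last by rewrite -ltrBlDr.
by apply: ub_le_sup; [exact: hS.2|exists (A `|` B)%fset].
Qed.

Lemma has_sum_unique x s t : has_sum x s -> has_sum x t -> s = t.
Proof.
move=> xs xt; apply/eqP; rewrite -subr_eq0 -cnorm_eq0; apply/eqP.
apply/eqP; rewrite eq_le cnorm_ge0 andbT; apply/ler_addgt0Pl => e e0.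
have e2 : 0 < e / 2 by rewrite divr_gt0.
have [A hA] := xs _ e2; have [B hB] := xt _ e2.
have := hA (A `|` B)%fset (fsubsetUl _ _).
have := hB (A `|` B)%fset (fsubsetUr _ _).
move: (\sum_(_ <- _) _) => u ut us; rewrite addr0.
rewrite (_ : s - t = (u - t) - (u - s)); last by ring.
apply: le_trans (cnormB _ _) _; lra.
Qed.

Lemma has_sumD x y s t : has_sum x s -> has_sum y t ->
  has_sum (fun i => x i + y i) (s + t).
Proof.
move=> xs yt e e0; have e2 : 0 < e / 2 by rewrite divr_gt0.
have [A hA] := xs _ e2; have [B hB] := yt _ e2.
exists (A `|` B)%fset => D; rewrite fsubUset => /andP[AD BD].
rewrite big_split /= opprD addrACA (le_lt_trans (cnormD _ _))//.
have := hA _ AD; have := hB _ BD; lra.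
Qed.

Lemma has_sumZ (k : C) x s : has_sum x s -> has_sum (fun i => k * x i) (k * s).
Proof.
move=> xs e e0; have k0 : 0 < 1 + cnorm k by rewrite ltr_wpDr// cnorm_ge0.
have [A hA] := xs _ (divr_gt0 e0 k0); exists A => B AB.
rewrite -mulr_sumr -mulrBr cnormM.
have := hA _ AB; rewrite ltr_pdivlMr// => h; apply: le_lt_trans h.
by rewrite mulrC ler_wpM2l ?cnorm_ge0// lerDr.
Qed.

Lemma has_sumN x s : has_sum x s -> has_sum (fun i => - x i) (- s).
Proof.
move=> /(has_sumZ (-1)); rewrite mulN1r.
by under [X in has_sum X]funext do rewrite mulN1r.
Qed.

Lemma has_sumB x y s t : has_sum x s -> has_sum y t ->
  has_sum (fun i => x i - y i) (s - t).
Proof. by move=> xs /has_sumN yt; exact: has_sumD. Qed.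

Lemma has_sum0 : has_sum (fun _ : I => 0) 0.
Proof.
by move=> e e0; exists fset0 => B _; rewrite big1// subr0 cnorm0.
Qed.

Lemma has_sum_fin (J : Type) (r : seq J) (x : J -> I -> C) (s : J -> C) :
  (forall j, has_sum (x j) (s j)) ->
  has_sum (fun i => \sum_(j <- r) x j i) (\sum_(j <- r) s j).
Proof.
move=> xs; elim: r => [|j r IH].
  rewrite big_nil (_ : (fun _ => _) = fun=> 0); first exact: has_sum0.
  by apply/funext => i; rewrite big_nil.
rewrite big_cons (_ : (fun _ => _) = fun i => x j i + \sum_(j <- r) x j i).
  exact: has_sumD.
by apply/funext => i; rewrite big_cons.
Qed.

Lemma has_sum_nneg M : bsum M ->
  has_sum (fun i => (M i)%:C)
    (sup [set r | exists B : {fset I}, r = \sum_(i <- B) M i])%:C.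
Proof.
move=> [M0 [K MK]] e e0; set S := [set r | _].
have hS : has_sup S.
  split; first by exists (\sum_(i <- fset0) M i), fset0.
  by exists K => _ [B ->].
have [_ [A ->] sA] := sup_adherent e0 hS; exists A => B AB.
rewrite -(rmorph_sum (real_complex R)) -rmorphB cnorm_real distrC ger0_norm; last first.
  by rewrite subr_ge0; apply: ub_le_sup; [exact: hS.2|exists B].
rewrite ltrBlDr -ltrBlDl; apply: lt_le_trans sA _.
by rewrite (fsum_setD _ AB) lerDl sumr_ge0.
Qed.

(** A real y dominated by M is the difference of the nonnegative summable families y + M and M; a
    complex family splits into real and imaginary parts. *)
Lemma has_sum_ex M x : bsum M -> (forall i, cnorm (x i) <= M i) ->
  exists s, has_sum x s.
Proof.
move=> bM xM.
have real_case (y : I -> R) : (forall i, `|y i| <= M i) ->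
    exists s, has_sum (fun i => (y i)%:C) s.
  move=> yM; have bN : bsum (fun i => y i + M i).
    apply: (bsumW (bsumD bM bM)) => i; have := yM i; rewrite ler_norml => /andP[].
    by move=> h1 h2; apply/andP; split; lra.
  eexists; have := has_sumB (has_sum_nneg bN) (has_sum_nneg bM).
  by under [X in has_sum X]funext do rewrite -rmorphB /= addrK; apply.
have [s hs] := real_case _ (fun i => le_trans (Re_le_cnorm (x i)) (xM i)).
have [t ht] := real_case _ (fun i => le_trans (Im_le_cnorm (x i)) (xM i)).
exists (s + (0 +i* 1) * t); have := has_sumD hs (has_sumZ (0 +i* 1) ht).
rewrite (_ : (fun i => _) = x)//; apply/funext => i.
case: (x i) => a b /=; rewrite mulCE addCE; congr (_ +i* _); ring.
Qed.

(** The finite set A depends on the majorant alone and not on x. This uniformity is what the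
    interchange of sums with limits, integrals and other sums rests on. *)
Lemma has_sum_tail M (e : R) : bsum M -> 0 < e ->
  exists A : {fset I}, forall x s B, (forall i, cnorm (x i) <= M i) ->
    has_sum x s -> (A `<=` B)%fset -> cnorm (\sum_(i <- B) x i - s) <= e.
Proof.
move=> bM e0; have [A hA] := bsum_tail bM e0; exists A => x s B xM xs AB.
apply/ler_addgt0Pl => f f0; have [D hD] := xs _ f0.
have := hD (D `|` B)%fset (fsubsetUl _ _).
rewrite (fsum_setD _ (fsubsetUr D B)).
set u := \sum_(i <- B) x i; set v := \sum_(i <- _) x i => h.
rewrite (_ : u - s = (u + v - s) - v); last by ring.
apply: le_trans (cnormB _ _) _; apply: lerD; first exact: ltW.
apply: le_trans (cnorm_sum _ _ _) _; apply/ltW.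
apply: le_lt_trans (_ : \sum_(i <- ((D `|` B) `\` B)%fset) M i < _).
  exact: ler_sum.
apply: hA; apply/fdisjointP => i iA; rewrite inE negb_and negbK.
by rewrite (fsubsetP AB).
Qed.

Lemma has_sum_csum x s : has_sum x s -> csum x = s.
Proof.
move=> xs.
have P (J : {fset I}) (u : I -> R) :
    summability.partial_sum u J = \sum_(i <- J) u i.
  by rewrite /summability.partial_sum big_seq_fsetE.
have lim_of (p : C -> R) : (forall z w, p (z + w) = p z + p w) -> p 0 = 0 ->
    (forall z, p (- z) = - p z) -> (forall z, `|p z| <= cnorm z) ->
    summability.sum (fun i => p (x i)) = p s.
  move=> pD p0 pN ple; have FF := @summability.totally_filter I.
  apply: cvg_lim; first exact: norm_hausdorff.
  apply/cvgrPdist_lt => e e0.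
  have [A hA] := xs _ e0; exists A => // B AB /=.
  rewrite P -(big_morph p pD p0) -normrN opprB -pN -pD.
  by apply: le_lt_trans (ple _) _; exact: hA.
rewrite /csum !lim_of; first by case: s {xs lim_of}.
- exact: ImD. - by []. - exact: ImN. - exact: Im_le_cnorm.
- exact: ReD. - by []. - exact: ReN. - exact: Re_le_cnorm.
Qed.

Definition ctends (T : Type) (F : set_system T) (f : T -> C) (l : C) : Prop :=
  forall e : R, 0 < e -> \forall t \near F, cnorm (f t - l) < e.

(* Tannery's theorem *)
Lemma has_sum_ctends (T : Type) (F : set_system T) {FF : Filter F} M
    (x : T -> I -> C) (l : I -> C) (S : T -> C) (s : C) :
  bsum M -> (\forall t \near F, forall i, cnorm (x t i) <= M i) ->
  (forall i, cnorm (l i) <= M i) ->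
  (forall i, ctends F (fun t => x t i) (l i)) ->
  (\forall t \near F, has_sum (x t) (S t)) -> has_sum l s -> ctends F S s.
Proof.
move=> bM xM lM xl xS ls e e0.
have e4 : 0 < e / 4 by rewrite divr_gt0.
have [A hA] := has_sum_tail bM e4.
have fin : \forall t \near F, cnorm (\sum_(i <- A) x t i - \sum_(i <- A) l i) < e / 4.
  elim: (enum_fset A) (e / 4) e4 => [|i r IH] f f0.
    by apply: nearW => t; rewrite !big_nil subr0 cnorm0.
  have f2 : 0 < f / 2 by rewrite divr_gt0.
  have h1 := IH _ f2; have h2 := xl i _ f2.
  near=> t; rewrite !big_cons opprD addrACA (le_lt_trans (cnormD _ _))//.
  have : cnorm (x t i - l i) < f / 2 by near: t.
  have : cnorm (\sum_(i <- r) x t i - \sum_(i <- r) l i) < f / 2 by near: t.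
  lra.
near=> t.
have h1 : cnorm (\sum_(i <- A) x t i - \sum_(i <- A) l i) < e / 4 by near: t.
have h2 : cnorm (\sum_(i <- A) x t i - S t) <= e / 4.
  by apply: hA => //; near: t.
have h3 : cnorm (\sum_(i <- A) l i - s) <= e / 4 by apply: hA.
move: h1 h2 h3; set u := \sum_(_ <- _) _; set v := \sum_(_ <- _) _ => h1 h2 h3.
rewrite (_ : S t - s = (u - v) - (u - S t) + (v - s)); last by ring.
apply: le_lt_trans (cnormD _ _) _.
have := cnormB (u - v) (u - S t); lra.
Unshelve. all: by end_near. Qed.

End OneIndex.

Lemma has_sum_eq (I : choiceType) (x y : I -> C) s :
  x =1 y -> has_sum x s -> has_sum y s.
Proof. by move=> /funext ->. Qed.

Lemma has_sum_inj (I J : choiceType) (h : I -> J) (x : J -> C) s :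
  injective h -> (forall j, ~ (exists i, j = h i) -> x j = 0) ->
  has_sum (fun i => x (h i)) s -> has_sum x s.
Proof.
move=> hI x0 xs e e0; have [A hA] := xs _ e0.
exists (h @` A)%fset => B AB.
(* D is the preimage of B under h, made finite by a partial inverse g; the elements of B outside the
   image carry zero terms. *)
have [D DP] : exists D : {fset I}, forall i, (i \in D) = (h i \in B).
  pose g j := if pselect (exists i, j = h i) is left p then Some (projT1 (cid p)) else None.
  have gh i : g (h i) = Some i.
    rewrite /g; case: pselect => [p|]; last by case; exists i.
    by congr Some; apply: hI; exact/esym/(projT2 (cid p)).
  exists [fset i | i in pmap g (enum_fset B)]%fset => i.
  rewrite !inE /= mem_pmap; apply/mapP/idP => [[j jB]|hB].
    rewrite /g; case: pselect => // p [] ->.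
    by rewrite -(projT2 (cid p)).
  by exists (h i).
have -> : \sum_(j <- B) x j = \sum_(i <- D) x (h i).
  have hD : (h @` D `<=` B)%fset.
    by apply/fsubsetP => _ /imfsetP[i /= iD ->]; rewrite -DP.
  rewrite (fsum_setD _ hD) [X in _ + X]big1_fset ?addr0.
    by rewrite big_imfset //= => i j _ _; exact: hI.
  move=> j; rewrite inE => /andP[jD jB] _; apply: x0 => -[i ji].
  by move/negP: jD; apply; apply/imfsetP; exists i => //=; rewrite DP -ji.
apply: hA; apply/fsubsetP => i iA; rewrite DP.
by apply: (fsubsetP AB); apply/imfsetP; exists i.
Qed.

Lemma has_sum_bij (I J : choiceType) (h : I -> J) (k : J -> I) (x : J -> C) s :
  cancel h k -> cancel k h -> has_sum (fun i => x (h i)) s -> has_sum x s.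
Proof.
move=> hk kh; apply: has_sum_inj; first exact: can_inj hk.
by move=> j; case; exists (k j).
Qed.

Lemma bsum_comp (I J : choiceType) (h : I -> J) (M : J -> R) :
  injective h -> bsum M -> bsum (fun i => M (h i)).
Proof.
move=> hI [M0 [K MK]]; split=> [i|]; first exact: M0.
exists K => B; apply: le_trans (MK (h @` B)%fset).
by rewrite big_imfset //= => i j _ _; exact: hI.
Qed.

Lemma bsum_pair (I J : choiceType) (M : I -> R) (N : J -> R) :
  bsum M -> bsum N -> bsum (fun p : I * J => M p.1 * N p.2).
Proof.
move=> [M0 [K MK]] [N0 [L NL]]; split=> [p|]; first exact: mulr_ge0.
exists (K * L) => B.
pose B1 := [fset p.1 | p in B]%fset; pose B2 := [fset p.2 | p in B]%fset.
apply: le_trans (_ : \sum_(p <- (B1 `*` B2)%fset) M p.1 * N p.2 <= _).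
  have sB : (B `<=` B1 `*` B2)%fset.
    apply/fsubsetP => p pB; rewrite !inE; apply/andP; split.
      by apply/imfsetP; exists p.
    by apply/imfsetP; exists p.
  by rewrite (fsum_setD _ sB) lerDl sumr_ge0// => p _; exact: mulr_ge0.
rewrite fsum_setM /=; under eq_bigr do rewrite -mulr_sumr.
by rewrite -mulr_suml; apply: ler_pM; rewrite ?sumr_ge0.
Qed.

Lemma has_sum_fubini (I J : choiceType) (M : I * J -> R) (x : I -> J -> C)
    (r : I -> C) (s : C) :
  bsum M -> (forall i j, cnorm (x i j) <= M (i, j)) ->
  (forall i, has_sum (x i) (r i)) -> has_sum (fun p => x p.1 p.2) s ->
  has_sum r s.
Proof.
move=> bM xM xr xs e e0; have e3 : 0 < e / 3 by rewrite divr_gt0.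
have xM' p : cnorm (x p.1 p.2) <= M p by case: p => ? ?; exact: xM.
have [A hA] := has_sum_tail bM e3.
exists [fset p.1 | p in A]%fset => B AB.
have [n nB] : exists n : nat, (#|` B|%fset <= n)%N by exists #|` B|%fset.
have f0 : 0 < e / 3 / n.+1%:R by rewrite divr_gt0.
have rD i : exists D : {fset J}, forall D', (D `<=` D')%fset ->
    cnorm (\sum_(j <- D') x i j - r i) < e / 3 / n.+1%:R by exact: xr.
have [D hD] := choice rD.
(* The columns E serve two purposes: they nearly exhaust every row of B, and B x E contains the set
   A outside which the double sum is small. *)
pose E := (\bigcup_(i <- B) D i `|` [fset p.2 | p in A])%fset.
have h1 : cnorm (\sum_(i <- B) \sum_(j <- E) x i j - \sum_(i <- B) r i) <= e / 3.
  rewrite -sumrB; apply: le_trans (cnorm_sum _ _ _) _.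
  apply: le_trans (_ : \sum_(i <- B) e / 3 / n.+1%:R <= _).
    rewrite big_seq [leRHS]big_seq; apply: ler_sum => i iB; apply/ltW/hD.
    by apply: fsubset_trans (fsubsetUl _ _); exact: bigfcup_sup.
  rewrite big_const_seq count_predT iter_addr addr0.
  move: (e / 3) e3 => f f1.
  by rewrite -[_ *+ size _]mulr_natr mulrAC ler_pdivrMr// ler_pM2l// ler_nat leqW.
have h2 : cnorm (\sum_(i <- B) \sum_(j <- E) x i j - s) <= e / 3.
  rewrite -(fsum_setM _ _ (fun p => x p.1 p.2)); apply: hA => //.
  apply/fsubsetP => p pA; rewrite !inE; apply/andP; split.
    by apply: (fsubsetP AB); apply/imfsetP; exists p.
  by apply/orP; right; apply/imfsetP; exists p.
move: h1 h2; set u := \sum_(_ <- _) _; set v := \sum_(_ <- _) _ => h1 h2.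
rewrite (_ : v - s = (u - s) - (u - v)); last by ring.
by apply: le_lt_trans (cnormB _ _) _; lra.
Qed.

End Sums.

(** * Integrals over the unit interval *)

Section RealIntegral.
Variable R : realType.
Implicit Types (f g : R -> R) (a b x y : R).
Local Notation mu := (@lebesgue_measure R).

Definition int01 f : R := \int[mu]_(x in `[0, 1]) f x.

Lemma continuous_integrable f a b :
  continuous f -> mu.-integrable `[a, b] (EFin \o f).
Proof.
by move=> cf; apply: continuous_compact_integrable;
  [exact: segment_compact|exact: continuous_subspaceT].
Qed.

Lemma is_derive_continuous f df : (forall x, is_derive x 1 f (df x)) ->
  continuous f.
Proof.
move=> fd x; apply/differentiable_continuous/derivable1_diffP.
by have [] := fd x.
Qed.

Lemma int01D f g : continuous f -> continuous g ->
  int01 (f \+ g) = int01 f + int01 g.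
Proof. by move=> cf cg; apply: RintegralD => //; exact: continuous_integrable. Qed.

Lemma int01Z k f : continuous f -> int01 (fun x => k * f x) = k * int01 f.
Proof. by move=> cf; apply: RintegralZl => //; exact: continuous_integrable. Qed.

Lemma int01_cst k : int01 (fun=> k) = k.
Proof.
rewrite /int01 Rintegral_cst//= lebesgue_measure_itv /= lte01 EFinN oppe0 adde0.
by rewrite mulr1.
Qed.

Lemma int01_le f g : continuous f -> continuous g ->
  (forall x, 0 <= x <= 1 -> f x <= g x) -> int01 f <= int01 g.
Proof.
move=> cf cg fg.
by apply: le_Rintegral (continuous_integrable _ _ cf) (continuous_integrable _ _ cg) fg.
Qed.

Lemma eq_int01 f g : (forall x, 0 <= x <= 1 -> f x = g x) -> int01 f = int01 g.
Proof.
move=> fg; apply: eq_Rintegral => x /set_mem; rewrite /= in_itv /=; exact: fg.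
Qed.

Lemma int01_norm f K : continuous f -> (forall x, 0 <= x <= 1 -> `|f x| <= K) ->
  `|int01 f| <= K.
Proof.
move=> cf fK; rewrite ler_norml; apply/andP; split.
  rewrite -(int01_cst (- K)); apply: int01_le => //; first exact: cst_continuous.
  by move=> x /fK; rewrite ler_norml => /andP[].
rewrite -[leRHS](int01_cst K); apply: int01_le => //; first exact: cst_continuous.
by move=> x /fK; rewrite ler_norml => /andP[].
Qed.

Lemma int01_FTC f F : continuous f -> (forall x, is_derive x 1 F (f x)) ->
  int01 f = F 1 - F 0.
Proof.
move=> cf dF; rewrite /int01 /Rintegral (@continuous_FTC2 _ f F)//.
- exact: continuous_subspaceT.
- have cF := is_derive_continuous dF; split.
  + by move=> x _; have [] := dF x.
  + exact/cvg_at_right_filter/cF.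
  + exact/cvg_at_left_filter/cF.
- by move=> x _; rewrite derive1E; have [] := dF x.
Qed.

(** The fundamental theorem of calculus starts from a finite lower bound - k, which has to move with
    x. Subtracting the value at 0 removes the dependence on k, so near x the fixed k = 2 + |x| may
    be used. *)
Lemma primitive_ex f : continuous f -> exists F, forall x, is_derive x 1 F (f x).
Proof.
move=> cf.
pose G k x := \int[mu]_(t in `[- k, x]) f t.
have dG k x : - k < x -> is_derive x 1 (G k) (f x).
  move=> kx; have xx : x < x + 1 by rewrite ltrDl.
  have [d1 d2] := @continuous_FTC1_closed _ f (- k) x _ xx
    (continuous_integrable _ _ cf) kx (cf x).
  split; [exact: d1|].
  rewrite -(derive1E (G k)).
  exact: d2.
exists (fun x => G (1 + `|x|) x - G (1 + `|x|) 0) => x.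
pose k := 1 + `|x| + 1.
apply: (@near_eq_is_derive _ _ _ (fun t => G k t - G k 0)); last first.
  have kx : - k < x by rewrite /k; have := ler_norm (- x); rewrite normrN; lra.
  by apply: is_derive_eq (is_deriveB (dG k x kx) (is_derive_cst _ _ _)) _; rewrite subr0.
have : \forall t \near x, `|x - t| < 1.
  by apply: (@cvgr_dist_lt _ _ _ (nbhs x) _ id x).
apply: filterS => t xt.
have tk : 1 + `|t| <= k.
  by rewrite /k; have := ler_normD (t - x) x; rewrite subrK distrC; lra.
have spl y : - (1 + `|t|) <= y ->
    G k y = G k (- (1 + `|t|)) + \int[mu]_(s in `]- (1 + `|t|), y]) f s.
  move=> ty; have := @Rintegral_itvB _ f (BLeft (- k)) (BRight y) (- (1 + `|t|))
    (continuous_integrable _ _ cf); rewrite !bnd_simp => <- //.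
    by rewrite addrC subrK.
  by rewrite lerN2.
have op y : G (1 + `|t|) y = \int[mu]_(s in `]- (1 + `|t|), y]) f s.
  rewrite /G Rintegral_itv_obnd_cbnd//.
  apply: (integrableS _ _ _ (continuous_integrable (- (1 + `|t|)) y cf)) => //.
  by apply: subset_itvr; rewrite bnd_simp.
rewrite (spl t) ?(spl 0) ?op.
- by move: (G _ _) (Rintegral _ _ _) (Rintegral _ _ _) => A B D; ring.
- by have := normr_ge0 t; lra.
- by have := ler_norm (- t); rewrite normrN; lra.
Qed.

(** For a primitive F, the function F (x + 1) - F x has derivative 0; its values at s and at 0 are
    the two integrals. *)
Lemma int01_shift f s : continuous f -> (forall x, f (x + 1) = f x) ->
  int01 (fun x => f (x + s)) = int01 f.
Proof.
move=> cf f1; have [F dF] := primitive_ex cf.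
have sh (c x : R) : is_derive x 1 (fun x => F (x + c)) (f (x + c)).
  have ds : is_derive x 1 (fun y : R => y + c) 1.
    by apply: is_derive_eq (is_deriveD (is_derive_id _ _) (is_derive_cst _ _ _)) _; rewrite addr0.
  by have := @is_derive1_comp R F (fun y => y + c) x _ _ (dF _) ds; rewrite mulr1.
rewrite (int01_FTC cf dF) (int01_FTC (F := fun x => F (x + s)))//; last first.
  by move=> x; apply: (@continuous_comp _ _ _ (fun y => y + s) f);
    [apply: cvgD; [exact: cvg_id|exact: cvg_cst]|exact: cf].
have dK x : is_derive x 1 (fun x => F (x + 1) - F (x + 0)) 0.
  by apply: is_derive_eq (is_deriveB (sh 1 x) (sh 0 x)) _; rewrite f1 addr0 subrr.
have := @is_derive_0_is_cst _ _ s 0 dK.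
by rewrite !(addr0, add0r) [1 + s]addrC.
Qed.

Lemma bounded_rectangle (u : R * R -> R) a b c d : continuous u ->
  exists K, 0 <= K /\ forall x y, a <= x <= b -> c <= y <= d -> `|u (x, y)| <= K.
Proof.
move=> cu; have cK : compact (`[a, b]%classic `*` `[c, d]%classic).
  by apply: compact_setX; exact: segment_compact.
have /compact_bounded[M [_ hM]] := continuous_compact (continuous_subspaceT cu) cK.
exists (`|M| + 1); split=> [|x y xab ycd]; first by rewrite addr_ge0.
apply: hM; first by rewrite ltr_pwDr// ler_norm.
by exists (x, y) => //; split; rewrite /= in_itv.
Qed.

Lemma int01_diff (u : R * R -> R) : continuous u ->
  (forall p, derivable u p (0, 1)) -> continuous (fun p => 'D_(0, 1) u p) ->
  forall y, is_derive y 1 (fun y => int01 (fun x => u (x, y)))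
    (int01 (fun x => 'D_(0, 1) u (x, y))).
Proof.
move=> cu du cdu y.
have slice y' : continuous (fun x => u (x, y')).
  move=> x; apply: (@continuous_comp _ _ _ (fun x => (x, y')) u); last exact: cu.
  by apply: (@cvg_pair _ _ _ (nbhs x) (nbhs x) (nbhs y')); [exact: cvg_id|exact: cvg_cst].
have line x y' : is_derive y' 1 (fun t => u (x, t)) ('D_(0, 1) u (x, y')).
  have E : (fun h : R => h^-1 *: (((fun t => u (x, t)) \o shift y') (h *: 1) - u (x, y'))) =
           (fun h : R => h^-1 *: ((u \o shift (x, y')) (h *: (0, 1)) - u (x, y'))).
    apply/funext => h /=; congr (_ *: (u _ - _)).
    by transitivity (h * 0 + x, h * 1 + y'); rewrite // mulr0 add0r.
  split; first by rewrite /derivable E; exact: du.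
  by rewrite /derive E.
(* Domination for the differentiation under the integral: the partial derivative is bounded on a
   compact rectangle around height y. *)
have [K [K0 hK]] := bounded_rectangle 0 1 (y - 1) (y + 1) cdu.
have Iy : `](y - 1), (y + 1)[%classic y.
  by rewrite /= in_itv /=; apply/andP; split; lra.
have E x t : partial1of2 (fun t x => u (x, t)) t x = 'D_(0, 1) u (x, t).
  by rewrite partial1of2E; have [] := line x t.
have H := @cvg_differentiation_under_integral R _ _ mu (fun t x => u (x, t))
  `[0, 1]%classic (measurable_itv _) y (y - 1) (y + 1) Iy.
have {}H := H (fun t _ => continuous_integrable 0 1 (slice t)).
have {}H := H (fun t x _ _ => @ex_derive _ _ _ _ _ _ _ (line x t)) (fun=> K) (fun=> K0).
have {}H := H (continuous_integrable 0 1 (@cst_continuous _ _ K)).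
have {}H := H _; rewrite /int01.
have : h^-1 *: ((fun t : R => \int[mu]_(x in `[0, 1]) u (x, t)) (h + y) -
    (fun t : R => \int[mu]_(x in `[0, 1]) u (x, t)) y) @[h --> 0^'] -->
    \int[mu]_(x in `[0, 1]) partial1of2 (fun t x => u (x, t)) y x.
  apply: H => t x; rewrite /= !in_itv /= => /andP[t1 t2] x01; rewrite E; apply: hK => //.
  by rewrite (ltW t1) (ltW t2).
have -> : \int[mu]_(x in `[0, 1]) partial1of2 (fun t x => u (x, t)) y x =
    \int[mu]_(x in `[0, 1]) 'D_(0, 1) u (x, y).
  by apply: eq_Rintegral => x _; exact: E.
set F := (fun y => \int[mu]_(x in `[0, 1]) u (x, y)).
rewrite -[\int[mu]_(x in `[0, 1]) u (x, y)]/(F y).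
have -> : (fun h : R => h^-1 *: (\int[mu]_(x in `[0, 1]) u (x, h + y) - F y)) =
    (fun h : R => h^-1 *: ((F \o shift y) (h *: 1) - F y)).
  by apply/funext => h; rewrite /= /GRing.scale /= mulr1.
move=> hh; split; first by apply/cvg_ex; eexists; exact: hh.
by apply: cvg_lim hh; exact: norm_hausdorff.
Qed.

End RealIntegral.

(** * Calculus of complex-valued functions of a real variable *)

Section ComplexCalculus.
Variable R : realType.
Local Notation C := R[i].
Implicit Types (f g : R -> C) (x y : R).

Definition ccont f : Prop :=
  continuous (fun t => complex.Re (f t)) /\ continuous (fun t => complex.Im (f t)).

Definition has_deriv f x (d : C) : Prop :=
  is_derive x 1 (fun t => complex.Re (f t)) (complex.Re d) /\
  is_derive x 1 (fun t => complex.Im (f t)) (complex.Im d).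

Definition cint01 f : C :=
  int01 (fun x => complex.Re (f x)) +i* int01 (fun x => complex.Im (f x)).

Lemma ccont_cst (k : C) : ccont (fun=> k).
Proof. by split; exact: cst_continuous. Qed.

Lemma ccontD f g : ccont f -> ccont g -> ccont (fun t => f t + g t).
Proof.
move=> [f1 f2] [g1 g2]; split=> x.
  rewrite (_ : (fun t => _) = (fun t => complex.Re (f t)) \+ (fun t => complex.Re (g t))).
    by apply: continuousD; [exact: f1|exact: g1].
  by apply/funext => t; rewrite ReD.
rewrite (_ : (fun t => _) = (fun t => complex.Im (f t)) \+ (fun t => complex.Im (g t))).
  by apply: continuousD; [exact: f2|exact: g2].
by apply/funext => t; rewrite ImD.
Qed.

Lemma ccontM f g : ccont f -> ccont g -> ccont (fun t => f t * g t).
Proof.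
move=> [f1 f2] [g1 g2]; split=> x.
  rewrite (_ : (fun t => _) = ((fun t => complex.Re (f t)) \* (fun t => complex.Re (g t)))
     \- ((fun t => complex.Im (f t)) \* (fun t => complex.Im (g t)))).
    apply: continuousB; apply: continuousM; by [exact: f1|exact: g1|exact: f2|exact: g2].
  by apply/funext => t; rewrite ReM.
rewrite (_ : (fun t => _) = ((fun t => complex.Re (f t)) \* (fun t => complex.Im (g t)))
   \+ ((fun t => complex.Im (f t)) \* (fun t => complex.Re (g t)))).
  apply: continuousD; apply: continuousM; by [exact: f1|exact: g1|exact: f2|exact: g2].
by apply/funext => t; rewrite ImM.
Qed.

Lemma ccontZ (k : C) f : ccont f -> ccont (fun t => k * f t).
Proof. by move=> cf; apply: ccontM => //; exact: ccont_cst. Qed.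

Lemma ccontN f : ccont f -> ccont (fun t => - f t).
Proof.
by move=> /(ccontZ (-1)); under [X in ccont X]funext do rewrite mulN1r.
Qed.

Lemma ccontB f g : ccont f -> ccont g -> ccont (fun t => f t - g t).
Proof. by move=> cf /ccontN cg; exact: ccontD. Qed.

Lemma ccont_sum (I : Type) (r : seq I) (F : I -> R -> C) :
  (forall i, ccont (F i)) -> ccont (fun t => \sum_(i <- r) F i t).
Proof.
move=> cF; elim: r => [|i r IH].
  by under [X in ccont X]funext do rewrite big_nil; exact: ccont_cst.
by under [X in ccont X]funext do rewrite big_cons; exact: ccontD.
Qed.

Lemma ccont_near f x (e : R) : ccont f -> 0 < e ->
  \forall t \near x, cnorm (f t - f x) < e.
Proof.
move=> [f1 f2] e0; have e2 : 0 < e / 2 by rewrite divr_gt0.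
have h1 : \forall t \near x, `|complex.Re (f x) - complex.Re (f t)| < e / 2.
  by apply: (@cvgr_dist_lt _ _ _ (nbhs x) _ (fun t => complex.Re (f t))) => //; exact: f1.
have h2 : \forall t \near x, `|complex.Im (f x) - complex.Im (f t)| < e / 2.
  by apply: (@cvgr_dist_lt _ _ _ (nbhs x) _ (fun t => complex.Im (f t))) => //; exact: f2.
near=> t; apply: le_lt_trans (cnorm_le _) _; rewrite ReD ImD ReN ImN distrC.
rewrite [X in _ + X]distrC [ltRHS]splitr; apply: ltrD; by near: t.
Unshelve. all: by end_near. Qed.

Lemma has_deriv_cst (k : C) x : has_deriv (fun=> k) x 0.
Proof. by split; exact: is_derive_cst. Qed.

Lemma has_derivD f g x (d e : C) : has_deriv f x d -> has_deriv g x e ->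
  has_deriv (fun t => f t + g t) x (d + e).
Proof.
move=> [f1 f2] [g1 g2]; split.
  under [X in is_derive _ _ X]funext do rewrite ReD.
  by rewrite ReD; exact: is_deriveD.
under [X in is_derive _ _ X]funext do rewrite ImD.
by rewrite ImD; exact: is_deriveD.
Qed.

Lemma has_derivM f g x (d e : C) : has_deriv f x d -> has_deriv g x e ->
  has_deriv (fun t => f t * g t) x (d * g x + f x * e).
Proof.
move=> [f1 f2] [g1 g2]; split.
  under [X in is_derive _ _ X]funext do rewrite ReM.
  apply: is_derive_eq (is_deriveB (is_deriveM f1 g1) (is_deriveM f2 g2)) _.
  rewrite ReD !ReM /GRing.scale /=; ring.
under [X in is_derive _ _ X]funext do rewrite ImM.
apply: is_derive_eq (is_deriveD (is_deriveM f1 g2) (is_deriveM f2 g1)) _.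
rewrite ImD !ImM /GRing.scale /=; ring.
Qed.

Lemma has_derivZ (k : C) f x d : has_deriv f x d ->
  has_deriv (fun t => k * f t) x (k * d).
Proof.
by move=> /(has_derivM (has_deriv_cst k x)); rewrite mul0r add0r.
Qed.

Lemma has_derivN f x d : has_deriv f x d -> has_deriv (fun t => - f t) x (- d).
Proof.
move=> /(has_derivZ (-1)); rewrite mulN1r.
by under [X in has_deriv X]funext do rewrite mulN1r.
Qed.

Lemma has_derivB f g x (d e : C) : has_deriv f x d -> has_deriv g x e ->
  has_deriv (fun t => f t - g t) x (d - e).
Proof. by move=> fd /has_derivN ge; exact: has_derivD. Qed.

Lemma has_deriv_unique f x d e : has_deriv f x d -> has_deriv f x e -> d = e.
Proof.
move=> [[_ d1] [_ d2]] [[_ e1] [_ e2]].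
by case: d d1 d2 => a b /= <- <-; case: e e1 e2 => c d /= <- <-.
Qed.

Lemma has_deriv_ccont f d : (forall x, has_deriv f x (d x)) -> ccont f.
Proof.
by move=> fd; split; apply: is_derive_continuous => x; [exact: (fd x).1|exact: (fd x).2].
Qed.

Lemma has_deriv0_cst f : (forall x, has_deriv f x 0) -> forall x y, f x = f y.
Proof.
move=> f0 x y.
have h1 := is_derive_0_is_cst x y (fun t => (f0 t).1).
have h2 := is_derive_0_is_cst x y (fun t => (f0 t).2).
by case: (f x) (f y) h1 h2 => a b [c d] /= -> ->.
Qed.

Lemma has_deriv_shift f s x d : has_deriv f (x + s) d ->
  has_deriv (fun t => f (t + s)) x d.
Proof.
have ds : is_derive x 1 (fun y : R => y + s) 1.
  by apply: is_derive_eq (is_deriveD (is_derive_id _ _) (is_derive_cst _ _ _)) _; rewrite addr0.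
move=> [f1 f2]; split.
  have := @is_derive1_comp R (fun t => complex.Re (f t)) (fun y => y + s) x _ _ f1 ds.
  by rewrite mulr1.
have := @is_derive1_comp R (fun t => complex.Im (f t)) (fun y => y + s) x _ _ f2 ds.
by rewrite mulr1.
Qed.

Lemma has_deriv_opp f x d : has_deriv f (- x) d ->
  has_deriv (fun t => f (- t)) x (- d).
Proof.
have ds : is_derive x 1 (fun y : R => - y) (- 1).
  exact: is_deriveN (is_derive_id _ _).
move=> [f1 f2]; split.
  have := @is_derive1_comp R (fun t => complex.Re (f t)) (fun y => - y) x _ _ f1 ds.
  by rewrite mulrN1 ReN.
have := @is_derive1_comp R (fun t => complex.Im (f t)) (fun y => - y) x _ _ f2 ds.
by rewrite mulrN1 ImN.
Qed.

Lemma has_deriv_expC (alpha beta : C) x :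
  has_deriv (fun t => expC (alpha * t%:C + beta)) x (alpha * expC (alpha * x%:C + beta)).
Proof.
case: alpha beta => a b [c d].
have E (u v : R) t : expC ((u +i* v) * t%:C + (c +i* d)) =
    expR (c + t * u) * cos (d + t * v) +i* (expR (c + t * u) * sin (d + t * v)).
  rewrite /expC mulCE addCE /= !mulr0 subr0 add0r.
  by rewrite [u * t]mulrC [v * t]mulrC [t * u + c]addrC [t * v + d]addrC.
have lin (p q : R) : is_derive x 1 (fun h : R => p + h * q) q.
  by apply: is_derive_eq; rewrite add0r mul1r scaler0 add0r [_%:A]mulr1.
have ex : is_derive x 1 (fun h => expR (c + h * a)) (expR (c + x * a) * a).
  exact: (@is_derive1_comp R expR (fun h => c + h * a) x _ _ (is_derive_expR _) (lin c a)).
have co : is_derive x 1 (fun h => cos (d + h * b)) (- sin (d + x * b) * b).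
  exact: (@is_derive1_comp R cos (fun h => d + h * b) x _ _ (is_derive_cos _) (lin d b)).
have si : is_derive x 1 (fun h => sin (d + h * b)) (cos (d + x * b) * b).
  exact: (@is_derive1_comp R sin (fun h => d + h * b) x _ _ (is_derive_sin _) (lin d b)).
split; under [X in is_derive _ _ X]funext do rewrite E /=.
  apply: is_derive_eq (is_deriveM ex co) _.
  rewrite E mulCE /= /GRing.scale /=; ring.
apply: is_derive_eq (is_deriveM ex si) _.
rewrite E mulCE /= /GRing.scale /=; ring.
Qed.

Lemma ccont_expC (alpha beta : C) : ccont (fun t => expC (alpha * t%:C + beta)).
Proof. exact: has_deriv_ccont (has_deriv_expC alpha beta). Qed.

Lemma eq_cint01 f g : (forall x, 0 <= x <= 1 -> f x = g x) -> cint01 f = cint01 g.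
Proof.
by move=> fg; congr (_ +i* _); apply: eq_int01 => x /fg ->.
Qed.

Lemma cint01D f g : ccont f -> ccont g ->
  cint01 (fun t => f t + g t) = cint01 f + cint01 g.
Proof.
move=> [f1 f2] [g1 g2]; rewrite /cint01 addCE -!int01D//; congr (_ +i* _).
  by congr int01; apply/funext => t; rewrite ReD.
by congr int01; apply/funext => t; rewrite ImD.
Qed.

Lemma cint01Z (k : C) f : ccont f -> cint01 (fun t => k * f t) = k * cint01 f.
Proof.
move=> [f1 f2]; rewrite /cint01; case: k => a b; rewrite mulCE.
have c (u : R) (h : R -> R) : continuous h -> continuous (fun x => u * h x).
  by move=> ch x; apply: continuousM; [exact: cst_continuous|exact: ch].
congr (_ +i* _).
  rewrite -mulNr -!int01Z// -int01D; [|exact: c|exact: c].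
  by congr int01; apply/funext => t; rewrite ReM /= mulNr.
rewrite -!int01Z// -int01D; [|exact: c|exact: c].
by congr int01; apply/funext => t; rewrite ImM.
Qed.

Lemma cint01B f g : ccont f -> ccont g ->
  cint01 (fun t => f t - g t) = cint01 f - cint01 g.
Proof.
move=> cf cg; rewrite -mulN1r -cint01Z// -cint01D//; last exact: ccontZ.
by congr cint01; apply/funext => t; rewrite mulN1r.
Qed.

Lemma cint01_cst (k : C) : cint01 (fun=> k) = k.
Proof. by rewrite /cint01 !int01_cst; case: k. Qed.

Lemma cint01_sum (I : Type) (r : seq I) (F : I -> R -> C) :
  (forall i, ccont (F i)) ->
  cint01 (fun t => \sum_(i <- r) F i t) = \sum_(i <- r) cint01 (F i).
Proof.
move=> cF; elim: r => [|i r IH].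
  rewrite big_nil -[RHS](cint01_cst 0); congr cint01; apply/funext => t.
  by rewrite big_nil.
rewrite big_cons -IH -cint01D//; last exact: ccont_sum.
by congr cint01; apply/funext => t; rewrite big_cons.
Qed.

(** The factor 2 comes from estimating real and imaginary parts separately, as in [has_deriv_lip]
    and [has_deriv_dom]. *)
Lemma cint01_norm f K : ccont f -> (forall x, 0 <= x <= 1 -> cnorm (f x) <= K) ->
  cnorm (cint01 f) <= 2 * K.
Proof.
move=> [f1 f2] fK; apply: le_trans (cnorm_le _) _.
rewrite mulr_natl mulr2n; apply: lerD; apply: int01_norm => // x /fK; apply: le_trans.
  exact: Re_le_cnorm.
exact: Im_le_cnorm.
Qed.

Lemma cint01_FTC f F : ccont f -> (forall x, has_deriv F x (f x)) ->
  cint01 f = F 1 - F 0.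
Proof.
move=> [f1 f2] dF; rewrite /cint01.
rewrite (int01_FTC f1 (fun x => (dF x).1)) (int01_FTC f2 (fun x => (dF x).2)).
by case: (F 1) (F 0) => [? ?] [? ?].
Qed.

Lemma cprimitive_ex f : ccont f -> exists F, forall x, has_deriv F x (f x).
Proof.
move=> [/primitive_ex[F1 d1] /primitive_ex[F2 d2]].
by exists (fun x => F1 x +i* F2 x) => x; split; [exact: d1|exact: d2].
Qed.

Lemma cint01_shift f s : ccont f -> (forall x, f (x + 1) = f x) ->
  cint01 (fun x => f (x + s)) = cint01 f.
Proof.
move=> [f1 f2] fp; congr (_ +i* _).
  by apply: (int01_shift s f1) => x; rewrite fp.
by apply: (int01_shift s f2) => x; rewrite fp.
Qed.

Lemma cint01_has_sum (I : choiceType) (M : I -> R) (x : I -> R -> C) (S : R -> C) :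
  bsum M -> (forall i, ccont (x i)) -> ccont S ->
  (forall i t, 0 <= t <= 1 -> cnorm (x i t) <= M i) ->
  (forall t, 0 <= t <= 1 -> has_sum (x ^~ t) (S t)) ->
  has_sum (fun i => cint01 (x i)) (cint01 S).
Proof.
move=> bM cx cS xM xS e e0; have e3 : 0 < e / 3 by rewrite divr_gt0.
have [A hA] := has_sum_tail bM e3; exists A => B AB.
rewrite -cint01_sum// -cint01B//; last exact: ccont_sum.
apply: le_lt_trans (_ : 2 * (e / 3) < e); last by lra.
apply: cint01_norm => [|t t01]; first by apply: ccontB => //; exact: ccont_sum.
apply: hA AB => [i|]; [exact: xM|exact: xS].
Qed.

Lemma cint01_diff (F : C -> C) : Cn 1 (reC F) -> Cn 1 (imC F) ->
  forall y, has_deriv (fun y => cint01 (fun x => F (x +i* y))) y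
    (cint01 (fun x => partialC (0, 1) F (x +i* y))).
Proof.
move=> [c1 [_ d1 _ [e1 _]]] [c2 [_ d2 _ [e2 _]]] y; split.
  exact: (int01_diff c1 d1 e1 y).
exact: (int01_diff c2 d2 e2 y).
Qed.

End ComplexCalculus.

(** * Fourier coefficients *)

Section FourierUniqueness.
Variable R : realType.
Local Notation C := R[i].

Definition ee (n : int) (z : C) : C := expC (2 * pii R * n%:~R * z).

Lemma eeDr n z w : ee n (z + w) = ee n z * ee n w.
Proof. by rewrite /ee mulrDr expCD. Qed.

Lemma eeDl n m z : ee (n + m) z = ee n z * ee m z.
Proof. by rewrite /ee intrD mulrDr mulrDl expCD. Qed.

Lemma ee0 z : ee 0 z = 1.
Proof. by rewrite /ee mulr0 mul0r expC0. Qed.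

Lemma ee_int n (m : int) : ee n m%:~R = 1.
Proof. by rewrite /ee -mulrA -intrM expC_2piint. Qed.

Lemma eeN n z : ee (- n) z = (ee n z)^-1.
Proof. by rewrite /ee mulrNz mulrN mulNr expCN. Qed.

Lemma Re_ee_arg (n : int) z :
  complex.Re (2 * pii R * n%:~R * z) = - 2 * pi * n%:~R * complex.Im z.
Proof.
rewrite natrC intrC /pii; case: z => x y /=.
ring.
Qed.

Lemma cnorm_ee n z : cnorm (ee n z) = expR (- 2 * pi * n%:~R * complex.Im z).
Proof. by rewrite /ee cnorm_expC Re_ee_arg. Qed.

Lemma ccont_ee n (c : C) : ccont (fun t => ee n (t%:C + c)).
Proof.
have := ccont_expC (2 * pii R * n%:~R) (2 * pii R * n%:~R * c).
by under [X in ccont X]funext do rewrite -mulrDr.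
Qed.

Lemma ccont_ee_real n : ccont (fun t : R => ee n t%:C).
Proof.
by have := ccont_ee n 0; under [X in ccont X]funext do rewrite addr0.
Qed.

Lemma pow_unbounded (r K : R) : 1 < r -> exists j : nat, K < r ^+ j.
Proof.
move=> r1; have b (j : nat) : 1 + j%:R * (r - 1) <= r ^+ j.
  elim: j => [|j IH]; first by rewrite mul0r addr0.
  have h : 0 <= j%:R * (r - 1) ^+ 2 by rewrite mulr_ge0 ?sqr_ge0.
  rewrite exprS; apply: le_trans (_ : r * (1 + j%:R * (r - 1)) <= _).
    by rewrite [j.+1%:R]mulrSr; nra.
  by rewrite ler_pM2l//; lra.
have r0 : 0 < r - 1 by lra.
exists (Num.bound (K / (r - 1))); apply: lt_le_trans (b _).
have := unstable.ltr_bound (K / (r - 1)); rewrite ltr_pdivrMr//; lra.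
Qed.

(* Lebesgue's kernel argument: the powers of the trigonometric polynomial
   q = 1 + (cos (2 pi (x - 1/2)) - cos (2 pi delta)) / 2 concentrate at 1/2. *)
Lemma fourier_concentration (g : R -> C) : ccont g ->
  (forall n, cint01 (fun x => g x * ee n x%:C) = 0) ->
  complex.Re (g (1 / 2)) <= 0.
Proof.
move=> cg g0; rewrite leNgt; apply/negP; set h := 1 / 2 => eps0.
pose eps := complex.Re (g h) / 2; have e0 : 0 < eps by rewrite divr_gt0.
have [D [D0 D4 hD]] : exists D : R, [/\ 0 < D, D < 1 / 4 &
    forall x, `|x - h| < D -> eps < complex.Re (g x)].
  have /nbhs_ballP[D' /= D0 hD] := ccont_near h cg e0.
  (* The cap 1/5 keeps the angle 2 pi D in [0, pi], where cos is decreasing, and the interval around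
     1/2 inside [0, 1]. *)
  exists (Num.min D' (1 / 5)); split; first by rewrite lt_min D0 divr_gt0.
    by rewrite gt_min; apply/orP; right; lra.
  move=> x; rewrite lt_min => /andP[xD _].
  have /hD : ball h D' x by rewrite /ball /= distrC.
  move=> /(le_lt_trans (Re_le_cnorm _)); rewrite ReD ReN ltr_norml => /andP[+ _].
  by rewrite /eps; lra.
pose q (x : R) := 1 + (cos (2 * pi * (x - h)) - cos (2 * pi * D)) / 2.
have pi0 : 0 < pi :> R by exact: pi_gt0.
have cos_abs (x : R) : cos (2 * pi * (x - h)) = cos (2 * pi * `|x - h|).
  have [//|_] := ger0P (x - h); by rewrite mulrN cosN.
have qin (x : R) : `|x - h| <= D -> 1 <= q x.
  move=> xD; rewrite /q cos_abs lerDl divr_ge0// subr_ge0.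
  have [->//|xD'] := eqVneq `|x - h| D.
  apply/ltW; rewrite ltr_cos ?ltr_pM2l ?mulr_gt0//; first by rewrite lt_neqAle xD'.
    by rewrite in_itv /=; apply/andP; split; [rewrite !mulr_ge0// ltW|have := normr_ge0 (x - h); nra].
  by rewrite in_itv /=; apply/andP; split; [rewrite !mulr_ge0// ltW|nra].
pose r := q (h + D / 2).
have r1 : 1 < r.
  rewrite /r /q ltrDl divr_gt0// subr_gt0.
  rewrite ltr_cos ?in_itv /= ?ltr_pM2l ?mulr_gt0//; first by lra.
    by apply/andP; split; [rewrite !mulr_ge0// ?ltW//; lra|nra].
  by apply/andP; split; [rewrite !mulr_ge0// ltW|nra].
have qinner (x : R) : `|x - h| <= D / 2 -> r <= q x.
  move=> xD; rewrite /r /q lerD2l ler_pM2r// lerD2r (cos_abs x).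
  rewrite (_ : h + D / 2 - h = D / 2); last by ring.
  have [->//|xD'] := eqVneq `|x - h| (D / 2).
  apply/ltW; rewrite ltr_cos ?ltr_pM2l ?mulr_gt0//; first by rewrite lt_neqAle xD'.
    by rewrite in_itv /=; apply/andP; split; [rewrite !mulr_ge0//; lra|nra].
  by rewrite in_itv /=; apply/andP; split; [rewrite !mulr_ge0// ltW|have := normr_ge0 (x - h); nra].
have qout (x : R) : 0 <= x <= 1 -> D <= `|x - h| -> 0 <= q x <= 1.
  move=> /andP[x0 x1] xD; rewrite /q.
  have c1 := cos_geN1 (2 * pi * (x - h)); have c2 := cos_le1 (2 * pi * D).
  suff c3 : cos (2 * pi * (x - h)) <= cos (2 * pi * D).
    by apply/andP; split; lra.
  rewrite cos_abs; have [->//|xD'] := eqVneq D `|x - h|.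
  have xh : `|x - h| <= h by rewrite ler_norml /h; apply/andP; split; lra.
  apply/ltW; rewrite ltr_cos ?ltr_pM2l ?mulr_gt0//; first by rewrite lt_neqAle xD'.
    by rewrite in_itv /=; apply/andP; split; [rewrite !mulr_ge0// ltW|nra].
  by rewrite in_itv /=; apply/andP; split; [rewrite !mulr_ge0// ltW|move: xh; rewrite /h; nra].
have cq : ccont (fun x => (q x)%:C).
  have lin : continuous (fun x : R => 2 * pi * (x - h)).
    move=> x; apply: cvgM; first exact: cvg_cst.
    by apply: cvgB; [exact: cvg_id|exact: cvg_cst].
  split=> x; last exact: cvg_cst.
  apply: cvgD; first exact: cvg_cst.
  apply: cvgM; last exact: cvg_cst.
  apply: cvgB; last exact: cvg_cst.
  exact: (@continuous_comp _ _ _ (fun y => 2 * pi * (y - h)) cos x (lin x) (@continuous_cos R _)).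
have cqj j : ccont (fun x => (q x)%:C ^+ j).
  elim: j => [|j IH]; first exact: ccont_cst.
  by under [X in ccont X]funext do rewrite exprS; exact: ccontM.
(* Centring at 1/2 turns cos (2 pi (x - 1/2)) into - cos (2 pi x), so q is a combination of the
   frequencies 0, 1 and -1. *)
have qee (x : R) : (q x)%:C = (1 - cos (2 * pi * D) / 2)%:C
    - (1 / 4)%:C * ee 1 x%:C - (1 / 4)%:C * ee (- 1) x%:C.
  have E1 : 2 * pii R * 1%:~R * x%:C = 0 +i* (2 * pi * x).
    rewrite natrC /pii; apply/eqP; rewrite eq_complex /=.
    by apply/andP; split; apply/eqP; ring.
  rewrite eeN /ee -expCN E1 /q (_ : 2 * pi * (x - h) = 2 * pi * x - pi); last first.
    by rewrite /h; field.
  rewrite /expC /= !(oppr0, expR0, mul1r) cosN sinN cosB cospi sinpi.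
  apply/eqP; rewrite eq_complex /=.
  by apply/andP; split; apply/eqP; field.
(* Multiplication by q only mixes neighbouring frequencies, so orthogonality to all of them passes
   from g to every g q^j. *)
have Z j : forall n, cint01 (fun x => g x * (q x)%:C ^+ j * ee n x%:C) = 0.
  elim: j => [|j IH] n.
    by rewrite -(g0 n); congr cint01; apply/funext => x; rewrite mulr1.
  pose k1 := (1 - cos (2 * pi * D) / 2)%:C; pose k2 : C := (1 / 4)%:C.
  pose G m x := g x * (q x)%:C ^+ j * ee m x%:C.
  have cG m : ccont (G m) by apply: ccontM (ccont_ee_real m); exact: ccontM.
  have -> : (fun x => g x * (q x)%:C ^+ j.+1 * ee n x%:C) =
      fun x => k1 * G n x - k2 * G (1 + n) x - k2 * G (- 1 + n) x.
    apply/funext => x; rewrite /G exprS !eeDl {1}qee -/k1 -/k2.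
    set A := g x; set B := _ ^+ j; ring.
  have cZ (k : C) m : ccont (fun x => k * G m x) by exact: ccontZ.
  rewrite cint01B; [|exact: ccontB|exact: cZ].
  by rewrite cint01B// !cint01Z// !IH !mulr0 !subr0.
have [K [K0 hK]] : exists K : R, 0 <= K /\ forall x, 0 <= x <= 1 -> - K <= complex.Re (g x).
  have cu : continuous (fun p : R * R => complex.Re (g p.1)).
    by move=> p; apply: (@continuous_comp _ _ _ fst (fun x => complex.Re (g x)));
      [exact: cvg_fst|exact: cg.1].
  have [K [K0 hK]] := bounded_rectangle 0 1 0 0 cu; exists K; split=> // x x01.
  have := hK x 0 x01; rewrite lexx => /(_ isT) /=.
  by rewrite ler_norml => /andP[].
have [j hj] := pow_unbounded (K / (eps * D)) r1.
(* Adding K makes the integrand nonnegative on [0, 1], and by orthogonality its integral is exactly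
   K. The choice of j makes the contribution of [1/2 - D/2, 1/2 + D/2] alone exceed K. *)
pose F x := complex.Re (g x) * q x ^+ j + K.
have cF : continuous F.
  move=> x; apply: cvgD; last exact: cvg_cst.
  apply: cvgM; first exact: cg.1.
  have := (cqj j).1 x; rewrite (_ : (fun t => complex.Re _) = fun t => q t ^+ j)//.
  by apply/funext => t; rewrite -rmorphXn.
have IF : int01 F = K.
  have := Z j 0; rewrite /cint01 => /(congr1 (@complex.Re R)) /=.
  rewrite (_ : (fun x => _) = fun x => complex.Re (g x) * q x ^+ j); last first.
    apply/funext => x; rewrite ee0 mulr1 -rmorphXn ReM /=.
    by rewrite mulr0 subr0.
  move=> I0; have := @int01D _ (fun x => complex.Re (g x) * q x ^+ j) (fun=> K).
  rewrite I0 add0r int01_cst; apply; last exact: cst_continuous.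
  move=> x; apply: cvgM; first exact: cg.1.
  have := (cqj j).1 x; rewrite (_ : (fun t => complex.Re _) = fun t => q t ^+ j)//.
  by apply/funext => t; rewrite -rmorphXn.
have [P dP] := primitive_ex cF.
have PF := int01_FTC cF dP.
have mvt a b : a < b -> exists2 c, a <= c <= b & P b - P a = F c * (b - a).
  move=> ab; have [c cab E] := @MVT_segment R P F a b (ltW ab) (fun x _ => dP x)
    (continuous_subspaceT (is_derive_continuous dP)).
  by exists c.
have F0 (x : R) : 0 <= x <= 1 -> 0 <= F x.
  move=> x01; have [xD|xD] := ltP `|x - h| D.
    have := hD _ xD; have := qin _ (ltW xD) => q1 gx.
    by rewrite /F addr_ge0// mulr_ge0 ?exprn_ge0//; lra.
  have /andP[q0 q1] := qout _ x01 xD; have := hK _ x01 => gx.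
  have : 0 <= q x ^+ j <= 1 by rewrite exprn_ge0// exprn_ile1.
  by move=> /andP[p0 p1]; rewrite /F; nra.
have [c1 /andP[c1a c1b] E1] := mvt 0 (h - D / 2) ltac:(rewrite /h; lra).
have [c2 /andP[c2a c2b] E2] := mvt (h - D / 2) (h + D / 2) ltac:(lra).
have [c3 /andP[c3a c3b] E3] := mvt (h + D / 2) 1 ltac:(rewrite /h; lra).
have F1 := F0 c1 ltac:(rewrite c1a /=; move: c1b; rewrite /h; lra).
have F3 := F0 c3 ltac:(rewrite c3b andbT; move: c3a; rewrite /h; lra).
have F2 : eps * r ^+ j <= F c2.
  have cD : `|c2 - h| <= D / 2 by rewrite ler_norml; apply/andP; split; lra.
  have g2 := hD c2 ltac:(lra); have q2 := qinner _ cD.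
  rewrite /F -[leLHS]addr0; apply: lerD => //; apply: ler_pM => //.
  - exact: ltW.
  - by rewrite exprn_ge0//; lra.
  - exact: ltW.
  - by apply: lerXn2r; rewrite ?nnegrE//; lra.
have I1 : 0 <= F c1 * (h - D / 2 - 0) by rewrite mulr_ge0// /h; lra.
have I3 : 0 <= F c3 * (1 - (h + D / 2)) by rewrite mulr_ge0// /h; lra.
have I2 : eps * r ^+ j * D <= F c2 * (h + D / 2 - (h - D / 2)).
  by rewrite (_ : h + D / 2 - (h - D / 2) = D); [rewrite ler_pM2r|field].
move: hj; rewrite ltr_pdivrMr ?mulr_gt0// => hj.
suff : K < K by rewrite ltxx.
apply: lt_le_trans hj _; rewrite -[leRHS]IF PF; lra.
Qed.

(** A translation moves x0 to 1/2; [fourier_concentration] applied to the multiples of g by 1, -1, i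
    and - i bounds both parts of g x0 on both sides by 0. *)
Lemma fourier_unique (g : R -> C) : ccont g -> (forall x, g (x + 1) = g x) ->
  (forall n, cint01 (fun x => g x * ee n x%:C) = 0) -> forall x, g x = 0.
Proof.
move=> cg gp g0 x0; pose s := x0 - 1 / 2.
have cgs : ccont (fun x => g (x + s)).
  have sh : continuous (fun y : R => y + s).
    by move=> x; apply: cvgD; [exact: cvg_id|exact: cvg_cst].
  split=> x.
    by apply: (@continuous_comp _ _ _ (fun y => y + s) (fun y => complex.Re (g y)));
      [exact: sh|exact: cg.1].
  by apply: (@continuous_comp _ _ _ (fun y => y + s) (fun y => complex.Im (g y)));
    [exact: sh|exact: cg.2].
have Z n : cint01 (fun x => g (x + s) * ee n x%:C) = 0.
  have -> : (fun x => g (x + s) * ee n x%:C) =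
      fun x => ee n (- s)%:C * (fun y => g y * ee n y%:C) (x + s).
    apply/funext => x; rewrite mulrCA -eeDr; congr (_ * ee n _).
    by rewrite -rmorphD addrC addrK.
  have cge : ccont (fun y => g y * ee n y%:C) by apply: ccontM; [|exact: ccont_ee_real].
  rewrite cint01Z.
    rewrite (cint01_shift s cge) ?g0 ?mulr0// => x.
    by rewrite gp rmorphD eeDr (ee_int n 1) mulr1.
  apply: ccontM => //.
  by under [X in ccont X]funext do rewrite rmorphD; exact: ccont_ee.
have key (k : C) : complex.Re (k * g x0) <= 0.
  have := @fourier_concentration (fun x => k * g (x + s)) (ccontZ k cgs).
  rewrite (_ : 1 / 2 + s = x0); last by rewrite /s; ring.
  apply=> n; under [X in cint01 X]funext do rewrite -mulrA.
  rewrite cint01Z ?Z ?mulr0//; apply: ccontM => //; exact: ccont_ee_real.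
case: (g x0) (key 1) (key (- 1)) (key (0 +i* 1)) (key (0 +i* - 1)) => a b /=.
move=> h1 h2 h3 h4; apply/eqP; rewrite eq_complex /=; apply/andP; split; apply/eqP; lra.
Qed.

End FourierUniqueness.

(** * Horizontal Fourier coefficients of smooth functions on the plane *)

Section SmoothFunctions.
Variable R : realType.
Local Notation C := R[i].
Implicit Types (f g : C -> C) (z : C) (x y : R) (n m : int).

Lemma smooth_continuous f : smooth f -> continuous (reC f) /\ continuous (imC f).
Proof. by move=> /(_ 0%N) [[? _] [? _]]. Qed.

Lemma ccont_hslice f y : smooth f -> ccont (fun x => f (x +i* y)).
Proof.
have slice (u : R * R -> R) : continuous u -> continuous (fun x => u (x, y)).
  move=> cu x; apply: (@continuous_comp _ _ _ (fun x => (x, y)) u); last exact: cu.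
  by apply: (@cvg_pair _ _ _ (nbhs x) (nbhs x) (nbhs y)); [exact: cvg_id|exact: cvg_cst].
by move=> /smooth_continuous[/slice c1 /slice c2]; split; [exact: c1|exact: c2].
Qed.

Lemma continuous_lin2 (a b c : R) : continuous (fun p : R * R => a * p.1 + b * p.2 + c).
Proof.
move=> p; apply: cvgD; last exact: cvg_cst.
apply: cvgD; apply: cvgM; by [exact: cvg_cst|exact: cvg_fst|exact: cvg_snd].
Qed.

Lemma smooth_expC (alpha beta : C) : smooth (fun z => expC (alpha * z + beta)).
Proof.
move=> n; set E := fun z => _.
(* The constant factor is what the induction needs: a partial derivative of k E is again a constant
   multiple of E. *)
suff H : forall k, Cn n (reC (fun z => k * E z)) /\ Cn n (imC (fun z => k * E z)).
  by have := H 1; rewrite (_ : (fun z => 1 * E z) = E)//; apply/funext => z; rewrite mul1r.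
have cE k' : continuous (reC (fun z => k' * E z)) /\ continuous (imC (fun z => k' * E z)).
  case: alpha beta @E => a b [c d] E; case: k' => k l.
  pose er (p : R * R) : R := expR (a * p.1 + (- b) * p.2 + c).
  pose co (p : R * R) : R := cos (b * p.1 + a * p.2 + d).
  pose si (p : R * R) : R := sin (b * p.1 + a * p.2 + d).
  have c1 : continuous er.
    by move=> p; apply: (@continuous_comp _ _ _ (fun p : R * R => a * p.1 + (- b) * p.2 + c) expR);
      [exact: continuous_lin2|exact: continuous_expR].
  have c2 : continuous co.
    by move=> p; apply: (@continuous_comp _ _ _ (fun p : R * R => b * p.1 + a * p.2 + d) cos);
      [exact: continuous_lin2|exact: continuous_cos].
  have c3 : continuous si.
    by move=> p; apply: (@continuous_comp _ _ _ (fun p : R * R => b * p.1 + a * p.2 + d) sin);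
      [exact: continuous_lin2|exact: continuous_sin].
  have EE (p : R * R) : E (p.1 +i* p.2) = (er p * co p) +i* (er p * si p).
    rewrite /E /expC /er /co /si /=; congr (expR _ * cos _ +i* (expR _ * sin _)); ring.
  split.
    rewrite (_ : reC _ = (fun p => k * (er p * co p) - l * (er p * si p))); last first.
      by apply/funext => p; rewrite /reC EE.
    move=> p; apply: cvgB; apply: cvgM; try exact: cvg_cst; apply: cvgM;
      by [exact: c1|exact: c2|exact: c3].
  rewrite (_ : imC _ = (fun p => k * (er p * si p) + l * (er p * co p))); last first.
    by apply/funext => p; rewrite /imC EE.
  move=> p; apply: cvgD; apply: cvgM; try exact: cvg_cst; apply: cvgM;
    by [exact: c1|exact: c2|exact: c3].
have dE k' (p e : R * R) :
    is_derive p e (reC (fun z => k' * E z)) (reC (fun z => k' * (alpha * (e.1 +i* e.2)) * E z) p) /\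
    is_derive p e (imC (fun z => k' * E z)) (imC (fun z => k' * (alpha * (e.1 +i* e.2)) * E z) p).
  have [h1 h2] := expC_lin alpha beta p e; case: k' => k l.
  rewrite /reC /imC -mulrA; move: h1 h2; rewrite -/E.
  move: (_ * E _) => [u v] /= h1 h2; split.
    have -> : (fun q : R * R => complex.Re ((k +i* l) * E (q.1 +i* q.2))) =
       (k *: reC E) - (l *: imC E) by apply/funext => q; rewrite /reC /imC ReM.
    by apply: is_derive_eq (is_deriveB (is_deriveZ k h1) (is_deriveZ l h2)) _.
  have -> : (fun q : R * R => complex.Im ((k +i* l) * E (q.1 +i* q.2))) =
     (k *: imC E) + (l *: reC E) by apply/funext => q; rewrite /reC /imC ImM.
  by apply: is_derive_eq (is_deriveD (is_deriveZ k h2) (is_deriveZ l h1)) _.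
elim: n => [|n IH] k; first by have [] := cE k.
have [c1 c2] := cE k; split; split=> //.
  split.
  - by move=> p; have [[]] := dE k p (1, 0).
  - by move=> p; have [[]] := dE k p (0, 1).
  - rewrite (_ : (fun p => _) = reC (fun z => k * (alpha * (1 +i* 0)) * E z)); first exact: (IH _).1.
    by apply/funext => p; have [[_ ->]] := dE k p (1, 0).
  - rewrite (_ : (fun p => _) = reC (fun z => k * (alpha * (0 +i* 1)) * E z)); first exact: (IH _).1.
    by apply/funext => p; have [[_ ->]] := dE k p (0, 1).
split.
- by move=> p; have [_ []] := dE k p (1, 0).
- by move=> p; have [_ []] := dE k p (0, 1).
- rewrite (_ : (fun p => _) = imC (fun z => k * (alpha * (1 +i* 0)) * E z)); first exact: (IH _).2.
  by apply/funext => p; have [_ [_ ->]] := dE k p (1, 0).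
- rewrite (_ : (fun p => _) = imC (fun z => k * (alpha * (0 +i* 1)) * E z)); first exact: (IH _).2.
  by apply/funext => p; have [_ [_ ->]] := dE k p (0, 1).
Qed.

Lemma smooth_ee n : smooth (ee n : C -> C).
Proof.
have := smooth_expC (2 * pii R * n%:~R) 0.
by under [X in smooth X]funext do rewrite addr0.
Qed.

Lemma dzbar_ee n z : dzbar (ee n) z = 0.
Proof.
have := dzbar_expC (2 * pii R * n%:~R) 0 z.
by under [X in dzbar X]funext do rewrite addr0.
Qed.

Lemma smooth_partial f : smooth f ->
  smooth (partialC (1, 0) f) /\ smooth (partialC (0, 1) f).
Proof.
move=> sf; split=> n; have [[_ [_ _ f1 f1']] [_ [_ _ f2 f2']]] := sf n.+1.
  by split; [move: f1|move: f2]; congr (Cn _ _); apply/funext => -[].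
by split; [move: f1'|move: f2']; congr (Cn _ _); apply/funext => -[].
Qed.

Lemma has_deriv_hslice f x y : smooth f ->
  has_deriv (fun t => f (t +i* y)) x (partialC (1, 0) f (x +i* y)).
Proof.
move=> /smooth_cderivable /(_ (x, y)) [d1 _ d2 _].
have line (u : R * R -> R) : derivable u (x, y) (1, 0) ->
    is_derive x 1 (fun t => u (t, y)) ('D_(1, 0) u (x, y)).
  move=> du.
  have E : (fun h : R => h^-1 *: (((fun t => u (t, y)) \o shift x) (h *: 1) - u (x, y))) =
           (fun h : R => h^-1 *: ((u \o shift (x, y)) (h *: (1, 0)) - u (x, y))).
    apply/funext => h /=; congr (_ *: (u _ - _)).
    by transitivity (h * 1 + x, h * 0 + y); rewrite // mulr0 add0r.
  split; first by rewrite /derivable E.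
  by rewrite /derive E.
by split; exact: line.
Qed.

(** The definition of d-bar solved for the y-derivative. The x-derivative integrates to 0 over a
    period, which leaves d-bar acting on coefficients as (i/2) d/dy. *)
Lemma dzbarE f z : partialC (0, 1) f z =
  (0 +i* - 2) * dzbar f z + (0 +i* 1) * partialC (1, 0) f z.
Proof.
rewrite /dzbar; move: (partialC _ _ _) (partialC _ _ _) => [a b] [c d].
have -> : 2^-1 = (2^-1 : R)%:C :> C by rewrite natrC fmorphV.
by rewrite !(mulCE, addCE); congr (_ +i* _); field.
Qed.

Definition hper f : Prop := forall z, f (z + 1) = f z.

Lemma hper_ee n : hper (ee n : C -> C).
Proof. by move=> z; rewrite eeDr (ee_int _ n 1) mulr1. Qed.

Lemma hperM f g : hper f -> hper g -> hper (f * g).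
Proof. by move=> pf pg z; rewrite /GRing.mul /= pf pg. Qed.

Lemma partialC_shift (e : R * R) f w z :
  partialC e (fun z' => f (z' + w)) z = partialC e f (z + w).
Proof.
have E (u u' : R * R -> R) : (forall p, u' p = u (p + coords w)) ->
    'D_e u' (coords z) = 'D_e u (coords (z + w)).
  move=> uu'; rewrite /derive.
  have zw : coords (z + w) = coords z + coords w by case: (z) (w) => ? ? [].
  congr (lim (_ @ 0^')); apply/funext => h /=.
  by rewrite !uu' zw addrA.
by rewrite /partialC; congr (_ +i* _); apply: E => -[a b];
  rewrite /reC /imC; case: (w).
Qed.

Lemma hper_partial (e : R * R) f : hper f -> hper (partialC e f).
Proof.
move=> pf z; have E : (fun z' => f (z' + 1)) = f by apply/funext => w; exact: pf.
by rewrite -partialC_shift E.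
Qed.

Lemma hper_dzbar f : hper f -> hper (dzbar f).
Proof.
move=> pf z; have E : (fun z' => f (z' + 1)) = f by apply/funext => w; exact: pf.
by rewrite -dzbar_shift E.
Qed.

Lemma hper_int f n z : hper f -> f (z + n%:~R) = f z.
Proof.
move=> pf; have nat_case (k : nat) w : f (w + k%:R) = f w.
  elim: k w => [|k IH] w; first by rewrite addr0.
  by rewrite mulrSr addrA pf.
case: n => k; first exact: nat_case.
by rewrite NegzE mulrNz -{2}[z](subrK (k.+1%:R : C)) nat_case.
Qed.

(* For a holomorphic f this is the coefficient of exp(2 pi i n z), whatever y. *)
Definition fcoef f n y : C := cint01 (fun x => f (x +i* y) * ee (- n) (x +i* y)).

Lemma x1_shift x y : (x + 1) +i* y = (x +i* y) + 1 :> C.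
Proof. by rewrite addCE addr0. Qed.

Lemma cint01_dx f y : smooth f -> hper f ->
  cint01 (fun x => partialC (1, 0) f (x +i* y)) = 0.
Proof.
move=> sf pf; rewrite (cint01_FTC (F := fun x => f (x +i* y))).
- have := pf (0 +i* y); rewrite -x1_shift add0r => ->.
  by rewrite subrr.
- exact/ccont_hslice/(smooth_partial sf).1.
- by move=> x; exact: has_deriv_hslice.
Qed.

Lemma cint01_dbar f y : smooth f -> hper f ->
  has_deriv (fun y => cint01 (fun x => f (x +i* y))) y
    ((0 +i* - 2) * cint01 (fun x => dzbar f (x +i* y))).
Proof.
move=> sf pf; have [s1 s2] := sf 1%N.
have := cint01_diff s1 s2 y; congr has_deriv.
under eq_fun do rewrite dzbarE.
have cD : ccont (fun x => dzbar f (x +i* y)) by exact/ccont_hslice/smooth_dzbar.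
have cX : ccont (fun x => partialC (1, 0) f (x +i* y)).
  exact/ccont_hslice/(smooth_partial sf).1.
rewrite cint01D; [|exact: ccontZ|exact: ccontZ].
by rewrite (cint01Z _ cD) (cint01Z _ cX) cint01_dx// mulr0 addr0.
Qed.

(** The factor [ee (- n)] is holomorphic and passes through d-bar; hence coefficients are taken
    against it and not against the unitary exponential of x. *)
Lemma fcoef_deriv f n y : smooth f -> hper f ->
  has_deriv (fcoef f n) y ((0 +i* - 2) * fcoef (dzbar f) n y).
Proof.
move=> sf pf; have := @cint01_dbar (f * ee (- n)) y (smoothM sf (@smooth_ee _))
  (hperM pf (hper_ee _)).
rewrite /fcoef; congr (has_deriv _ _ (_ * cint01 _)); apply/funext => x.
rewrite dzbarM; [|exact: smooth_cderivable|exact/smooth_cderivable/smooth_ee].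
by rewrite dzbar_ee mulr0 addr0.
Qed.

Lemma fcoef_dx f n y : smooth f -> hper f ->
  fcoef (partialC (1, 0) f) n y = 2 * pii R * n%:~R * fcoef f n y.
Proof.
move=> sf pf.
have := @cint01_dx (f * ee (- n)) y (smoothM sf (@smooth_ee _)) (hperM pf (hper_ee _)).
have E x : partialC (1, 0) (f * ee (- n)) (x +i* y) =
    partialC (1, 0) f (x +i* y) * ee (- n) (x +i* y)
    - 2 * pii R * n%:~R * (f (x +i* y) * ee (- n) (x +i* y)).
  have [a1 _ a2 _] := smooth_cderivable sf (coords (x +i* y)).
  have [b1 _ b2 _] := smooth_cderivable (@smooth_ee (- n)) (coords (x +i* y)).
  rewrite (partialCM a1 a2 b1 b2).
  have -> : partialC (1, 0) (ee (- n)) (x +i* y) = 2 * pii R * (- n)%:~R * ee (- n) (x +i* y).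
    have [[_ h1] [_ h2]] := expC_lin (2 * pii R * (- n)%:~R) 0 (x, y) (1, 0).
    move: h1 h2; rewrite /partialC.
    rewrite (_ : (fun z => expC (2 * pii R * (- n)%:~R * z + 0)) = ee (- n)); last first.
      by apply/funext => z; rewrite addr0.
    move=> -> ->; rewrite addr0 -/(ee _ _) /=.
    by rewrite -[1 +i* 0]/(1 : C) mulr1; case: (_ * _).
  move: (partialC _ _ _) (f _) (ee _ _) => A B D; rewrite mulrNz; ring.
under eq_fun do rewrite E.
have c1 : ccont (fun x => partialC (1, 0) f (x +i* y) * ee (- n) (x +i* y)).
  apply: (@ccont_hslice (partialC (1, 0) f * ee (- n))).
  by apply: smoothM (@smooth_ee _); exact: (smooth_partial sf).1.
have c2 : ccont (fun x => f (x +i* y) * ee (- n) (x +i* y)).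
  apply: (@ccont_hslice (f * ee (- n))).
  by apply: smoothM (@smooth_ee _).
by rewrite cint01B ?cint01Z//; [move/eqP; rewrite subr_eq0 => /eqP|exact: ccontZ].
Qed.

(** Multiplying back by [ee n] makes the bound uniform in n, because the moduli of [ee n] and
    [ee (- n)] at equal height cancel. *)
Lemma fcoef_bound f (Y : R) : smooth f -> exists B, 0 <= B /\
  forall n y x, `|y| <= Y -> cnorm (fcoef f n y * ee n (x +i* y)) <= B.
Proof.
move=> sf; have [c1 c2] := smooth_continuous sf.
have [K1 [K10 h1]] := bounded_rectangle 0 1 (- Y) Y c1.
have [K2 [K20 h2]] := bounded_rectangle 0 1 (- Y) Y c2.
exists (2 * (K1 + K2)); split=> [|n y x yY]; first by rewrite mulr_ge0// addr_ge0.
have yY' : - Y <= y <= Y by rewrite -ler_norml.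
have cf : ccont (fun x => f (x +i* y) * ee (- n) (x +i* y)).
  by apply: (@ccont_hslice (f * ee (- n))); apply: smoothM (@smooth_ee _).
rewrite /fcoef mulrC -cint01Z//; apply: cint01_norm => [|t t01]; first exact: ccontZ.
rewrite mulrCA cnormM (_ : cnorm (ee n _ * _) = 1) ?mulr1; last first.
  by rewrite cnormM eeN cnormV !cnorm_ee divff// gt_eqF// expR_gt0.
apply: le_trans (cnorm_le _) _; apply: lerD; [exact: (h1 t y)|exact: (h2 t y)].
Qed.

Lemma fcoef_inj f g : smooth f -> smooth g -> hper f -> hper g ->
  (forall n y, fcoef f n y = fcoef g n y) -> f = g.
Proof.
move=> sf sg pf pg fg; apply/funext => -[x y]; apply/eqP; rewrite -subr_eq0; apply/eqP.
have cf := ccont_hslice y sf; have cg := ccont_hslice y sg.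
apply: (@fourier_unique _ (fun x => f (x +i* y) - g (x +i* y))) => [|t|n].
- exact: ccontB.
- by rewrite !x1_shift pf pg.
have cfe : ccont (fun x => f (x +i* y) * ee n (x +i* y)).
  by apply: (@ccont_hslice (f * ee n)); apply: smoothM (@smooth_ee _).
have cge : ccont (fun x => g (x +i* y) * ee n (x +i* y)).
  by apply: (@ccont_hslice (g * ee n)); apply: smoothM (@smooth_ee _).
have := fg (- n) y; rewrite /fcoef opprK => /eqP.
rewrite -subr_eq0 -cint01B// => /eqP h.
have -> : (fun t => (f (t +i* y) - g (t +i* y)) * ee n t%:C) =
    fun t => ee n (0 +i* - y) * (f (t +i* y) * ee n (t +i* y) - g (t +i* y) * ee n (t +i* y)).
  apply/funext => t; rewrite -mulrBl mulrCA -eeDr addCE.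
  by rewrite add0r addNr.
by rewrite cint01Z ?h ?mulr0//; exact: ccontB.
Qed.

End SmoothFunctions.

(** * Fourier series with parameters *)

Section SummableInt.
Variable R : realType.
Local Notation C := R[i].

Lemma bsum_nat (M : nat -> R) (K : R) : (forall k, 0 <= M k) ->
  (forall m, \sum_(k < m) M k <= K) -> bsum M.
Proof.
move=> M0 MK; split=> //; exists K => B.
have [m mB] : exists m, forall k, k \in B -> (k < m)%N.
  exists (\max_(k <- B) k).+1 => k kB; rewrite ltnS.
  by rewrite (big_fsetD1 k)//= leq_maxl.
apply: le_trans (MK m); rewrite -(big_mkord xpredT M).
have sB : (B `<=` [fset k | k in index_iota 0 m])%fset.
  by apply/fsubsetP => k kB; rewrite !inE mem_index_iota mB.
have -> : \sum_(0 <= k < m) M k = \sum_(k <- [fset k | k in index_iota 0 m]%fset) M k.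
  apply/perm_big/uniq_perm; [exact: iota_uniq|exact: fset_uniq|].
  by move=> k; rewrite !inE.
by rewrite (fsum_setD _ sB) lerDl sumr_ge0.
Qed.

Lemma bsum_int (M : int -> R) : bsum (fun k : nat => M (Posz k)) ->
  bsum (fun k : nat => M (Negz k)) -> bsum M.
Proof.
move=> [P0 [K MK]] [N0 [L NL]].
have M0 n : 0 <= M n by case: n => k; [exact: P0|exact: N0].
split=> //; exists (K + L) => B.
pose B1 := [fset absz n | n in B]%fset; pose B2 := [fset (absz n).-1 | n in B]%fset.
pose D1 := (Posz @` B1)%fset; pose D2 := (Negz @` B2)%fset.
have sB : (B `<=` D1 `|` D2)%fset.
  apply/fsubsetP => n nB; rewrite inE; case: n nB => k kB; apply/orP; [left|right].
    by apply/imfsetP; exists k => //=; apply/imfsetP; exists (Posz k).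
  by apply/imfsetP; exists k => //=; apply/imfsetP; exists (Negz k).
apply: le_trans (_ : \sum_(n <- (D1 `|` D2)%fset) M n <= _).
  by rewrite (fsum_setD _ sB) lerDl sumr_ge0.
rewrite fsum_setU; last first.
  apply/fdisjointP => _ /imfsetP[k /= _ ->]; apply/negP => /imfsetP[j _].
  by [].
apply: lerD.
  by rewrite big_imfset /=; [exact: MK|move=> i j _ _ []].
by rewrite big_imfset /=; [exact: NL|move=> i j _ _ []].
Qed.

Definition wt (n : int) : R := 1 + `|n%:~R|.

Lemma wt_ge1 n : 1 <= wt n.
Proof. by rewrite lerDl. Qed.

Lemma wt_gt0 n : 0 < wt n.
Proof. exact: lt_le_trans (wt_ge1 n). Qed.

Lemma wtX_ge0 n (K : nat) : 0 <= wt n ^+ K.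
Proof. by rewrite exprn_ge0// ltW// wt_gt0. Qed.

Lemma bsum_wt : bsum (fun n => wt n ^- 2).
Proof.
have h (m : nat) : \sum_(k < m) (k.+1%:R : R) ^- 2 <= 2.
  (* Telescoping majorant: 1 / a^2 <= 2 / a - 2 / (a + 1) for a >= 1. *)
  apply: le_trans (_ : 2 - 2 * (m.+1%:R : R)^-1 <= _); last first.
    by rewrite gerBl mulr_ge0// invr_ge0.
  elim: m => [|m IH]; first by rewrite big_ord0 invr1; lra.
  rewrite big_ord_recr /=; apply: le_trans (lerD IH (lexx _)) _.
  have a1 : 1 <= (m.+1%:R : R) by rewrite ler1n.
  rewrite [m.+2%:R]mulrSr; move: (m.+1%:R : R) a1 => a a1.
  have a0 : 0 < a by exact: lt_le_trans a1.
  have a2 : 0 < a + 1 by rewrite addr_gt0.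
  rewrite -subr_ge0 (_ : _ - _ = (a - 1) / (a ^+ 2 * (a + 1))).
    by rewrite divr_ge0 ?subr_ge0// mulr_ge0 ?sqr_ge0// ltW.
  by field; rewrite !gt_eqF.
apply: bsum_int; apply: (@bsum_nat _ 2) => [k|m].
- by rewrite invr_ge0 exprn_ge0// ltW// wt_gt0.
- by apply: le_trans (h m); apply: ler_sum => k _; rewrite /wt ger0_norm// -mulrS.
- by rewrite invr_ge0 exprn_ge0// ltW// wt_gt0.
- apply: le_trans (h m); apply: ler_sum => k _.
  have k0 : 0 < (k.+1%:R : R) by [].
  rewrite /wt NegzE mulrNz normrN ger0_norm//.
  have k1 : 0 < 1 + (k.+1%:R : R) by rewrite addr_gt0.
  rewrite lef_pV2 ?posrE; [|exact: exprn_gt0|exact: exprn_gt0].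
  by apply: lerXn2r; rewrite ?nnegrE ?ltW// ltrDr.
Qed.

End SummableInt.

Section FourierSeries.
Variable R : realType.
Local Notation C := R[i].
Implicit Types (u v : int -> R -> C) (z : C) (x y : R) (n m : int) (k : nat).

Definition term u n z : C := u n (complex.Im z) * ee n z.

(** Rapid decay of the whole terms, exponential included, uniformly on strips. All powers of the
    weight are demanded because each x-derivative multiplies a term by n. *)
Definition decay u : Prop := forall (K : nat) (Y : R), exists B, 0 <= B /\
  forall n z, `|complex.Im z| <= Y -> cnorm (term u n z) * wt R n ^+ K <= B.

(** The counterpart of C^k for coefficients. Continuity in y is not recorded and has to be drawn
    from differentiability, which is why [RD_Cnc] loses one order. *)
Fixpoint RD k u : Prop := decay u /\
  if k is k'.+1 then
    exists v, (forall n y, has_deriv (u n) y (v n y)) /\ RD k' v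
  else True.

Definition fser u z : C := csum (fun n => term u n z).

Lemma RD_decay k u : RD k u -> decay u.
Proof. by case: k => [|k] []. Qed.

Lemma RDW k u : RD k.+1 u -> RD k u.
Proof.
elim: k u => [|k IH] u [du [v [uv Rv]]]; first by [].
by split=> //; exists v; split=> //; exact: IH.
Qed.

Lemma decayD u v : decay u -> decay v -> decay (fun n y => u n y + v n y).
Proof.
move=> du dv K Y; have [B [B0 hB]] := du K Y; have [D [D0 hD]] := dv K Y.
exists (B + D); split=> [|n z zY]; first exact: addr_ge0.
apply: le_trans (lerD (hB n z zY) (hD n z zY)).
rewrite -mulrDl ler_wpM2r ?wtX_ge0//.
by rewrite /term mulrDl cnormD.
Qed.

Lemma decayZ (c : C) u : decay u -> decay (fun n y => c * n%:~R * u n y).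
Proof.
move=> du K Y; have [B [B0 hB]] := du K.+1 Y.
exists (cnorm c * B); split=> [|n z zY]; first by rewrite mulr_ge0// cnorm_ge0.
apply: le_trans (_ : cnorm c * (cnorm (term u n z) * wt R n ^+ K.+1) <= _).
  rewrite /term -mulrA -mulrA !cnormM -!mulrA ler_wpM2l ?cnorm_ge0//.
  rewrite mulrCA ler_wpM2l ?cnorm_ge0// exprS mulrCA ler_wpM2l ?cnorm_ge0//.
  rewrite ler_wpM2r ?wtX_ge0//.
  by rewrite intrC cnorm_real /wt lerDr.
by rewrite ler_wpM2l ?cnorm_ge0// hB.
Qed.

Lemma decayZ1 (c : C) u : decay u -> decay (fun n y => c * u n y).
Proof.
move=> du K Y; have [B [B0 hB]] := du K Y.
exists (cnorm c * B); split=> [|n z zY]; first by rewrite mulr_ge0// cnorm_ge0.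
by rewrite /term -mulrA cnormM -mulrA ler_wpM2l ?cnorm_ge0// hB.
Qed.

Lemma RDD k u v : RD k u -> RD k v -> RD k (fun n y => u n y + v n y).
Proof.
elim: k u v => [|k IH] u v [du hu] [dv hv]; split=> //; try exact: decayD.
move: hu hv => [u' [uu' Ru']] [v' [vv' Rv']].
exists (fun n y => u' n y + v' n y); split=> [n y|]; first exact: has_derivD.
exact: IH.
Qed.

Lemma RDZ k (c : C) u : RD k u -> RD k (fun n y => c * n%:~R * u n y).
Proof.
elim: k u => [|k IH] u [du hu]; split=> //; try exact: decayZ.
move: hu => [u' [uu' Ru']]; exists (fun n y => c * n%:~R * u' n y).
by split=> [n y|]; [exact: has_derivZ|exact: IH].
Qed.

Lemma RDZ1 k (c : C) u : RD k u -> RD k (fun n y => c * u n y).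
Proof.
elim: k u => [|k IH] u [du hu]; split=> //; try exact: decayZ1.
move: hu => [u' [uu' Ru']]; exists (fun n y => c * u' n y).
by split=> [n y|]; [exact: has_derivZ|exact: IH].
Qed.

Lemma decay_dom u (Y : R) : decay u -> exists M : int -> R, bsum M /\
  forall n z, `|complex.Im z| <= Y -> cnorm (term u n z) <= M n.
Proof.
move=> du; have [B [B0 hB]] := du 2%N Y.
exists (fun n => B * wt R n ^- 2); split=> [|n z zY].
  by apply: bsumZ => //; exact: bsum_wt.
by rewrite ler_pdivlMr ?exprn_gt0 ?wt_gt0// hB.
Qed.

Lemma fser_has_sum u z : decay u -> has_sum (term u ^~ z) (fser u z).
Proof.
move=> du; have [M [bM hM]] := decay_dom `|complex.Im z| du.
have [s hs] := has_sum_ex bM (fun n => hM n z (lexx _)).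
by rewrite /fser (has_sum_csum hs).
Qed.

Lemma hper_fser u : hper (fser u).
Proof.
move=> z; congr csum; apply/funext => n; rewrite /term hper_ee.
by case: z => x y /=; rewrite addr0.
Qed.

Lemma is_derive_quot (f : R -> R) x (d : R) :
  (forall e, 0 < e -> \forall h \near 0^', `|h^-1 * (f (h + x) - f x) - d| < e) ->
  is_derive x 1 f d.
Proof.
move=> H.
have E : (fun h : R => h^-1 *: ((f \o shift x) (h *: 1) - f x)) =
    (fun h : R => h^-1 * (f (h + x) - f x)).
  by apply/funext => h; rewrite /= /GRing.scale /= mulr1.
have cv : h^-1 * (f (h + x) - f x) @[h --> 0^'] --> d.
  apply/cvgrPdist_lt => e e0; have := H e e0; apply: filterS => h.
  by rewrite distrC.
split; first by rewrite /derivable E; apply/cvg_ex; exists d.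
by rewrite /derive E; apply: cvg_lim cv; exact: norm_hausdorff.
Qed.

Lemma is_derive_quotP (f : R -> R) x (d : R) : is_derive x 1 f d ->
  forall e, 0 < e -> \forall h \near 0^', `|h^-1 * (f (h + x) - f x) - d| < e.
Proof.
move=> [df <-] e e0.
have E : (fun h : R => h^-1 *: ((f \o shift x) (h *: 1) - f x)) =
    (fun h : R => h^-1 * (f (h + x) - f x)).
  by apply/funext => h; rewrite /= /GRing.scale /= mulr1.
have : h^-1 * (f (h + x) - f x) @[h --> 0^'] --> 'D_1 f x.
  by move: df; rewrite /derivable /derive E.
move=> /cvgrPdist_lt /(_ e e0); apply: filterS => h; by rewrite distrC.
Qed.

Lemma has_deriv_quot (f : R -> C) x (d : C) :
  ctends (0^' : set_system R) (fun h : R => (h^-1)%:C * (f (h + x) - f x)) d <->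
  has_deriv f x d.
Proof.
have Eq (h : R) : complex.Re ((h^-1)%:C * (f (h + x) - f x) - d) =
      h^-1 * (complex.Re (f (h + x)) - complex.Re (f x)) - complex.Re d /\
    complex.Im ((h^-1)%:C * (f (h + x) - f x) - d) =
      h^-1 * (complex.Im (f (h + x)) - complex.Im (f x)) - complex.Im d.
  rewrite ReD ImD ReM ImM !(ReD, ImD, ReN, ImN) /=; split; ring.
split=> [H|[h1 h2] e e0].
  split; apply: is_derive_quot => e e0; have := H e e0; apply: filterS => h hh.
    by rewrite -(Eq h).1; apply: le_lt_trans (Re_le_cnorm _) hh.
  by rewrite -(Eq h).2; apply: le_lt_trans (Im_le_cnorm _) hh.
have e2 : 0 < e / 2 by rewrite divr_gt0.
near=> h; apply: le_lt_trans (cnorm_le _) _; rewrite (Eq h).1 (Eq h).2.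
rewrite [ltRHS]splitr; apply: ltrD; near: h; exact: is_derive_quotP.
Unshelve. all: by end_near. Qed.

Lemma has_deriv_lip (f f' : R -> C) (K a b : R) : a <= b ->
  (forall x, has_deriv f x (f' x)) ->
  (forall x, a <= x <= b -> cnorm (f' x) <= K) ->
  cnorm (f b - f a) <= 2 * K * (b - a).
Proof.
move=> ab ff' fK.
have real_case (g g' : R -> R) : (forall x, is_derive x 1 g (g' x)) ->
    (forall x, a <= x <= b -> `|g' x| <= K) -> `|g b - g a| <= K * (b - a).
  move=> gg' gK; have [c cab ->] := @MVT_segment R g g' a b ab (fun x _ => gg' x)
    (continuous_subspaceT (is_derive_continuous gg')).
  rewrite normrM [X in _ * X]ger0_norm ?subr_ge0// ler_wpM2r ?subr_ge0//.
  by apply: gK; move: cab; rewrite in_itv.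
apply: le_trans (cnorm_le _) _; rewrite ReD ImD ReN ImN.
have h1 := real_case _ _ (fun x => (ff' x).1) (fun x xab => le_trans (Re_le_cnorm _) (fK x xab)).
have h2 := real_case _ _ (fun x => (ff' x).2) (fun x xab => le_trans (Im_le_cnorm _) (fK x xab)).
by apply: le_trans (lerD h1 h2) _; rewrite -mulrDl -mulr2n -[K *+ 2]mulr_natl.
Qed.

(** By the mean value inequality the difference quotients of the terms are dominated by 2 M, so
    Tannery's theorem applies to their sum. *)
Lemma has_sum_deriv (I : choiceType) (M : I -> R) (f f' : I -> R -> C)
    (S : R -> C) (d : C) x :
  bsum M -> (forall i t, has_deriv (f i) t (f' i t)) ->
  (forall i t, `|t - x| <= 1 -> cnorm (f' i t) <= M i) ->
  (forall t, `|t - x| <= 1 -> has_sum (f ^~ t) (S t)) -> has_sum (f' ^~ x) d ->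
  has_deriv S x d.
Proof.
move=> bM ff' f'M fS f'd; apply/has_deriv_quot.
have M0 i : 0 <= M i by have [] := bM.
have near1 : \forall h \near (0^' : set_system R), h != 0 /\ `|h| <= 1.
  near=> h; split; first by near: h; exact: nbhs_dnbhs_neq.
  near: h; apply: nbhs_dnbhs; apply/nbhs_ballP; exists 1 => //= h.
  by rewrite /ball /= sub0r normrN => /ltW.
have lip i (h : R) : `|h| <= 1 -> cnorm (f i (h + x) - f i x) <= 2 * M i * `|h|.
  move=> h1; have [h0|h0] := leP 0 h.
    have := @has_deriv_lip (f i) (f' i) (M i) x (h + x).
    rewrite addrK ger0_norm// => -> //; first by rewrite lerDr.
    move=> t /andP[t1 t2]; apply: f'M; rewrite ger0_norm ?subr_ge0//.
    by apply: le_trans h1; rewrite ger0_norm// lerBlDr.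
  have := @has_deriv_lip (f i) (f' i) (M i) (h + x) x.
  rewrite -cnormN opprB (_ : x - (h + x) = `|h|); last first.
    by rewrite ltr0_norm//; ring.
  move=> -> //; first by rewrite gerDr ltW.
  move=> t /andP[t1 t2]; apply: f'M; rewrite ler0_norm ?subr_le0//.
  by apply: le_trans h1; rewrite ltr0_norm// opprB; lra.
apply: (@has_sum_ctends _ _ _ _ _ (fun i => 2 * M i)
    (fun (h : R) i => (h^-1)%:C * (f i (h + x) - f i x)) (f' ^~ x)).
- exact: bsumZ.
- apply: filterS near1 => h [h0 h1] i; rewrite cnormM cnorm_real normfV.
  by rewrite mulrC ler_pdivrMr ?normr_gt0// lip.
- by move=> i; apply: le_trans (f'M i x _) _; rewrite ?subrr ?normr0// ler_peMl// ler1n.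
- by move=> i; apply/has_deriv_quot.
- apply: filterS near1 => h [h0 h1]; apply: has_sumZ; apply: has_sumB.
    by apply: fS; rewrite addrK.
  by apply: fS; rewrite subrr normr0.
- exact: f'd.
Unshelve. all: by end_near. Qed.

End FourierSeries.

(** * Smoothness of Fourier series and decay of Fourier coefficients *)

Section SmoothSeries.
Variable R : realType.
Local Notation C := R[i].
Implicit Types (u v : int -> R -> C) (z : C) (x y : R) (n m : int) (k : nat).
Implicit Types (f g : C -> C).

Definition Cnc k f : Prop := Cn k (reC f) /\ Cn k (imC f).

Lemma CncM k f g : Cnc k f -> Cnc k g -> Cnc k (f * g).
Proof.
move=> [f1 f2] [g1 g2]; rewrite /Cnc reCM imCM; split.
  apply: CnD; first exact: CnM.
  by apply: CnM; [exact: Cn_cst|exact: CnM].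
by apply: CnD; apply: CnM.
Qed.

Lemma is_derive_slice1 (U : R * R -> R) x y (d : R) :
  is_derive x 1 (fun t => U (t, y)) d -> is_derive (x, y) (1, 0) U d.
Proof.
have E : (fun h : R => h^-1 *: (((fun t => U (t, y)) \o shift x) (h *: 1) - U (x, y))) =
         (fun h : R => h^-1 *: ((U \o shift (x, y)) (h *: (1, 0)) - U (x, y))).
  apply/funext => h /=; congr (_ *: (U _ - _)).
  by transitivity (h * 1 + x, h * 0 + y); rewrite // mulr0 add0r.
by move=> [d1 d2]; split; [move: d1|move: d2]; rewrite /derivable /derive E.
Qed.

Lemma is_derive_slice2 (U : R * R -> R) x y (d : R) :
  is_derive y 1 (fun t => U (x, t)) d -> is_derive (x, y) (0, 1) U d.
Proof.
have E : (fun h : R => h^-1 *: (((fun t => U (x, t)) \o shift y) (h *: 1) - U (x, y))) =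
         (fun h : R => h^-1 *: ((U \o shift (x, y)) (h *: (0, 1)) - U (x, y))).
  apply/funext => h /=; congr (_ *: (U _ - _)).
  by transitivity (h * 0 + x, h * 1 + y); rewrite // mulr0 add0r.
by move=> [d1 d2]; split; [move: d1|move: d2]; rewrite /derivable /derive E.
Qed.

Lemma ctends_near0 f (p : R * R) (e : R) : Cnc 0 f -> 0 < e ->
  \forall q \near p, cnorm (f (q.1 +i* q.2) - f (p.1 +i* p.2)) < e.
Proof.
move=> [[f1 _] [f2 _]] e0; have e2 : 0 < e / 2 by rewrite divr_gt0.
have h1 : \forall q \near p, `|reC f p - reC f q| < e / 2.
  by apply: (@cvgr_dist_lt _ _ _ (nbhs p) _ (reC f)) => //; exact: f1.
have h2 : \forall q \near p, `|imC f p - imC f q| < e / 2.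
  by apply: (@cvgr_dist_lt _ _ _ (nbhs p) _ (imC f)) => //; exact: f2.
near=> q; apply: le_lt_trans (cnorm_le _) _; rewrite ReD ImD ReN ImN distrC.
rewrite [X in _ + X]distrC [ltRHS]splitr; apply: ltrD; by near: q.
Unshelve. all: by end_near. Qed.

Lemma Cnc0_term u n : ccont (u n) -> Cnc 0 (term u n).
Proof.
move=> [c1 c2]; apply: (@CncM 0 (fun z => u n (complex.Im z)) (ee n)).
  split; split=> // p.
    by apply: (@continuous_comp _ _ _ snd (fun y => complex.Re (u n y)));
      [exact: cvg_snd|exact: c1].
  by apply: (@continuous_comp _ _ _ snd (fun y => complex.Im (u n y)));
    [exact: cvg_snd|exact: c2].
exact: (@smooth_ee R n 0%N).
Qed.

Lemma fser_continuous u : decay u -> (forall n, ccont (u n)) -> Cnc 0 (fser u).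
Proof.
move=> du cu.
have key (p : R * R) : ctends (nbhs p) (fun q => fser u (q.1 +i* q.2)) (fser u (p.1 +i* p.2)).
  have [M [bM hM]] := decay_dom (`|p.2| + 1) du.
  apply: (@has_sum_ctends _ _ _ _ _ M (fun q n => term u n (q.1 +i* q.2))
    (fun n => term u n (p.1 +i* p.2))) => //.
  - have h : \forall q \near p, `|p.2 - q.2| < 1.
      by apply: (@cvgr_dist_lt _ _ _ (nbhs p) _ snd) => //; exact: cvg_snd.
    apply: filterS h => q qp n; apply: hM => /=.
    have := ler_normD (q.2 - p.2) p.2; rewrite subrK distrC; lra.
  - by move=> n; apply: hM; rewrite /= lerDl.
  - by move=> n e e0; apply: (@ctends_near0 (term u n)) => //; exact: Cnc0_term.
  - by apply: nearW => q; exact: fser_has_sum.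
  - exact: fser_has_sum.
split; split=> // p; apply/cvgrPdist_lt => e e0; have := key p e e0; apply: filterS => q.
  by apply: le_lt_trans; rewrite distrC /reC -ReN -ReD Re_le_cnorm.
by apply: le_lt_trans; rewrite distrC /imC -ImN -ImD Im_le_cnorm.
Qed.

Lemma has_deriv_ee_v n x y : has_deriv (fun t => ee n (x +i* t) : C) y
  (- 2 * pi%:C * n%:~R * ee n (x +i* y)).
Proof.
have := has_deriv_expC (- 2 * pi%:C * n%:~R) (2 * pii R * n%:~R * x%:C) y.
have E t : - 2 * pi%:C * n%:~R * t%:C + 2 * pii R * n%:~R * x%:C =
    2 * pii R * n%:~R * (x +i* t) :> C.
  rewrite natrC intrC /pii -rmorphN -!rmorphM /= !(mulCE, addCE); congr (_ +i* _); ring.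
by under [X in has_deriv X]funext do rewrite E; rewrite E.
Qed.

Lemma has_deriv_ee_h n x y : has_deriv (fun t => ee n (t +i* y) : C) x
  (2 * pii R * n%:~R * ee n (x +i* y)).
Proof.
have := has_deriv_expC (2 * pii R * n%:~R) (2 * pii R * n%:~R * (0 +i* y)) x.
have E t : 2 * pii R * n%:~R * t%:C + 2 * pii R * n%:~R * (0 +i* y) =
    2 * pii R * n%:~R * (t +i* y) :> C.
  by rewrite -mulrDr addCE addr0 add0r.
by under [X in has_deriv X]funext do rewrite E; rewrite E.
Qed.

Lemma fser_dx u x y : decay u ->
  has_deriv (fun t => fser u (t +i* y)) x
    (fser (fun n y => 2 * pii R * n%:~R * u n y) (x +i* y)).
Proof.
move=> du; have dv := decayZ (2 * pii R) du.
have [M [bM hM]] := decay_dom `|y| dv.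
apply: (@has_sum_deriv R _ M (fun n t => term u n (t +i* y))
  (fun n t => term (fun n y => 2 * pii R * n%:~R * u n y) n (t +i* y))) => //.
- move=> n t; have := has_derivZ (u n y) (has_deriv_ee_h n t y).
  by rewrite /term /= mulrCA mulrA.
- by move=> n t _; apply: hM.
- by move=> t _; exact: fser_has_sum.
- exact: fser_has_sum.
Qed.

Lemma fser_dy u v x y : decay u -> decay v ->
  (forall n y, has_deriv (u n) y (v n y)) ->
  has_deriv (fun t => fser u (x +i* t)) y
    (fser (fun n y => v n y + - 2 * pi%:C * n%:~R * u n y) (x +i* y)).
Proof.
move=> du dv uv; have dw := decayD dv (decayZ (- 2 * pi%:C) du).
have [M [bM hM]] := decay_dom (`|y| + 1) dw.
apply: (@has_sum_deriv R _ M (fun n t => term u n (x +i* t))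
  (fun n t => term (fun n y => v n y + - 2 * pi%:C * n%:~R * u n y) n (x +i* t))) => //.
- move=> n t; have := has_derivM (uv n t) (has_deriv_ee_v n x t).
  rewrite /term /=; congr has_deriv.
  by rewrite mulrDl; congr (_ + _); rewrite mulrCA mulrA.
- move=> n t ty; apply: hM => /=.
  by have := ler_normD (t - y) y; rewrite subrK; lra.
- by move=> t _; exact: fser_has_sum.
- exact: fser_has_sum.
Qed.

Lemma RD_Cnc k u : RD k.+1 u -> Cnc k (fser u).
Proof.
elim: k u => [|k IH] u.
  move=> [du [v [uv _]]]; apply: fser_continuous => // n.
  exact: has_deriv_ccont (uv n).
move=> Ru; have Rk := RDW Ru; have [Cu1 Cu2] := IH _ Rk.
have [du [v [uv Rv']]] := Ru; have {Rv'} Rv : RD k.+1 v := Rv'; have dv := RD_decay Rv.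
have [X1 X2] := IH _ (RDZ (2 * pii R) Rk).
have [Y1 Y2] := IH _ (RDD Rv (RDZ (- 2 * pi%:C) Rk)).
have dx x y := fser_dx x y du; have dy x y := fser_dy x y du dv uv.
have C0 (U : R * R -> R) : Cn k U -> continuous U by case: (k) => [|j] [].
have c1 := C0 _ Cu1; have c2 := C0 _ Cu2.
split.
  split; first exact: c1.
  split.
  - by move=> [x y]; have [] := is_derive_slice1 (U := reC (fser u)) (dx x y).1.
  - by move=> [x y]; have [] := is_derive_slice2 (U := reC (fser u)) (dy x y).1.
  - have -> : (fun p => 'D_(1, 0) (reC (fser u)) p) =
        reC (fser (fun n y => 2 * pii R * n%:~R * u n y)).
      apply/funext => -[x y].
      by have [_ ->] := is_derive_slice1 (U := reC (fser u)) (dx x y).1.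
    exact: X1.
  - have -> : (fun p => 'D_(0, 1) (reC (fser u)) p) =
        reC (fser (fun n y => v n y + - 2 * pi%:C * n%:~R * u n y)).
      apply/funext => -[x y].
      by have [_ ->] := is_derive_slice2 (U := reC (fser u)) (dy x y).1.
    exact: Y1.
split; first exact: c2.
split.
- by move=> [x y]; have [] := is_derive_slice1 (U := imC (fser u)) (dx x y).2.
- by move=> [x y]; have [] := is_derive_slice2 (U := imC (fser u)) (dy x y).2.
- have -> : (fun p => 'D_(1, 0) (imC (fser u)) p) =
      imC (fser (fun n y => 2 * pii R * n%:~R * u n y)).
    apply/funext => -[x y].
    by have [_ ->] := is_derive_slice1 (U := imC (fser u)) (dx x y).2.
  exact: X2.
- have -> : (fun p => 'D_(0, 1) (imC (fser u)) p) =
      imC (fser (fun n y => v n y + - 2 * pi%:C * n%:~R * u n y)).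
    apply/funext => -[x y].
    by have [_ ->] := is_derive_slice2 (U := imC (fser u)) (dy x y).2.
  exact: Y2.
Qed.

Lemma smooth_fser u : (forall k, RD k u) -> smooth (fser u).
Proof. by move=> Ru k; exact: RD_Cnc (Ru k.+1). Qed.

Lemma cint01_ee n y : cint01 (fun x => ee n (x +i* y) : C) = (n == 0)%:R.
Proof.
have [->|n0] := eqVneq n 0.
  by rewrite -[RHS](cint01_cst (1 : C)); congr cint01; apply/funext => x; rewrite ee0.
have k0 : 2 * pii R * n%:~R != 0 :> C.
  rewrite !mulf_neq0 ?intr_eq0 ?pnatr_eq0// /pii eq_complex /= eqxx /=.
  by rewrite gt_eqF// pi_gt0.
have cee : ccont (fun x => ee n (x +i* y)) by exact/ccont_hslice/smooth_ee.
apply: (mulfI k0); rewrite -(cint01Z _ cee) mulr0.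
rewrite (cint01_FTC (ccontZ _ cee) (fun x => has_deriv_ee_h n x y)).
have := hper_ee n (0 +i* y); rewrite -x1_shift add0r => ->.
by rewrite subrr.
Qed.

Lemma has_sum_delta (I : choiceType) (w : I -> C) i0 :
  (forall i, i != i0 -> w i = 0) -> has_sum w (w i0).
Proof.
move=> w0 e e0; exists [fset i0]%fset => B /fsubsetP /(_ i0).
rewrite inE eqxx => /(_ isT) iB; rewrite (big_fsetD1 i0)//= big1_fset.
  by rewrite addr0 subrr cnorm0.
by move=> i; rewrite !inE => /andP[/w0].
Qed.

Lemma fcoef_fser u n y : RD 1 u -> fcoef (fser u) n y = u n y.
Proof.
move=> Ru; have du := RD_decay Ru; have [c1 c2] := RD_Cnc Ru.
have [M [bM hM]] := decay_dom `|y| du.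
have slice (U : R * R -> R) : continuous U -> continuous (fun x => U (x, y)).
  move=> cu x; apply: (@continuous_comp _ _ _ (fun x => (x, y)) U); last exact: cu.
  by apply: (@cvg_pair _ _ _ (nbhs x) (nbhs x) (nbhs y)); [exact: cvg_id|exact: cvg_cst].
have cf : ccont (fun x => fser u (x +i* y)).
  by split; [exact: slice c1.1|exact: slice c2.1].
have cee m : ccont (fun x => ee m (x +i* y) : C) by exact/ccont_hslice/smooth_ee.
have H : has_sum (fun m => cint01 (fun x => term u m (x +i* y) * ee (- n) (x +i* y)))
    (fcoef (fser u) n y).
  apply: (@cint01_has_sum R _ (fun m => expR (- 2 * pi * (- n)%:~R * y) * M m)).
  - by apply: bsumZ => //; exact: expR_ge0.
  - move=> m; apply: ccontM; last exact: cee.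
    exact: (ccontZ (u m y) (cee m)).
  - by apply: ccontM.
  - by move=> m t _; rewrite mulrC cnormM cnorm_ee /= ler_pM2l ?expR_gt0// hM.
  - move=> t _; have := has_sumZ (ee (- n) (t +i* y)) (fser_has_sum (t +i* y) du).
    by rewrite mulrC; apply: has_sum_eq => m; rewrite mulrC.
have E m : cint01 (fun x => term u m (x +i* y) * ee (- n) (x +i* y)) = u m y * (m == n)%:R.
  rewrite -subr_eq0 -(cint01_ee (m - n) y) -cint01Z//.
  by congr cint01; apply/funext => x; rewrite /term -mulrA -eeDl.
apply: has_sum_unique H _; under [X in has_sum X]funext do rewrite E.
have := @has_sum_delta _ (fun m => u m y * (m == n)%:R) n.
rewrite eqxx mulr1; apply=> m /negPf ->; exact: mulr0.
Qed.

(** Integration by parts: each power of the weight is paid for by one x-derivative, which multiplies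
    the n-th coefficient by 2 pi i n. *)
Lemma fcoef_decay f : smooth f -> hper f -> decay (fcoef f).
Proof.
move=> sf pf K; elim: K f sf pf => [|K IH] f sf pf Y.
  have [B [B0 hB]] := fcoef_bound Y sf; exists B; split=> // n [x y] zY.
  by rewrite expr0 mulr1; exact: hB.
have [B [B0 hB]] := IH f sf pf Y.
have [D [D0 hD]] := IH _ (smooth_partial sf).1 (hper_partial (1, 0) pf) Y.
exists (B + D); split=> [|n z zY]; first exact: addr_ge0.
rewrite exprSr mulrA [wt R n]/wt mulrDr mulr1; apply: lerD; first exact: hB.
apply: le_trans (hD n z zY); rewrite mulrAC ler_wpM2r ?wtX_ge0//.
rewrite /term fcoef_dx// !cnormM natrC intrC !cnorm_real cnorm_im.
have := cnorm_ge0 (fcoef f n (complex.Im z)); have := cnorm_ge0 (ee n z).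
have : 2 <= `|pi| * 2 :> R by rewrite ger0_norm ?pi_ge0//; have := @pi_ge2 R; lra.
have -> : `|2 : R| = 2 by rewrite ger0_norm.
have := normr_ge0 (n%:~R : R).
have arith (a b c p : R) : 0 <= a -> 2 <= p * 2 -> 0 <= c -> 0 <= b ->
    b * c * a <= 2 * p * a * b * c.
  move=> a0 p2 c0 b0; have h : 0 <= b * c * a by rewrite !mulr_ge0.
  by rewrite (_ : 2 * p * a * b * c = (p * 2) * (b * c * a)); [nra|ring].
by move=> *; exact: arith.
Qed.

Lemma fcoef_RD k f : smooth f -> hper f -> RD k (fcoef f).
Proof.
elim: k f => [|k IH] f sf pf; split=> //; try exact: fcoef_decay.
exists (fun n y => (0 +i* - 2) * fcoef (dzbar f) n y); split=> [n y|].
  exact: fcoef_deriv.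
apply: RDZ1; apply: IH; [exact: smooth_dzbar|exact: hper_dzbar].
Qed.

End SmoothSeries.

(** * Sections and theta functions *)

Section Sections.
Variables (R : realType) (tau : R[i]).
Local Notation C := R[i].
Local Notation t2 := (complex.Im tau).
Hypothesis tau_gt0 : 0 < t2.
Implicit Types (f g : C -> C) (z : C) (x y : R) (n m : int) (k : nat).

(* [qp r] is q ^ (r / 2). *)
Definition qp (r : R) : C := expC (pii R * tau * r%:C).

Lemma qpD r s : qp (r + s) = qp r * qp s.
Proof. by rewrite /qp rmorphD mulrDr expCD. Qed.

Lemma qp0 : qp 0 = 1.
Proof. by rewrite /qp mulr0 expC0. Qed.

Lemma qp_neq0 r : qp r != 0.
Proof. exact: expC_neq0. Qed.

Lemma cnorm_qp r : cnorm (qp r) = expR (- (pi * t2 * r)).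
Proof.
rewrite /qp cnorm_expC /pii; congr expR; case: tau => a b /=; ring.
Qed.

Lemma ee_tau n : ee n tau = qp (2 * n%:~R).
Proof.
rewrite /ee /qp; congr expC; rewrite rmorphM rmorph_int rmorph_nat; ring.
Qed.

Lemma automorphyE (N m : int) z :
  automorphy tau N m z = qp (- (N%:~R * m%:~R ^+ 2)) * ee (- (N * m)) z.
Proof.
rewrite /automorphy /qp /ee -expCD; congr expC.
rewrite rmorphN rmorphM rmorphXn !rmorph_int mulrNz intrM; ring.
Qed.

Lemma automorphy0 (N : int) z : automorphy tau N 0 z = 1.
Proof. by rewrite automorphyE mulr0 oppr0 ee0 mulr0z expr0n /= mulr0 oppr0 qp0 mulr1. Qed.

Lemma automorphy_cocycle (N m m' : int) z :
  automorphy tau N (m + m') z = automorphy tau N m z * automorphy tau N m' (z + m%:~R * tau).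
Proof.
rewrite /automorphy -expCD; congr expC; rewrite intrD.
by move: (N%:~R) (m%:~R) (m'%:~R) => a b c; ring.
Qed.

(** The automorphy factors form a cocycle, so the laws for the two generators 1 and tau imply the
    law for all of Z^2. *)
Lemma section_mk (N : int) f : smooth f -> hper f ->
  (forall z, f (z + tau) = f z * automorphy tau N 1 z) -> f \in is_section tau N.
Proof.
move=> sf pf qf; apply/asboolP; split=> // m n z; rewrite hper_int//.
have nat_case (j : nat) w : f (w + j%:R * tau) = f w * automorphy tau N j w.
  elim: j w => [|j IH] w; first by rewrite mul0r addr0 automorphy0 mulr1.
  rewrite mulrSr mulrDl mul1r addrA qf IH -mulrA.
  by rewrite -addn1 PoszD automorphy_cocycle.
case: m => j; first exact: nat_case.
rewrite NegzE; set w := z + _.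
have zw : z = w + j.+1%:R * tau by rewrite /w mulrNz mulNr subrK.
have := nat_case j.+1 w; rewrite -zw => ->; rewrite -mulrA.
have := automorphy_cocycle N (- j.+1%:Z) j.+1 z.
by rewrite addNr automorphy0 -/w [_ * automorphy _ _ _ w]mulrC => <-; rewrite mulr1.
Qed.

Lemma csec_smooth (N : int) (s : csec tau N) : smooth s.
Proof. by have [] := csecP s. Qed.

Lemma csec_hper (N : int) (s : csec tau N) : hper s.
Proof.
move=> z; have [_ /(_ 0 1 z)] := csecP s.
by rewrite mul0r addr0 automorphy0 mulr1.
Qed.

Lemma csec_qper (N : int) (s : csec tau N) z : s (z + tau) = s z * automorphy tau N 1 z.
Proof. by have [_ /(_ 1 0 z)] := csecP s; rewrite mul1r addr0. Qed.

Lemma fcoef_tau f n y : smooth f -> hper f ->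
  fcoef (fun z => f (z + tau)) n y = qp (2 * n%:~R) * fcoef f n (y + t2).
Proof.
move=> sf pf; rewrite /fcoef.
have cf : ccont (fun x => f (x +i* (y + t2)) * ee (- n) (x +i* (y + t2))).
  by apply: (@ccont_hslice _ (f * ee (- n))); apply: smoothM (@smooth_ee _ _).
rewrite -(cint01_shift (complex.Re tau) cf); last first.
  by move=> x; rewrite !x1_shift pf hper_ee.
rewrite -cint01Z; last first.
  have [c1 c2] := cf.
  have sh : continuous (fun x : R => x + complex.Re tau).
    by move=> x; apply: cvgD; [exact: cvg_id|exact: cvg_cst].
  split=> x.
    by apply: (@continuous_comp _ _ _ (fun x : R => x + complex.Re tau)
      (fun x => complex.Re (f (x +i* (y + t2)) * ee (- n) (x +i* (y + t2)))));
      [exact: sh|exact: c1].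
  by apply: (@continuous_comp _ _ _ (fun x : R => x + complex.Re tau)
      (fun x => complex.Im (f (x +i* (y + t2)) * ee (- n) (x +i* (y + t2)))));
      [exact: sh|exact: c2].
congr cint01; apply/funext => x.
have -> : (x + complex.Re tau) +i* (y + t2) = (x +i* y) + tau.
  by case: (tau) => a b; rewrite addCE.
rewrite eeDr (eeN n tau) ee_tau [RHS]mulrC -!mulrA mulVf ?qp_neq0//.
by rewrite mulr1.
Qed.

Lemma fcoef_mulee f m n y : fcoef (fun z => f z * ee m z) n y = fcoef f (n - m) y.
Proof.
rewrite /fcoef; congr cint01; apply/funext => x.
by rewrite -mulrA -eeDl opprB.
Qed.

Lemma fcoefZ (c : C) f n y : smooth f -> fcoef (fun z => c * f z) n y = c * fcoef f n y.
Proof.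
move=> sf; rewrite /fcoef -cint01Z.
  by congr cint01; apply/funext => x; rewrite mulrA.
by apply: (@ccont_hslice _ (f * ee (- n))); apply: smoothM (@smooth_ee _ _).
Qed.

Lemma fcoefD f g n y : smooth f -> smooth g ->
  fcoef (fun z => f z + g z) n y = fcoef f n y + fcoef g n y.
Proof.
move=> sf sg; rewrite /fcoef -cint01D.
- by congr cint01; apply/funext => x; rewrite mulrDl.
- by apply: (@ccont_hslice _ (f * ee (- n))); apply: smoothM (@smooth_ee _ _).
- by apply: (@ccont_hslice _ (g * ee (- n))); apply: smoothM (@smooth_ee _ _).
Qed.

Lemma fcoef0 n y : fcoef (fun _ : C => 0) n y = 0.
Proof.
rewrite /fcoef -[RHS](cint01_cst (0 : C)); congr cint01; apply/funext => x.
by rewrite mul0r.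
Qed.

Lemma smooth_sum (I : Type) (r : seq I) (F : I -> C -> C) :
  (forall i, smooth (F i)) -> smooth (fun z => \sum_(i <- r) F i z).
Proof.
move=> sF; elim: r => [|i r IH].
  by under [X in smooth X]funext do rewrite big_nil; exact: smooth_cst.
by under [X in smooth X]funext do rewrite big_cons; exact: (smoothD (sF i) IH).
Qed.

Lemma fcoef_sum (I : Type) (r : seq I) (F : I -> C -> C) n y :
  (forall i, smooth (F i)) ->
  fcoef (fun z => \sum_(i <- r) F i z) n y = \sum_(i <- r) fcoef (F i) n y.
Proof.
move=> sF; elim: r => [|i r IH].
  by under [X in fcoef X]funext do rewrite big_nil; rewrite big_nil fcoef0.
under [X in fcoef X]funext do rewrite big_cons.
by rewrite big_cons fcoefD ?IH//; exact: smooth_sum.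
Qed.

(** Consequently the coefficients of one residue class mod N are, up to powers of q, translates of a
    single function of the height. *)
Lemma fcoef_qper (N : int) f n y : smooth f -> hper f ->
  (forall z, f (z + tau) = f z * automorphy tau N 1 z) ->
  fcoef f n (y + t2) = qp (- (N%:~R + 2 * n%:~R)) * fcoef f (n + N) y.
Proof.
move=> sf pf qf; have := fcoef_tau n y sf pf.
under [X in fcoef X]funext do rewrite qf automorphyE mulr1 expr1n mulr1 mulrCA.
rewrite fcoefZ; last by apply: smoothM (@smooth_ee _ _).
rewrite fcoef_mulee opprK => h; apply: (mulfI (qp_neq0 (2 * n%:~R))).
by rewrite -h mulrA -qpD opprD addrCA subrr addr0.
Qed.

Lemma smooth_shift (w : C) f : smooth f -> smooth (fun z => f (z + w)).
Proof.
move=> sf.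
move=> k; have sk := sf k.
have sh (U : R * R -> R) : Cn k U -> Cn k (fun p => U (p + coords w)).
  elim: k U {sk} => [|k IH] U /=.
    move=> [cU _]; split=> // p.
    apply: (@continuous_comp _ _ _ (fun p : R * R => p + coords w) U); last exact: cU.
    by apply: cvgD; [exact: cvg_id|exact: cvg_cst].
  have dE (e : R * R) p : (fun h : R => h^-1 *: (((fun q => U (q + coords w)) \o shift p) (h *: e) - U (p + coords w)))
     = (fun h : R => h^-1 *: ((U \o shift (p + coords w)) (h *: e) - U (p + coords w))).
    by apply/funext => h /=; rewrite addrA.
  move=> [cU [d1 d2 c1 c2]]; split.
    move=> p; apply: (@continuous_comp _ _ _ (fun p : R * R => p + coords w) U); last exact: cU.
    by apply: cvgD; [exact: cvg_id|exact: cvg_cst].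
  split.
  - by move=> p; rewrite /derivable dE; exact: d1.
  - by move=> p; rewrite /derivable dE; exact: d2.
  - have -> : (fun p => 'D_(1, 0) (fun q => U (q + coords w)) p) =
        (fun p => 'D_(1, 0) U (p + coords w)).
      by apply/funext => p; rewrite /derive dE.
    exact: (IH _ c1).
  - have -> : (fun p => 'D_(0, 1) (fun q => U (q + coords w)) p) =
        (fun p => 'D_(0, 1) U (p + coords w)).
      by apply/funext => p; rewrite /derive dE.
    exact: (IH _ c2).
have [h1 h2] := sk; split.
  by have := sh _ h1; congr Cn; apply/funext => -[x y]; rewrite /reC /coords; case: (w).
by have := sh _ h2; congr Cn; apply/funext => -[x y]; rewrite /imC /coords; case: (w).
Qed.

Lemma qper_fcoef (N : int) f : smooth f -> hper f ->
  (forall n y, fcoef f n (y + t2) = qp (- (N%:~R + 2 * n%:~R)) * fcoef f (n + N) y) ->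
  forall z, f (z + tau) = f z * automorphy tau N 1 z.
Proof.
move=> sf pf H.
have sA : smooth (automorphy tau N 1).
  have [alpha [beta ->]] := automorphy_affine tau N 1; exact: smooth_expC.
have pA : hper (automorphy tau N 1).
  by move=> z; rewrite !automorphyE hper_ee.
suff : (fun z => f (z + tau)) = f * automorphy tau N 1.
  by move=> /funeqP h z; exact: h.
have sft := smooth_shift tau sf.
apply: fcoef_inj => //.
- exact: smoothM.
- by move=> z; rewrite addrAC pf.
- exact: hperM.
move=> n y; rewrite fcoef_tau// H.
transitivity (fcoef (fun z => qp (- N%:~R) * (f z * ee (- N) z)) n y); last first.
  have -> : f * automorphy tau N 1 = fun z => qp (- N%:~R) * (f z * ee (- N) z).
    apply/funext => z; rewrite -[(f * _) z]/(f z * _).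
    by rewrite automorphyE mulr1 expr1n mulr1 mulrCA.
  by [].
rewrite fcoefZ; last by apply: smoothM (@smooth_ee _ _).
by rewrite fcoef_mulee opprK mulrA -qpD opprD addrCA subrr addr0.
Qed.

Lemma H0_smooth (N : int) (s : H0 tau N) : smooth s.
Proof. exact: csec_smooth. Qed.

Lemma H0_fcoef_cst (N : int) (s : H0 tau N) n y y' : fcoef s n y = fcoef s n y'.
Proof.
apply: has_deriv0_cst => v; have := fcoef_deriv n v (H0_smooth s) (csec_hper s).
have -> : dzbar s = fun=> 0 by apply/funext => z; exact: dbar_H0.
by rewrite fcoef0 mulr0.
Qed.

Lemma H0_fcoef_per (N : int) (s : H0 tau N) n (j : int) : N != 0 ->
  fcoef s (n + N * j) 0 * qp (- ((n + N * j)%:~R ^+ 2 / N%:~R)) =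
  fcoef s n 0 * qp (- (n%:~R ^+ 2 / N%:~R)).
Proof.
move=> N0; pose b m := fcoef s m 0 * qp (- (m%:~R ^+ 2 / N%:~R)).
have N0' : N%:~R != 0 :> R by rewrite intr_eq0.
have step m : b (m + N) = b m.
  rewrite /b (H0_fcoef_cst s m 0 (0 + t2)).
  rewrite (fcoef_qper m 0 (H0_smooth s) (csec_hper s) (csec_qper s)).
  rewrite -mulrA [RHS]mulrCA -qpD; congr (_ * qp _); rewrite intrD; field.
  exact: N0'.
rewrite -/(b _) -/(b _); have nat_case (k : nat) m : b (m + N * k%:Z) = b m.
  elim: k m => [|k IH] m; first by rewrite mulr0 addr0.
  by rewrite -addn1 PoszD mulrDr mulr1 addrA step IH.
case: j => k; first exact: nat_case.
by have := nat_case k.+1 (n + N * Negz k); rewrite NegzE mulrN subrK => ->.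
Qed.

(** For N < 0 the factor q^(n^2/(2N)) grows along a residue class, against the bound on the
    coefficients of a smooth function at height 0. *)
Lemma H0_neg (N : int) (s : H0 tau N) : N < 0 -> s = 0 :> (C -> C).
Proof.
move=> N0; have N0' : N != 0 by rewrite lt_eqF.
apply: (fcoef_inj (H0_smooth s) (@smooth_cst R 0) (csec_hper s)) => // n y.
rewrite [RHS]fcoef0 (H0_fcoef_cst s n y 0); apply/eqP; rewrite -cnorm_eq0.
rewrite eq_le cnorm_ge0 andbT leNgt; apply/negP => a0.
have [B [B0 hB]] := fcoef_bound 0 (H0_smooth s).
set b := cnorm (fcoef s n 0 * qp (- (n%:~R ^+ 2 / N%:~R))).
have b0 : 0 < b by rewrite /b cnormM mulr_gt0// cnorm_qp expR_gt0.
pose c : R := pi * t2 / - N%:~R.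
have c0 : 0 < c by rewrite divr_gt0 ?mulr_gt0 ?pi_gt0// oppr_gt0 ltrz0.
have bB (j : nat) : b * (1 + j%:R * c) <= B.
  (* Since N <= -1, this i gives m <= - j whatever n is, hence m^2 >= j. *)
  pose i : int := j%:Z + `|n|; pose m := n + N * i.
  have mj : j%:R <= (m%:~R : R) ^+ 2.
    rewrite -rmorphXn /= -[j%:R]/((j%:Z)%:~R) ler_int.
    have i0 : 0 <= i by rewrite /i; lia.
    have h : N * i <= - i by nia.
    have mj : m <= - j%:Z by rewrite /m; move: h; rewrite /i; lia.
    by rewrite expr2; nia.
  have := hB m 0 0; rewrite normr0 lexx => /(_ isT).
  rewrite cnormM cnorm_ee /= mulr0 expR0 mulr1; apply: le_trans.
  have qE : cnorm (qp (- (m%:~R ^+ 2 / N%:~R))) = expR (- (m%:~R ^+ 2 * c)).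
    by rewrite cnorm_qp; congr expR; rewrite /c; field; rewrite intr_eq0.
  rewrite /b -(H0_fcoef_per s n i N0') -/m cnormM qE -mulrA.
  rewrite -[leRHS]mulr1 ler_wpM2l ?cnorm_ge0//.
  rewrite -[leRHS](expRxMexpNx_1 (m%:~R ^+ 2 * c)) [leRHS]mulrC ler_wpM2l ?expR_ge0//.
  by apply: le_trans (expR_ge1Dx _); rewrite lerD2l ler_wpM2r// ltW.
have [j hj] : exists j : nat, B / b / c < j%:R.
  by exists (Num.bound (B / b / c)); exact: unstable.ltr_bound.
have := bB j; rewrite leNgt => /negP; apply.
move: hj; rewrite !ltr_pdivrMr// => hj; apply: lt_le_trans hj _.
rewrite (_ : b * (1 + j%:R * c) = b + j%:R * c * b); last by ring.
by rewrite lerDr ltW.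
Qed.

Lemma pow_le_expR (K : nat) : exists B : R, 0 <= B /\
  forall x, 0 <= x -> (1 + x) ^+ K <= B * expR x.
Proof.
case: K => [|K].
  exists 1; split=> // x x0; rewrite expr0 mul1r.
  by apply: le_trans (expR_ge1Dx _); rewrite lerDl.
exists (K.+1%:R ^+ K.+1 * expR 1); split=> [|x x0].
  by rewrite mulr_ge0 ?expR_ge0// exprn_ge0.
have k0 : 0 < K.+1%:R :> R by [].
rewrite -mulrA -expRD -ler_pdivrMl ?exprn_gt0// mulrC -expr_div_n.
have -> : 1 + x = (1 + x) / K.+1%:R * K.+1%:R by rewrite divfK// gt_eqF.
rewrite expRM_natr mulfK ?gt_eqF//.
apply: lerXn2r; rewrite ?nnegrE ?expR_ge0// ?divr_ge0 ?addr_ge0//.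
by apply: le_trans (expR_ge1Dx _); rewrite lerDr.
Qed.

Lemma gauss_bound (c b : R) (K : nat) : 0 < c -> exists B : R, 0 <= B /\
  forall x, 0 <= x -> expR (- (c * x ^+ 2) + b * x) * (1 + x) ^+ K <= B.
Proof.
move=> c0; have [B [B0 hB]] := pow_le_expR K.
exists (B * expR ((b + 1) ^+ 2 / (4 * c))); split=> [|x x0].
  by rewrite mulr_ge0 ?expR_ge0.
apply: le_trans (ler_wpM2l (expR_ge0 _) (hB x x0)) _.
rewrite mulrCA -expRD ler_wpM2l// ler_expR.
rewrite -subr_ge0 (_ : _ - _ = (2 * c * x - (b + 1)) ^+ 2 / (4 * c)).
  by rewrite divr_ge0 ?sqr_ge0// mulr_ge0// ltW.
by field; rewrite gt_eqF.
Qed.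

Section Theta.
Variables (N : nat) (N0 : (0 < N)%N).

Definition theta_coef (k : nat) (n : int) : C :=
  if (N%:Z %| n - k%:Z)%Z then qp (n%:~R ^+ 2 / N%:R) else 0.

Lemma theta_coef_bound k n z :
  cnorm (theta_coef k n * ee n z) <=
  expR (- (pi * t2 / N%:R * `|n%:~R| ^+ 2) + 2 * pi * `|complex.Im z| * `|n%:~R|).
Proof.
rewrite /theta_coef; case: ifP => _; last by rewrite mul0r cnorm0 expR_ge0.
rewrite cnormM cnorm_qp cnorm_ee -expRD ler_expR.
have -> : pi * t2 * (n%:~R ^+ 2 / N%:R) = pi * t2 / N%:R * `|n%:~R| ^+ 2.
  by rewrite real_normK ?num_real//; field; rewrite pnatr_eq0 -lt0n.
rewrite lerD2l; apply: le_trans (ler_norm _) _.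
rewrite !normrM normrN normr_nat (ger0_norm (pi_ge0 R)).
by rewrite -[leRHS]mulrA [X in _ <= _ * X]mulrC mulrA.
Qed.

Lemma theta_decay k : decay (fun n (_ : R) => theta_coef k n).
Proof.
move=> K Y; have c0 : 0 < pi * t2 / N%:R by rewrite divr_gt0 ?mulr_gt0 ?pi_gt0 ?ltr0n.
have [B [B0 hB]] := gauss_bound (2 * pi * Y) K c0; exists B; split=> // n z zY.
apply: le_trans (hB `|n%:~R| (normr_ge0 _)); rewrite ler_wpM2r ?wtX_ge0//.
apply: le_trans (theta_coef_bound k n z) _; rewrite ler_expR lerD2l.
by rewrite ler_wpM2r// ler_wpM2l// mulr_ge0 ?pi_ge0.
Qed.

Lemma theta_RD k j : RD j (fun n (_ : R) => theta_coef k n).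
Proof.
have z j' : RD j' (fun (_ : int) (_ : R) => 0 : C).
  have d0 : decay (fun (_ : int) (_ : R) => 0 : C).
    move=> K Y; exists 0; split=> // n w _.
    by rewrite /term mul0r cnorm0 mul0r.
  elim: j' => [|j' IH]; split=> //; exists (fun _ _ => 0); split=> // n y.
  exact: has_deriv_cst.
case: j => [|j]; split=> //; try exact: theta_decay.
by exists (fun _ _ => 0); split=> // n y; exact: has_deriv_cst.
Qed.

Definition theta_ser (k : nat) : C -> C := fser (fun n (_ : R) => theta_coef k n).

Lemma theta_ser_smooth k : smooth (theta_ser k).
Proof. by apply: smooth_fser => j; exact: theta_RD. Qed.

Lemma theta_ser_fcoef k n y : fcoef (theta_ser k) n y = theta_coef k n.
Proof. exact/fcoef_fser/theta_RD. Qed.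

Lemma theta_ser_section k : theta_ser k \in is_section tau N%:Z.
Proof.
apply: section_mk; [exact: theta_ser_smooth|exact: hper_fser|].
apply: qper_fcoef; [exact: theta_ser_smooth|exact: hper_fser|] => n y.
rewrite !theta_ser_fcoef /theta_coef addrAC.
have -> : (N%:Z %| n - k%:Z + N%:Z)%Z = (N%:Z %| n - k%:Z)%Z.
  by rewrite rpredDr ?dvdzz.
case: ifP => _; last by rewrite mulr0.
rewrite -qpD; congr qp; rewrite intrD; field.
by rewrite pnatr_eq0 -lt0n.
Qed.

Lemma theta_ser_hol k : CSec (theta_ser_section k) \in @is_holomorphic R tau N.
Proof.
apply/eqP/val_inj => /=.
apply: (@fcoef_inj _ _ (fun=> 0)).
- exact/smooth_dzbar/theta_ser_smooth.
- exact: smooth_cst.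
- exact/hper_dzbar/hper_fser.
- by [].
move=> n y; rewrite fcoef0.
have := fcoef_deriv n y (theta_ser_smooth k) (@hper_fser _ _).
rewrite (_ : fcoef (theta_ser k) n = fun=> theta_coef k n); last first.
  by apply/funext => v; exact: theta_ser_fcoef.
move=> /has_deriv_unique /(_ (has_deriv_cst _ _)) /eqP.
rewrite mulf_eq0 => /orP[|/eqP//]; rewrite eq_complex /= eqxx /=.
by rewrite oppr_eq0 pnatr_eq0.
Qed.

Lemma theta_funE k : theta_fun tau N k = theta_ser k.
Proof.
apply/funext => z; pose h (j : int) := N%:Z * j + k%:Z.
have hI : injective h.
  move=> i j /addIr /mulfI; apply; by rewrite eqz_nat -lt0n.
have E j : expC (pii R * (tau / N%:R) * ((N%:Z * j + k%:Z)%:~R) ^+ 2 +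
    2 * pii R * (N%:Z * j + k%:Z)%:~R * z) = theta_coef k (h j) * ee (h j) z.
  have hj : h j - k%:Z = N%:Z * j by rewrite /h addrK.
  rewrite -/(h j) /theta_coef hj dvdz_mulr ?dvdzz// /qp /ee -expCD.
  have -> : ((h j)%:~R ^+ 2 / N%:R : R)%:C = (h j)%:~R ^+ 2 / N%:R :> C.
    by rewrite rmorphM rmorphXn fmorphV rmorph_int rmorph_nat.
  apply: congr1; move: ((h j)%:~R) (N%:R) => a b; ring.
rewrite /theta_fun; under eq_fun do rewrite E.
have [M [bM hM]] := decay_dom `|complex.Im z| (theta_decay k).
have [s hs] := has_sum_ex (bsum_comp hI bM) (fun j => hM (h j) z (lexx _)).
rewrite (has_sum_csum hs).
apply: has_sum_unique (fser_has_sum z (theta_decay k)).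
apply: has_sum_inj hI _ hs => n nh; rewrite /term /theta_coef.
case: ifP => [/dvdzP[q nq]|]; last by rewrite mul0r.
by case: nh; exists q; rewrite /h mulrC -nq subrK.
Qed.

(** [theta] falls back to 0 outside the holomorphic sections; [theta_ser_section] and
    [theta_ser_hol] exclude both default cases. *)
Lemma thetaE k : theta tau N k = theta_ser k :> (C -> C).
Proof.
rewrite /theta theta_funE.
have -> : insubd (0 : csec tau N%:Z) (theta_ser k) = CSec (theta_ser_section k).
  by apply: val_inj; rewrite insubdK//; exact: theta_ser_section.
have := insubdK (0 : H0 tau N%:Z) (theta_ser_hol k).
by move=> /(congr1 (@csec_fun R tau N%:Z)).
Qed.

Lemma theta_fcoef k n y : fcoef (theta tau N k) n y = theta_coef k n.
Proof. by rewrite thetaE theta_ser_fcoef. Qed.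

Lemma fcoef_thetaZ (c : C) k n y :
  fcoef (fun z => c * theta tau N k z) n y = c * theta_coef k n.
Proof. by rewrite fcoefZ ?theta_fcoef//; exact: H0_smooth. Qed.

Lemma theta_has_sum k z : has_sum (fun n => theta_coef k n * ee n z) (theta tau N k z).
Proof. by rewrite thetaE; exact: fser_has_sum (theta_decay k). Qed.

Definition cmod (n : int) : 'I_N := Ordinal (ltn_pmod `|(n %% N%:Z)%Z|%N N0).

Lemma cmodP n (k : 'I_N) : (N%:Z %| n - (k : nat)%:Z)%Z = (k == cmod n).
Proof.
have N0' : N%:Z != 0 by rewrite eqz_nat -lt0n.
have n0 := modz_ge0 n N0'; have nN := ltz_mod n N0'.
have E : ((cmod n : nat)%:Z = (n %% N%:Z)%Z).
  by rewrite /cmod /= modn_small; [rewrite gez0_abs|lia].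
rewrite -eqz_mod_dvd -val_eqE -eqz_nat E eq_sym; congr (_ == _).
by rewrite modz_small// ltz_nat ltn_ord.
Qed.

Lemma H0_decomp (s : H0 tau N) z :
  s z = \sum_(l < N) (fcoef s (l : nat)%:Z 0 * qp (- ((l : nat)%:R ^+ 2 / N%:R))) * theta tau N l z.
Proof.
pose b (l : 'I_N) := fcoef s (l : nat)%:Z 0 * qp (- ((l : nat)%:R ^+ 2 / N%:R)).
suff : (s : C -> C) = fun z => \sum_(l < N) b l * theta tau N l z.
  by move=> /funeqP /(_ z).
have sF (l : 'I_N) : smooth (fun z => b l * theta tau N l z).
  by apply: (smoothM (smooth_cst (b l))); exact: H0_smooth.
apply: fcoef_inj.
- exact: H0_smooth.
- exact: smooth_sum.
- exact: csec_hper.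
- by move=> w; apply: eq_bigr => l _; rewrite csec_hper.
move=> n y; rewrite fcoef_sum//.
under eq_bigr do rewrite fcoef_thetaZ.
rewrite (bigD1 (cmod n))//= big1 ?addr0; last first.
  by move=> l ln; rewrite /theta_coef cmodP (negPf ln) mulr0.
have := cmodP n (cmod n); rewrite eqxx => nl.
rewrite /theta_coef nl; move: nl => /dvdzP[j nj].
have {nj} nj : n = (cmod n : nat)%:Z + N%:Z * j by rewrite mulrC -nj addrC subrK.
rewrite /b (H0_fcoef_cst s n y 0).
have N0' : N%:Z != 0 by rewrite eqz_nat -lt0n.
have := H0_fcoef_per s (cmod n : nat)%:Z j N0'; rewrite -nj => <-.
by rewrite -mulrA -qpD addNr qp0 mulr1.
Qed.

(** Among the F_{N,i} only F_{N,l} has frequency l, with coefficient q^(l^2/(2N)), so coordinates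
    are read off Fourier coefficients; this also gives the uniqueness that [xget] asks for. *)
Lemma coefE (s : H0 tau N) (l : 'I_N) :
  coef tau s l = fcoef s (l : nat)%:Z 0 * qp (- ((l : nat)%:R ^+ 2 / N%:R)).
Proof.
rewrite /coef (_ : xget _ _ = [ffun l : 'I_N => fcoef s (l : nat)%:Z 0 * qp (- ((l : nat)%:R ^+ 2 / N%:R))]).
  by rewrite ffunE.
apply: xget_unique => /= [z|u hu].
  by rewrite H0_decomp; apply: eq_bigr => i _; rewrite ffunE.
apply/ffunP => i; rewrite ffunE.
have sF (j : 'I_N) : smooth (fun z => u j * theta tau N j z).
  by apply: (smoothM (smooth_cst (u j))); exact: H0_smooth.
have -> : (s : C -> C) = fun z => \sum_(j < N) u j * theta tau N j z.
  by apply/funext => z; exact: hu.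
rewrite fcoef_sum//.
under eq_bigr do rewrite fcoef_thetaZ.
rewrite (bigD1 i)//= big1 ?addr0; last first.
  move=> j ji; rewrite /theta_coef cmodP.
  have := cmodP (i : nat)%:Z i; rewrite subrr dvdz0 => /esym/eqP <-.
  by rewrite (negPf ji) mulr0.
rewrite /theta_coef subrr dvdz0 -[(i : nat)%:~R]/((i : nat)%:R) -mulrA -qpD subrr.
by rewrite qp0 mulr1.
Qed.

End Theta.

End Sections.

(** * The d-bar equation in negative degree *)

Section LimitsAtInfinity.
Variable R : realType.
Local Notation C := R[i].
Implicit Types (f g : R -> C) (x y a b c : R).

Definition lim_Ny f (l : C) : Prop :=
  forall e : R, 0 < e -> exists A : R, forall v, v <= A -> cnorm (f v - l) < e.

Definition lim_y f (l : C) : Prop :=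
  forall e : R, 0 < e -> exists A : R, forall v, A <= v -> cnorm (f v - l) < e.

Lemma lim_NyN f l : lim_Ny (fun v => f (- v)) l <-> lim_y f l.
Proof.
split=> H e e0; have [A hA] := H e e0; exists (- A) => v vA.
  by rewrite -(opprK v); apply: hA; rewrite lerNl.
by apply: hA; rewrite lerNr.
Qed.

Lemma lim_Ny_cst (k l : C) : lim_Ny (fun=> k) l -> k = l.
Proof.
move=> H; apply/eqP; rewrite -subr_eq0 -cnorm_eq0 eq_le cnorm_ge0 andbT.
apply/ler_addgt0Pl => e e0; rewrite addr0.
by have [A /(_ A (lexx _)) /ltW] := H e e0.
Qed.

Lemma lim_NyB f g k l : lim_Ny f k -> lim_Ny g l -> lim_Ny (fun v => f v - g v) (k - l).
Proof.
move=> fk gl e e0; have e2 : 0 < e / 2 by rewrite divr_gt0.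
have [A hA] := fk _ e2; have [B hB] := gl _ e2.
exists (Num.min A B) => v; rewrite le_min => /andP[vA vB].
rewrite (_ : _ - _ - _ = (f v - k) - (g v - l)); last by ring.
apply: le_lt_trans (cnormB _ _) _; rewrite [ltRHS]splitr.
by apply: ltrD; [exact: hA|exact: hB].
Qed.

Lemma lim_NyZ (k : C) f l : lim_Ny f l -> lim_Ny (fun v => k * f v) (k * l).
Proof.
move=> fl e e0; have k0 : 0 < 1 + cnorm k by rewrite ltr_wpDr// cnorm_ge0.
have [A hA] := fl _ (divr_gt0 e0 k0); exists A => v vA.
rewrite -mulrBr cnormM; have := hA v vA; rewrite ltr_pdivlMr// => h.
by apply: le_lt_trans h; rewrite mulrC ler_wpM2l ?cnorm_ge0// lerDr.
Qed.

Lemma lim_Ny_shift f l s : lim_Ny f l -> lim_Ny (fun v => f (v + s)) l.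
Proof.
move=> fl e e0; have [A hA] := fl e e0; exists (A - s) => v vA.
by apply: hA; rewrite -lerBrDr.
Qed.

Lemma has_deriv_lim_eq f g f' : (forall v, has_deriv f v (f' v)) ->
  (forall v, has_deriv g v (f' v)) -> lim_Ny f 0 -> lim_Ny g 0 -> f =1 g.
Proof.
move=> ff' gf' f0 g0 v; apply/eqP; rewrite -subr_eq0; apply/eqP.
have d0 w : has_deriv (fun v => f v - g v) w 0.
  by rewrite -(subrr (f' w)); exact: has_derivB.
have := lim_NyB f0 g0; rewrite subr0.
have -> : (fun v => f v - g v) = fun=> f v - g v.
  by apply/funext => w; exact: (has_deriv0_cst d0).
exact: lim_Ny_cst.
Qed.

Lemma has_deriv_dom f f' (h h' : R -> R) a b : a <= b ->
  (forall x, has_deriv f x (f' x)) -> (forall x, is_derive x 1 h (h' x)) ->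
  (forall x, a <= x <= b -> cnorm (f' x) <= h' x) ->
  cnorm (f b - f a) <= 2 * (h b - h a).
Proof.
move=> ab ff' hh' fh.
have real_case (g g' : R -> R) : (forall x, is_derive x 1 g (g' x)) ->
    (forall x, a <= x <= b -> `|g' x| <= h' x) -> `|g b - g a| <= h b - h a.
  move=> gg' gh.
  have mon (u u' : R -> R) : (forall x, is_derive x 1 u (u' x)) ->
      (forall x, a <= x <= b -> 0 <= u' x) -> u a <= u b.
    move=> uu' u0; have [c cab E] := @MVT_segment R u u' a b ab (fun x _ => uu' x)
      (continuous_subspaceT (is_derive_continuous uu')).
    rewrite -subr_ge0 E mulr_ge0 ?subr_ge0//; apply: u0.
    by move: cab; rewrite in_itv.
  have h1 := mon _ _ (fun x => is_deriveB (hh' x) (gg' x)).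
  have h2 := mon _ _ (fun x => is_deriveD (hh' x) (gg' x)).
  have {}h1 : h a - g a <= h b - g b.
    by apply: h1 => x /gh; rewrite ler_norml subr_ge0 => /andP[].
  have {}h2 : h a + g a <= h b + g b.
    by apply: h2 => x /gh; rewrite ler_norml => /andP[]; lra.
  by rewrite ler_norml; apply/andP; split; lra.
apply: le_trans (cnorm_le _) _; rewrite ReD ImD ReN ImN.
have h1 := real_case _ _ (fun x => (ff' x).1) (fun x xab => le_trans (Re_le_cnorm _) (fh x xab)).
have h2 := real_case _ _ (fun x => (ff' x).2) (fun x xab => le_trans (Im_le_cnorm _) (fh x xab)).
by apply: le_trans (lerD h1 h2) _; rewrite mulr_natl mulr2n.
Qed.

Lemma is_derive_expc (K c x : R) : c != 0 ->
  is_derive x 1 (fun x => K / c * expR (c * x)) (K * expR (c * x)).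
Proof.
move=> c0.
have lin : is_derive x 1 (fun x : R => c * x) c.
  by apply: is_derive_eq (is_deriveZ c (is_derive_id x 1)) _; rewrite [_ *: _]mulr1.
have := @is_derive1_comp R expR (fun x => c * x) x _ _ (is_derive_expR _) lin.
move=> /(is_deriveZ (K / c)) h; apply: is_derive_eq h _.
by rewrite /GRing.scale /=; field.
Qed.

Lemma exp_dom f f' K c a b : 0 < c -> a <= b ->
  (forall x, has_deriv f x (f' x)) ->
  (forall x, a <= x <= b -> cnorm (f' x) <= K * expR (c * x)) ->
  cnorm (f b - f a) <= 2 * (K / c) * (expR (c * b) - expR (c * a)).
Proof.
move=> c0 ab ff' fK; rewrite -mulrA mulrBr.
apply: (has_deriv_dom ab ff' (h := fun x => K / c * expR (c * x)) (h' := fun x => K * expR (c * x))) => //.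
by move=> x; apply: is_derive_expc; rewrite gt_eqF.
Qed.

Lemma exp_tail f f' K c y : 0 < c -> (forall x, has_deriv f x (f' x)) ->
  (forall x, x <= y -> cnorm (f' x) <= K * expR (c * x)) -> lim_Ny f 0 ->
  cnorm (f y) <= 2 * (K / c) * expR (c * y).
Proof.
move=> c0 ff' fK f0; apply/ler_addgt0Pl => e e0; have [A hA] := f0 e e0.
pose a := Num.min A y; have ay : a <= y by rewrite ge_min lexx orbT.
have := hA a; rewrite ge_min lexx subr0 => /(_ isT) fa.
have K0 : 0 <= K by have := le_trans (cnorm_ge0 _) (fK y (lexx _)); rewrite pmulr_lge0 ?expR_gt0.
have := exp_dom c0 ay ff' (fun x xay => fK x (proj2 (andP xay))).
rewrite (_ : f y = (f y - f a) + f a); last by rewrite subrK.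
rewrite [X in cnorm (X - _)]subrK => h; rewrite [leRHS]addrC; apply: le_trans (cnormD _ _) _.
apply: lerD; last exact: ltW.
apply: le_trans h _; rewrite ler_wpM2l ?mulr_ge0 ?invr_ge0 ?(ltW c0)//.
by rewrite gerBl expR_ge0.
Qed.

Lemma exp_small (e K : R) : 0 < e -> exists A : R, A <= 0 /\ forall v, v <= A -> K * expR v < e.
Proof.
move=> e0; pose K' := `|K| + 1; have K0 : 0 < K' by rewrite ltr_wpDl.
exists (- (K' / e)); split=> [|v vA]; first by rewrite oppr_le0 divr_ge0 ?ltW.
apply: le_lt_trans (_ : K' * expR v < e).
  by rewrite ler_wpM2r ?expR_ge0// (le_trans (ler_norm K))// lerDl.
have h : K' / e < expR (- v).
  by apply: lt_le_trans (expR_ge1Dx _); rewrite lerNr in vA; rewrite ltr_pwDl.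
move: h; rewrite expRN ltr_pdivrMr// => h.
rewrite -(ltr_pM2l (_ : 0 < (expR v)^-1)) ?invr_gt0 ?expR_gt0//.
by rewrite mulrCA mulVf ?mulr1// gt_eqF// expR_gt0.
Qed.

Lemma exp_lim_ex f f' K : (forall x, has_deriv f x (f' x)) ->
  (forall x, x <= 0 -> cnorm (f' x) <= K * expR x) -> exists l, lim_Ny f l.
Proof.
move=> ff' fK.
have K0 : 0 <= K by have := le_trans (cnorm_ge0 _) (fK 0 (lexx _)); rewrite pmulr_lge0 ?expR_gt0.
have dom a b : a <= b -> b <= 0 -> cnorm (f b - f a) <= 2 * K * (expR b - expR a).
  move=> ab b0; have := @exp_dom f f' K 1 a b ltr01 ab ff'; rewrite divr1 !mul1r; apply.
  by move=> x /andP[_ xb]; rewrite mul1r; apply: fK; exact: le_trans b0.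
have real_case (g : R -> R) : (forall a b, a <= b -> b <= 0 ->
      `|g b - g a| <= 2 * K * (expR b - expR a)) ->
    exists l, forall e, 0 < e -> exists A, forall v, v <= A -> `|g v - l| < e.
  (* Adding 2 K exp v makes g nondecreasing on v <= 0, so the limit at -oo is an infimum. *)
  move=> gd; pose u v := g v + 2 * K * expR v.
  have mon a b : a <= b -> b <= 0 -> u a <= u b.
    by move=> ab b0; have := gd a b ab b0; rewrite /u ler_norml => /andP[]; lra.
  pose S : set R := [set r | exists v, v <= 0 /\ r = u v].
  have lbS : lbound S (g 0 - 2 * K).
    move=> _ [v [v0 ->]]; have := gd v 0 v0 (lexx _).
    rewrite expR0 ler_norml => /andP[h _]; rewrite /u.
    have : 0 <= 2 * K * expR v by rewrite !mulr_ge0 ?expR_ge0.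
    have : 2 * K * (1 - expR v) <= 2 * K by rewrite mulrBr mulr1 gerBl !mulr_ge0 ?expR_ge0.
    move: h; rewrite mulrBr; have := gd v 0 v0 (lexx _).
    by rewrite expR0 ler_norml => /andP[_]; lra.
  have hS : has_inf S by split; [exists (u 0), 0|exists (g 0 - 2 * K)].
  exists (inf S) => e e0; have e2 : 0 < e / 2 by rewrite divr_gt0.
  have [_ [v0 [v00 ->]] hv0] := inf_adherent e2 hS.
  have [A [A0 hA]] := exp_small (2 * K) e2.
  exists (Num.min A v0) => v; rewrite le_min => /andP[vA vv0].
  have h1 : inf S <= u v.
    by apply: ge_inf; [exact: hS.2|exists v; split=> //; exact: le_trans v00].
  have h2 := mon v v0 vv0 v00; have h3 := hA v vA.
  have h4 : 0 <= 2 * K * expR v by rewrite !mulr_ge0 ?expR_ge0.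
  by move: h1 h2; rewrite /u ltr_norml => h1 h2; apply/andP; split; rewrite /u in hv0; lra.
have [l1 h1] : exists l, forall e, 0 < e -> exists A, forall v, v <= A -> `|complex.Re (f v) - l| < e.
  apply: real_case => a b ab b0; rewrite -ReN -ReD.
  exact: le_trans (Re_le_cnorm _) (dom a b ab b0).
have [l2 h2] : exists l, forall e, 0 < e -> exists A, forall v, v <= A -> `|complex.Im (f v) - l| < e.
  apply: real_case => a b ab b0; rewrite -ImN -ImD.
  exact: le_trans (Im_le_cnorm _) (dom a b ab b0).
exists (l1 +i* l2) => e e0; have e2 : 0 < e / 2 by rewrite divr_gt0.
have [A hA] := h1 _ e2; have [B hB] := h2 _ e2.
exists (Num.min A B) => v; rewrite le_min => /andP[vA vB].
apply: le_lt_trans (cnorm_le _) _; rewrite ReD ImD ReN ImN /= [ltRHS]splitr.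
by apply: ltrD; [exact: hA|exact: hB].
Qed.

End LimitsAtInfinity.

(** * Primitives of the coefficients and the exactness criterion *)

Section NegativeDegree.
Variables (R : realType) (tau : R[i]).
Local Notation C := R[i].
Local Notation t2 := (complex.Im tau).
Hypothesis tau_gt0 : 0 < t2.
Variable N : int.
Hypothesis N_lt0 : N < 0.
Implicit Types (z : C) (x y v : R) (n m : int).

(** Translation by the lattice moves z into the compact rectangle [0, 1] x [0, Im tau]; the
    automorphy factor collected on the way is a Gaussian in Im z, decaying because N < 0. *)
Lemma csec_growth (a : csec tau N) : exists S, 0 <= S /\
  forall z, cnorm (a z) <= S * expR (pi * N%:~R / t2 * complex.Im z ^+ 2).
Proof.
have [c1 c2] := smooth_continuous (csec_smooth a).
have [K1 [K10 h1]] := bounded_rectangle 0 1 0 t2 c1.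
have [K2 [K20 h2]] := bounded_rectangle 0 1 0 t2 c2.
pose c := pi * N%:~R / t2; have c0 : c < 0.
  by rewrite /c -mulrA pmulr_rlt0 ?pi_gt0// pmulr_llt0 ?invr_gt0// ltrz0.
exists ((K1 + K2) * expR (- c * t2 ^+ 2)); split=> [|z].
  by rewrite mulr_ge0 ?expR_ge0// addr_ge0.
pose m := Num.floor (complex.Im z / t2); pose w := z - m%:~R * tau.
have Imw : complex.Im w = complex.Im z - m%:~R * t2.
  by rewrite /w ImD ImN ImM Re_int Im_int mul0r addr0.
have w1 : 0 <= complex.Im w.
  by rewrite Imw subr_ge0 -ler_pdivlMr//; exact: floor_le.
have w2 : complex.Im w <= t2.
  rewrite Imw lerBlDl -[X in _ <= _ + X]mul1r -mulrDl -ler_pdivrMr//.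
  by apply/ltW; have := floorD1_gt (complex.Im z / t2); rewrite intrD.
pose k := Num.floor (complex.Re w); pose w0 := w - k%:~R.
have Imw0 : complex.Im w0 = complex.Im w by rewrite /w0 ImD ImN Im_int subr0.
have Rw0 : 0 <= complex.Re w0 <= 1.
  rewrite /w0 ReD ReN Re_int subr_ge0 floor_le /= lerBlDl.
  by apply/ltW; have := floorD1_gt (complex.Re w); rewrite intrD.
have zw : z = w0 + m%:~R * tau + k%:~R by rewrite /w0 /w; ring.
have aw0 : cnorm (a w0) <= K1 + K2.
  apply: le_trans (cnorm_le _) _; apply: lerD.
    have := h1 _ _ Rw0 (_ : 0 <= complex.Im w0 <= t2); rewrite Imw0 w1 w2 => /(_ isT).
    by rewrite /reC /= -Imw0; case: (w0).
  have := h2 _ _ Rw0 (_ : 0 <= complex.Im w0 <= t2); rewrite Imw0 w1 w2 => /(_ isT).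
  by rewrite /imC /= -Imw0; case: (w0).
have [_ qa] := csecP a; rewrite {1}zw qa cnormM -[leRHS]mulrA; apply: ler_pM.
- exact: cnorm_ge0.
- exact: cnorm_ge0.
- exact: aw0.
rewrite automorphyE cnormM cnorm_qp cnorm_ee -!expRD ler_expR Imw0.
have -> : complex.Im z = complex.Im w + m%:~R * t2 by rewrite Imw subrK.
rewrite mulrNz intrM; move: (complex.Im w) w1 w2 => y0 w1 w2.
rewrite -subr_ge0 -/c (_ : _ - _ = - c * (t2 ^+ 2 - y0 ^+ 2)); last first.
  by rewrite /c; field; rewrite gt_eqF.
rewrite mulr_ge0//; first by rewrite oppr_ge0 ltW.
by rewrite subr_ge0 lerXn2r// nnegrE ltW.
Qed.

Lemma fcoef_growth (a : csec tau N) : exists S, 0 <= S /\ forall n v,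
  cnorm (fcoef a n v) <= S * expR (pi * N%:~R / t2 * v ^+ 2 + 2 * pi * n%:~R * v).
Proof.
have [S [S0 hS]] := csec_growth a; exists (2 * S); split=> [|n v]; first exact: mulr_ge0.
rewrite /fcoef -mulrA expRD; apply: cint01_norm => [|x _].
  by apply: (@ccont_hslice _ ((a : C -> C) * ee (- n))); apply: smoothM (@smooth_ee _ _); exact: csec_smooth.
rewrite cnormM cnorm_ee mulrA; apply: ler_pM; rewrite ?cnorm_ge0 ?expR_ge0//.
by rewrite ler_expR /= mulrNz; lra.
Qed.

Let c := pi * N%:~R / t2.
Let c_lt0 : c < 0.
Proof. by rewrite /c -mulrA pmulr_rlt0 ?pi_gt0// pmulr_llt0 ?invr_gt0// ltrz0. Qed.

Lemma fcoef_growth_exp (a : csec tau N) n (b : R) : exists S, 0 <= S /\ forall v,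
  cnorm (fcoef a n v) <= S * expR (b * v).
Proof.
have [S [S0 hS]] := fcoef_growth a; pose d := 2 * pi * n%:~R - b.
exists (S * expR (- (d ^+ 2 / (4 * c)))); split=> [|v]; first by rewrite mulr_ge0 ?expR_ge0.
apply: le_trans (hS n v) _; rewrite -[leRHS]mulrA ler_wpM2l// -expRD ler_expR -/c.
rewrite -subr_ge0 (_ : _ - _ = (2 * c * v + d) ^+ 2 / (- (4 * c))).
  by rewrite divr_ge0 ?sqr_ge0// oppr_ge0 mulr_ge0_le0// ltW.
by rewrite /d; field; rewrite lt_eqF.
Qed.

(** The decay at both ends makes the limits exist. L is the obstruction to exactness carried by the
    n-th coefficient; [serre_cls] identifies it with a Serre pairing. *)
Lemma fcoef_primitive (a : csec tau N) n : exists P L,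
  [/\ forall v, has_deriv P v ((0 +i* - 2) * fcoef a n v), lim_Ny P 0 & lim_y P L].
Proof.
have sa := csec_smooth a; have pa := @csec_hper _ _ _ a.
have cf : ccont (fun v => (0 +i* - 2) * fcoef a n v).
  apply: ccontZ; exact: has_deriv_ccont (fun v => fcoef_deriv n v sa pa).
have [G dG] := cprimitive_ex cf.
have [S [S0 hS]] := fcoef_growth_exp a n 1.
have [T [T0 hT]] := fcoef_growth_exp a n (- 1).
have n2 : cnorm (0 +i* - 2 : C) = 2 by rewrite cnorm_im normrN ger0_norm.
have [l1 h1] : exists l, lim_Ny G l.
  apply: (exp_lim_ex (K := 2 * S) dG) => x _; rewrite cnormM n2 -mulrA ler_wpM2l//.
  by have := hS x; rewrite mul1r.
have [l2 h2] : exists l, lim_Ny (fun v => G (- v)) l.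
  apply: (exp_lim_ex (K := 2 * T) (fun x => has_deriv_opp (dG (- x)))) => x _.
  rewrite cnormN cnormM n2 -mulrA ler_wpM2l//.
  by have := hT (- x); rewrite mulrNN mul1r.
exists (fun v => G v - l1), (l2 - l1); split.
- by move=> v; rewrite -[X in has_deriv _ _ X]subr0; apply: has_derivB => //; exact: has_deriv_cst.
- by move=> e e0; have [A hA] := h1 e e0; exists A => v vA; rewrite subr0; exact: hA.
- apply/lim_NyN => e e0; have [A hA] := h2 e e0; exists A => v vA.
  by rewrite opprB addrA subrK; exact: hA.
Qed.

(** The part of f accumulated up to y - 1 is controlled by the global bound and gains a factor exp
    (- b); only on the last unit interval is the finer local bound L used. In the application b = 2
    pi |n|, so the gain beats every power of n. *)
Lemma one_side_decay (f f' : R -> C) (b S L y : R) : 1 <= b ->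
  (forall v, has_deriv f v (f' v)) -> (forall v, cnorm (f' v) <= S * expR (b * v)) ->
  lim_Ny f 0 -> (forall v, y - 1 <= v <= y -> cnorm (f' v) <= L * expR (b * v)) ->
  cnorm (f y) * expR (- (b * y)) <= 2 * S * expR (- b) + 2 * L.
Proof.
move=> b1 ff' fS f0 fL; have b0 : 0 < b by lra.
have E0 : 0 < expR (b * y) by exact: expR_gt0.
have S0 : 0 <= S by have := le_trans (cnorm_ge0 _) (fS 0); rewrite mulr0 expR0 mulr1.
have L0 : 0 <= L.
  have yy : y - 1 <= y <= y by rewrite lexx gerBl ler01.
  by have := le_trans (cnorm_ge0 _) (fL y yy); rewrite pmulr_lge0.
have h1 := exp_tail b0 ff' (fun v _ => fS v) f0 (y := y - 1).
have yy : y - 1 <= y by rewrite gerBl.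
have h2 := exp_dom b0 yy ff' fL.
have bV (K : R) : 0 <= K -> 2 * (K / b) <= 2 * K.
  by move=> K0; rewrite ler_wpM2l// ler_pdivrMr// ler_peMr.
rewrite expRN ler_pdivrMr//.
rewrite (_ : f y = (f y - f (y - 1)) + f (y - 1)); last by rewrite subrK.
apply: le_trans (cnormD _ _) _; rewrite addrC mulrDl; apply: lerD.
  apply: le_trans h1 _; rewrite mulrBr mulr1 expRD [expR (b * y) * _]mulrC.
  by rewrite -[leRHS]mulrA ler_wpM2r ?mulr_ge0 ?expR_ge0// bV.
apply: le_trans h2 _.
apply: ler_pM; rewrite ?bV ?mulr_ge0 ?divr_ge0 ?(ltW b0)//.
- by rewrite invr_ge0 ltW.
- by rewrite subr_ge0 ler_expR ler_wpM2l ?(ltW b0).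
- by rewrite gerBl expR_ge0.
Qed.

Lemma primitive_decay (a : csec tau N) (P : int -> R -> C) :
  (forall n v, has_deriv (P n) v ((0 +i* - 2) * fcoef a n v)) ->
  (forall n, lim_Ny (P n) 0) -> (forall n, lim_y (P n) 0) -> decay P.
Proof.
move=> dP PNy Py K Y.
have da := fcoef_decay (csec_smooth a) (@csec_hper _ _ _ a).
have [B [B0 hB]] := da K (Y + 1).
have [S [S0 hS]] := fcoef_growth a.
have [D [D0 hD]] := pow_le_expR R K.
have n2 : cnorm (0 +i* - 2 : C) = 2 by rewrite cnorm_im normrN ger0_norm.
have glob n v : cnorm ((0 +i* - 2) * fcoef a n v) <= 2 * S * expR (2 * pi * n%:~R * v).
  rewrite cnormM n2 -mulrA ler_wpM2l//; apply: le_trans (hS n v) _.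
  rewrite ler_wpM2l// ler_expR -lerBrDr subrr -/c.
  by rewrite mulr_le0_ge0 ?sqr_ge0// ltW.
have loc n v : `|v| <= Y + 1 -> cnorm ((0 +i* - 2) * fcoef a n v) <=
    2 * (B / wt R n ^+ K) * expR (2 * pi * n%:~R * v).
  move=> vY; have := hB n (0 +i* v) vY.
  rewrite -ler_pdivlMr ?exprn_gt0 ?wt_gt0// /term cnormM cnorm_ee -[complex.Im _]/v.
  rewrite !mulNr expRN ler_pdivrMr ?expR_gt0// cnormM n2 => h.
  by rewrite -[leRHS]mulrA ler_wpM2l.
have pi1 : 1 <= 2 * pi :> R by have := pi_ge2 R; lra.
have fin (n : int) (b : R) : n != 0 -> b = 2 * pi * `|n%:~R| ->
    (2 * (2 * S) * expR (- b) + 2 * (2 * (B / wt R n ^+ K))) * wt R n ^+ K <= 4 * S * D + 4 * B.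
  move=> n0 bE; rewrite mulrDl; apply: lerD.
    rewrite mulrA -[2 * 2]natrM -mulrA ler_wpM2l ?mulr_ge0//.
    apply: le_trans (_ : expR (- `|n%:~R|) * wt R n ^+ K <= _).
      rewrite ler_wpM2r ?wtX_ge0// ler_expR lerN2 bE.
      by rewrite ler_peMl.
    by rewrite expRN mulrC ler_pdivrMr ?expR_gt0// hD.
  by rewrite mulrA -[2 * 2]natrM -mulrA divfK// gt_eqF// exprn_gt0// wt_gt0.
(* Frequency 0 has no exponential gain, but a single coefficient only has to be bounded on the
   strip. *)
have [D0' hD0] : exists D', forall y, `|y| <= Y -> cnorm (P 0 y) <= D'.
  exists (cnorm (P 0 0) + 2 * (2 * S) * Y) => y yY.
  have bd x : cnorm ((0 +i* - 2) * fcoef a 0 x) <= 2 * S.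
    by have := glob 0 x; rewrite mulr0 mul0r expR0 mulr1.
  have : cnorm (P 0 y - P 0 0) <= 2 * (2 * S) * `|y|.
    have [y0|y0] := leP 0 y.
      by have := has_deriv_lip y0 (dP 0) (fun x _ => bd x); rewrite subr0 ger0_norm.
    have := has_deriv_lip (ltW y0) (dP 0) (fun x _ => bd x).
    by rewrite -cnormN opprB sub0r ltr0_norm.
  move=> h; rewrite -[P 0 y](subrK (P 0 0)) addrC; apply: le_trans (cnormD _ _) _.
  by rewrite lerD2l; apply: le_trans h _; rewrite ler_wpM2l// !mulr_ge0.
exists (`|D0'| + (4 * S * D + 4 * B)); split=> [|n [x y] yY].
  by rewrite addr_ge0// addr_ge0// !mulr_ge0.
have [n0|n0] := eqVneq n 0.
  rewrite n0 /term ee0 mulr1 /wt normr0 addr0 expr1n mulr1.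
  apply: le_trans (hD0 y yY) _; apply: le_trans (ler_norm _) _.
  by rewrite lerDl addr_ge0// !mulr_ge0.
apply: le_trans (_ : 4 * S * D + 4 * B <= _); last by rewrite lerDr.
apply: le_trans (fin n _ n0 erefl); rewrite ler_wpM2r ?wtX_ge0//.
rewrite /term cnormM cnorm_ee -[complex.Im _]/y.
have b1 : 1 <= 2 * pi * `|n%:~R| :> R.
  have h1 : 1 <= `|n%:~R| :> R by rewrite -intr_norm -[1]/(1%:~R) ler_int; lia.
  by apply: le_trans pi1 _; rewrite ler_peMr// mulr_ge0 ?pi_ge0.
have [n1|n1] := ltP 0 n.
  have nE : `|n%:~R| = n%:~R :> R by rewrite ger0_norm// ler0z ltW.
  rewrite nE in b1 *.
  have := @one_side_decay (P n) _ _ _ (2 * (B / wt R n ^+ K)) y b1 (dP n) (glob n) (PNy n).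
  rewrite !mulNr; apply=> v /andP[v1 v2]; apply: loc.
  by move: yY; rewrite /= !ler_norml => /andP[h1 h2]; apply/andP; split; lra.
have nE : `|n%:~R| = - n%:~R :> R by rewrite ler0_norm// lerz0.
rewrite nE in b1 *.
have := @one_side_decay (fun v => P n (- v)) _ _ (2 * S) (2 * (B / wt R n ^+ K)) (- y) b1
  (fun v => has_deriv_opp (dP n (- v))).
rewrite opprK => h.
have -> : -2 * pi * n%:~R * y = - (2 * pi * - n%:~R * - y) by ring.
apply: h => [v||v /andP[v1 v2]].
- by rewrite cnormN; apply: le_trans (glob n (- v)) _; rewrite !mulrN !mulNr.
- exact/lim_NyN.
rewrite cnormN; apply: le_trans (loc n (- v) _) _; last by rewrite !mulrN !mulNr.
by move: yY; rewrite /= normrN !ler_norml => /andP[h1 h2]; apply/andP; split; lra.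
Qed.

(* Vanishing at both ends allows P n to be estimated from either end, according to
   the sign of n, so that the P n are the coefficients of a smooth function. *)
Lemma dbar_solve (a : csec tau N) (P : int -> R -> C) :
  (forall n v, has_deriv (P n) v ((0 +i* - 2) * fcoef a n v)) ->
  (forall n, lim_Ny (P n) 0) -> (forall n, lim_y (P n) 0) ->
  exists t : csec tau N, dbar t = a /\ forall n v, fcoef t n v = P n v.
Proof.
move=> dP PNy Py; have sa := csec_smooth a; have pa := @csec_hper _ _ _ a.
have dcP := primitive_decay dP PNy Py.
have RP k : RD k P.
  case: k => [|k]; split=> //; exists (fun n v => (0 +i* - 2) * fcoef a n v).
  by split=> //; apply: RDZ1; exact: fcoef_RD.
pose t := fser P; have st : smooth t by exact: smooth_fser.
have pt : hper t by exact: hper_fser.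
have tE n v : fcoef t n v = P n v by exact: fcoef_fser.
have qt : forall z, t (z + tau) = t z * automorphy tau N 1 z.
  apply: qper_fcoef => // n y; rewrite !tE; move: y.
  (* The two sides are primitives of the same function, by the quasi-periodicity of a, and both
     vanish at -oo. *)
  apply: (has_deriv_lim_eq (f' := fun y => (0 +i* - 2) * fcoef a n (y + t2))).
  - by move=> v; apply: has_deriv_shift.
  - move=> v; rewrite (fcoef_qper n v sa pa (@csec_qper _ _ _ a)) mulrCA.
    exact: has_derivZ.
  - exact: lim_Ny_shift.
  - by have := lim_NyZ (qp tau (- (N%:~R + 2 * n%:~R))) (PNy (n + N)); rewrite mulr0.
exists (CSec (section_mk st pt qt)); split=> //; apply/val_inj => /=.
apply: (fcoef_inj (smooth_dzbar st) sa (hper_dzbar pt) pa) => n v.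
have k0 : (0 +i* - 2 : C) != 0 by rewrite eq_complex /= eqxx oppr_eq0 pnatr_eq0.
apply: (mulfI k0); apply: has_deriv_unique (dP n v).
by have := fcoef_deriv n v st pt; rewrite (_ : fcoef t n = P n)//; apply/funext => w.
Qed.

End NegativeDegree.

(** * Products with theta functions and integrals over the torus *)

Section Convolution.
Variables (R : realType) (tau : R[i]).
Local Notation C := R[i].
Local Notation t2 := (complex.Im tau).
Hypothesis tau_gt0 : 0 < t2.
Implicit Types (f g : C -> C) (z : C) (x y v : R) (n m : int).

Lemma ccont_mulee f m y : smooth f -> ccont (fun x => f (x +i* y) * ee m (x +i* y)).
Proof.
move=> sf; apply: (@ccont_hslice _ (f * ee m)); exact: smoothM sf (@smooth_ee _ _).
Qed.

Lemma fcoef_mul_theta (N : nat) (N0 : (0 < N)%N) k f p v : smooth f ->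
  has_sum (fun m => theta_coef tau N k m * fcoef f (p - m) v)
    (fcoef (fun z => f z * theta tau N k z) p v).
Proof.
move=> sf; have [c1 c2] := ccont_hslice v sf.
have [K hK] : exists K, forall t, 0 <= t <= 1 -> cnorm (f (t +i* v)) <= K.
  have [d1 d2] := smooth_continuous sf.
  have [K1 [_ h1]] := bounded_rectangle 0 1 v v d1.
  have [K2 [_ h2]] := bounded_rectangle 0 1 v v d2.
  exists (K1 + K2) => t t01; apply: le_trans (cnorm_le _) _; apply: lerD.
    by apply: (h1 t v t01); rewrite lexx.
  by apply: (h2 t v t01); rewrite lexx.
have K0 : 0 <= K.
  by apply: le_trans (cnorm_ge0 _) (hK 0 _); rewrite lexx ler01.
have [M [bM hM]] := decay_dom `|v| (theta_decay tau_gt0 N0 k).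
pose E := expR (- 2 * pi * (- p)%:~R * v).
have st := H0_smooth (theta tau N k).
have H : has_sum (fun m => cint01 (fun t => f (t +i* v) * (theta_coef tau N k m * ee m (t +i* v)) * ee (- p) (t +i* v)))
    (fcoef (fun z => f z * theta tau N k z) p v).
  apply: (@cint01_has_sum R _ (fun m => K * E * M m)).
  - by apply: bsumZ => //; rewrite mulr_ge0 ?expR_ge0.
  - move=> m; apply: ccontM; last exact/ccont_hslice/smooth_ee.
    apply: ccontM; first exact: ccont_hslice.
    exact/ccontZ/ccont_hslice/smooth_ee.
  - by apply: (ccont_mulee _ _ (f := f * theta tau N k)); apply: smoothM.
  - move=> m t t01; rewrite cnormM [cnorm (ee (- p) _)]cnorm_ee -[complex.Im _]/v -/E.
    rewrite cnormM [K * E * _]mulrAC ler_pM2r ?expR_gt0//; apply: ler_pM; rewrite ?cnorm_ge0 ?hK//.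
    exact: (hM m (t +i* v)).
  - move=> t _; have := has_sumZ (f (t +i* v) * ee (- p) (t +i* v)) (theta_has_sum tau_gt0 N0 k (t +i* v)).
    rewrite mulrAC; apply: has_sum_eq => m; by rewrite mulrAC.
apply: has_sum_eq H => m; rewrite /fcoef -cint01Z; last exact: ccont_mulee.
congr cint01; apply/funext => t; rewrite mulrCA -!mulrA; congr (_ * (_ * _)).
by rewrite -eeDl opprB.
Qed.

Lemma has_deriv_scale (f : R -> C) (s x : R) (d : C) : has_deriv f (s * x) d ->
  has_deriv (fun t => f (s * t)) x (s%:C * d).
Proof.
have ds : is_derive x 1 (fun y : R => s * y) s.
  by apply: is_derive_eq (is_deriveZ s (is_derive_id x 1)) _; rewrite [_ *: _]mulr1.
move=> [f1 f2]; split.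
  have := @is_derive1_comp R (fun t => complex.Re (f t)) (fun y => s * y) x _ _ f1 ds.
  by rewrite mulrC ReM /= mul0r subr0.
have := @is_derive1_comp R (fun t => complex.Im (f t)) (fun y => s * y) x _ _ f2 ds.
by rewrite mulrC ImM /= mul0r addr0.
Qed.

(** The inner integral runs along a horizontal segment of length 1 at height s Im tau; periodicity
    slides it back to start at x = 0, where it is the coefficient of frequency 0. *)
Lemma torus_intE g : smooth g -> hper g ->
  torus_int tau g = t2%:C * cint01 (fun s => fcoef g 0 (s * t2)).
Proof.
move=> sg pg.
have E (s : R) : fcoef g 0 (s * t2) =
    int01 (fun b => complex.Re (g (s%:C * tau + b%:C))) +i*
    int01 (fun b => complex.Im (g (s%:C * tau + b%:C))).
  rewrite /fcoef; under eq_fun do rewrite oppr0 ee0 mulr1.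
  rewrite -(cint01_shift (s * complex.Re tau) (ccont_hslice (s * t2) sg)); last first.
    by move=> x; rewrite x1_shift pg.
  have A (b : R) : (b + s * complex.Re tau) +i* (s * t2) = s%:C * tau + b%:C.
    by case: tau => u w /=; rewrite mulCE addCE !mul0r subr0 !addr0 addrC.
  by rewrite /cint01; congr (_ +i* _); congr int01; apply/funext => b; rewrite A.
transitivity (t2%:C *
  (int01 (fun s => int01 (fun b => complex.Re (g (s%:C * tau + b%:C)))) +i*
   int01 (fun s => int01 (fun b => complex.Im (g (s%:C * tau + b%:C)))))); first by [].
have -> : (fun s => fcoef g 0 (s * t2)) = fun s : R =>
    int01 (fun b => complex.Re (g (s%:C * tau + b%:C))) +i*
    int01 (fun b => complex.Im (g (s%:C * tau + b%:C))).
  by apply/funext => s; exact: E.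
exact: erefl.
Qed.

Lemma fcoef_qper_int (M : int) f n y (j : int) : M != 0 -> smooth f -> hper f ->
  (forall z, f (z + tau) = f z * automorphy tau M 1 z) ->
  qp tau (- ((n + M * j)%:~R ^+ 2 / M%:~R)) * fcoef f (n + M * j) y =
  qp tau (- (n%:~R ^+ 2 / M%:~R)) * fcoef f n (y + j%:~R * t2).
Proof.
move=> M0 sf pf qf; have M0' : M%:~R != 0 :> R by rewrite intr_eq0.
pose Q m v := qp tau (- (m%:~R ^+ 2 / M%:~R)) * fcoef f m v.
have step m v : Q (m + M) v = Q m (v + t2).
  rewrite /Q (fcoef_qper m v sf pf qf) mulrA -qpD; congr (qp _ _ * _).
  by rewrite intrD; field.
have nat_case (k : nat) m v : Q (m + M * k%:Z) v = Q m (v + k%:R * t2).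
  elim: k m v => [|k IH] m v; first by rewrite mulr0 mul0r !addr0.
  by rewrite -addn1 PoszD mulrDr mulr1 addrA step IH natrD mulrDl mul1r addrA addrAC.
rewrite -/(Q _ _) -/(Q _ _); case: j => k; first exact: nat_case.
have := nat_case k.+1 (n + M * Negz k) (y + (Negz k)%:~R * t2).
by rewrite NegzE mulrN subrK mulrNz mulNr subrK => ->.
Qed.

Lemma has_sum_telescope (F : R -> C) (L s : C) (h : R) : 0 < h ->
  lim_Ny F 0 -> lim_y F L ->
  has_sum (fun j : int => F ((j + 1)%:~R * h) - F (j%:~R * h)) s -> s = L.
Proof.
move=> h0 F0 FL Fs; apply/eqP; rewrite -subr_eq0 -cnorm_eq0 eq_le cnorm_ge0 andbT.
apply/ler_addgt0Pl => e e0; rewrite addr0; have e3 : 0 < e / 3 by rewrite divr_gt0.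
have [A hA] := Fs _ e3; have [a ha] := F0 _ e3; have [b hb] := FL _ e3.
have [k [kA ka kb]] : exists k : nat, [/\ forall j, j \in A -> - k%:Z <= j < k%:Z,
    - k%:R * h <= a & b <= k%:R * h].
  pose k1 := (\max_(j <- A) `|j|).+1; pose k2 := Num.bound (`|a| / h); pose k3 := Num.bound (`|b| / h).
  exists (k1 + k2 + k3)%N; split.
  - move=> j jA; have : (`|j| < k1)%N by rewrite ltnS (big_fsetD1 j)//= leq_maxl.
    lia.
  - have : `|a| / h < k2%:R by exact: unstable.ltr_bound.
    rewrite ltr_pdivrMr// => h2; rewrite !natrD mulNr lerNl.
    apply: le_trans (_ : k2%:R * h <= _); first by apply: le_trans (ltW h2); rewrite -normrN ler_norm.
    by rewrite ler_wpM2r ?(ltW h0)//; have := ler0n R k1; have := ler0n R k3; lra.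
  - have : `|b| / h < k3%:R by exact: unstable.ltr_bound.
    rewrite ltr_pdivrMr// => h2; rewrite !natrD.
    apply: le_trans (_ : k3%:R * h <= _); first by apply: le_trans (ltW h2); rewrite ler_norm.
    by rewrite ler_wpM2r ?(ltW h0)//; have := ler0n R k1; have := ler0n R k2; lra.
pose B := [fset i%:Z - k%:Z | i in iota 0 (k + k)]%fset.
have AB : (A `<=` B)%fset.
  apply/fsubsetP => j jA; apply/imfsetP; exists (absz (j + k%:Z)) => /=.
    by rewrite mem_iota; have := kA j jA; lia.
  by have := kA j jA; lia.
have SB : \sum_(j <- B) (F ((j + 1)%:~R * h) - F (j%:~R * h)) = F (k%:R * h) - F (- k%:R * h).
  rewrite (_ : \sum_(j <- B) _ = \sum_(j <- [seq i%:Z - k%:Z | i <- index_iota 0 (k + k)]) (F ((j + 1)%:~R * h) - F (j%:~R * h))); last first.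
    apply/perm_big/uniq_perm; first exact: fset_uniq.
      by rewrite map_inj_uniq ?iota_uniq// => i i' /addIr [].
    move=> j; apply/imfsetP/mapP => [[i /= ik ->]|[i ik ->]]; exists i => //.
      by rewrite /index_iota subn0.
    by move: ik; rewrite /index_iota subn0.
  rewrite big_map (telescope_sumr_eq (fun i => F ((i%:Z - k%:Z)%:~R * h))).
  - by rewrite PoszD addrK sub0r mulrNz.
  - by [].
  - by move=> i _; congr (F (_%:~R * h) - _); lia.
have := hA B AB; rewrite SB; have := ha _ ka; have := hb _ kb; rewrite subr0.
set u := F _; set w := F _ => h1 h2 h3.
rewrite (_ : s - L = (u - L) - w - (u - w - s)); last by ring.
apply: le_trans (cnormB _ _) _; have := cnormB (u - L) w; lra.
Qed.

End Convolution.

(** * Serre duality *)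

Section SerreDuality.
Variables (R : realType) (tau kappa : R[i]).
Local Notation C := R[i].
Local Notation t2 := (complex.Im tau).
Hypothesis tau_gt0 : 0 < t2.
Hypothesis kappa_neq0 : kappa != 0.
Variables (N : nat) (N0 : (0 < N)%N).
Implicit Types (z : C) (x y v : R) (n m : int).

Let M : int := - N%:Z.
Let M_lt0 : M < 0. Proof. by rewrite /M oppr_lt0 ltz_nat. Qed.
Let NR0 : (N%:R : R) != 0. Proof. by rewrite pnatr_eq0 -lt0n. Qed.

Lemma bsum_gauss (c b : R) : 0 < c ->
  bsum (fun j : int => expR (- (c * `|j%:~R| ^+ 2) + b * `|j%:~R|)).
Proof.
move=> c0; have [B [B0 hB]] := gauss_bound b 2 c0.
apply: bsumW (bsumZ B0 (bsum_wt R)) _ => j; rewrite expR_ge0 /=.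
by rewrite ler_pdivlMr ?exprn_gt0 ?wt_gt0// hB.
Qed.

(* Quasi-periodicity unfolds the integral over the torus into the integral over
   the whole line of the single coefficient [fcoef a n]. *)
Lemma serre_formula (a : csec tau M) (k : nat) n (P : R -> C) (L : C) :
  (N%:Z %| n + k%:Z)%Z ->
  (forall v, has_deriv P v ((0 +i* - 2) * fcoef a n v)) -> lim_Ny P 0 -> lim_y P L ->
  torus_int tau (fun w => a w * theta tau N k w * kappa * (0 +i* - 2)) =
  kappa * qp tau (n%:~R ^+ 2 / N%:R) * L.
Proof.
move=> nk dP P0 PL.
have sa := csec_smooth a; have pa := @csec_hper _ _ _ a.
have st := H0_smooth (theta tau N k); have pt := @csec_hper _ _ _ (theta tau N k).
pose cst := kappa * (0 +i* - 2); pose g z := a z * theta tau N k z.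
have sg : smooth g by exact: (smoothM sa st).
have pg : hper g by exact: (hperM pa pt).
have -> : (fun w => a w * theta tau N k w * kappa * (0 +i* - 2)) = fun w => cst * g w.
  by apply/funext => w; rewrite /cst /g; move: (a w) (theta tau N k w) => A B; ring.
rewrite torus_intE; [|exact: (smoothM (smooth_cst cst) sg)|by move=> z; rewrite /= pg].
under [X in cint01 X]eq_fun do rewrite fcoefZ//.
have dsc (h : R -> C) (D : C) (s : R) : has_deriv h (s * t2) D ->
    has_deriv (fun s => h (s * t2)) s (t2%:C * D).
  move=> hD; under [X in has_deriv X]eq_fun do rewrite mulrC.
  by apply: has_deriv_scale; rewrite mulrC.
have cg : ccont (fun s => fcoef g 0 (s * t2)).
  exact: (has_deriv_ccont (fun s => dsc _ _ s (fcoef_deriv 0 (s * t2) sg pg))).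
rewrite cint01Z//.
pose phi := fcoef a n.
have cphi (j : int) : ccont (fun s => phi ((s + j%:~R) * t2)).
  apply: (has_deriv_ccont (d := fun s => t2%:C * ((0 +i* - 2) * fcoef (dzbar a) n ((s + j%:~R) * t2)))) => s.
  apply: (has_deriv_shift (f := fun s => phi (s * t2))).
  exact: (dsc _ _ _ (fcoef_deriv n _ sa pa)).
(* In the convolution for frequency 0 only m = - (n + M j) meets the residue class of k, and
   quasi-periodicity turns the corresponding coefficient of a into [phi] translated by j Im tau. *)
have sumv v : has_sum (fun j : int => qp tau (n%:~R ^+ 2 / N%:R) * phi (v + j%:~R * t2)) (fcoef g 0 v).
  have H := fcoef_mul_theta tau_gt0 N0 k 0 v sa.
  have nNj (j : int) : theta_coef tau N k (- (n + M * j)) * fcoef a (0 - - (n + M * j)) v =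
      qp tau (n%:~R ^+ 2 / N%:R) * phi (v + j%:~R * t2).
    rewrite /theta_coef (_ : (N%:Z %| - (n + M * j) - k%:Z)%Z); last first.
      rewrite -opprD addrAC rpredN rpredD// /M mulNr rpredN dvdz_mulr//.
    rewrite sub0r opprK.
    have := fcoef_qper_int n v j (_ : M != 0) sa pa (csec_qper a).
    rewrite lt_eqF// => /(_ isT); rewrite mulrNz sqrrN /M !mulrNz !invrN !mulrN !opprK.
    by [].
  pose h (j : int) := - (n + M * j).
  have hI : injective h.
    move=> i j /oppr_inj /addrI /mulfI; apply; by rewrite lt_eqF.
  have [Mb [bM hM]] : exists Mb : int -> R, bsum Mb /\ forall m,
      cnorm (theta_coef tau N k m * fcoef a (0 - m) v) <= Mb m.
    have [S [S0 hS]] := fcoef_growth tau_gt0 M_lt0 a.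
    have c0 : 0 < pi * t2 / N%:R by rewrite divr_gt0 ?mulr_gt0 ?pi_gt0 ?ltr0n.
    exists (fun m => S * expR (- (pi * t2 / N%:R * `|m%:~R| ^+ 2) + 2 * pi * `|v| * `|m%:~R|)).
    split=> [|m]; first by apply: bsumZ => //; exact: bsum_gauss.
    rewrite cnormM expRD mulrCA; apply: ler_pM; rewrite ?cnorm_ge0//.
      have := theta_coef_bound tau N0 k m 0.
      by rewrite cnormM cnorm_ee /= !mulr0 expR0 mulr1 normr0 mulr0 mul0r addr0.
    apply: le_trans (hS _ v) _; rewrite ler_wpM2l// ler_expR sub0r.
    have cM : pi * M%:~R / t2 * v ^+ 2 <= 0.
      by rewrite mulr_le0_ge0 ?sqr_ge0// mulr_le0_ge0 ?invr_ge0 ?(ltW tau_gt0)// mulr_ge0_le0 ?pi_ge0// lerz0 ltW.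
    apply: le_trans (lerD cM (ler_norm _)) _; rewrite add0r !normrM normr_nat (ger0_norm (pi_ge0 R)).
    by rewrite mulrNz normrN mulrAC.
  have [s hs] := has_sum_ex (bsum_comp hI bM) (fun j => hM (h j)).
  have hs' : has_sum (fun m => theta_coef tau N k m * fcoef a (0 - m) v) s.
    apply: (has_sum_inj hI) hs => m nm; rewrite /theta_coef; case: ifP => [mk|]; last by rewrite mul0r.
    case: nm; have : (N%:Z %| m + n)%Z.
      have -> : m + n = (m - k%:Z) + (n + k%:Z) by lia.
      by rewrite rpredD.
    move=> /dvdzP[q mq]; exists q; rewrite /h /M mulNr mulrC -mq; ring.
  rewrite (has_sum_unique H hs'); apply: has_sum_eq hs => j; exact: nNj.
pose k0 : C := t2%:C * (0 +i* - 2).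
have k00 : k0 != 0.
  rewrite mulf_neq0//; last by rewrite eq_complex /= eqxx oppr_eq0 pnatr_eq0.
  by rewrite eq_complex /= eqxx andbT gt_eqF.
have Ij (j : int) : cint01 (fun s => phi ((s + j%:~R) * t2)) =
    k0^-1 * (P ((j + 1)%:~R * t2) - P (j%:~R * t2)).
  have hF s : has_deriv (fun s => k0^-1 * P ((s + j%:~R) * t2)) s (phi ((s + j%:~R) * t2)).
    have -> : phi ((s + j%:~R) * t2) = k0^-1 * (t2%:C * ((0 +i* - 2) * phi ((s + j%:~R) * t2))).
      by rewrite !mulrA -[k0^-1 * _ * _]mulrA mulVf// mul1r.
    apply: has_derivZ; apply: (has_deriv_shift (f := fun s => P (s * t2))).
    exact: (dsc _ _ _ (dP _)).
  rewrite (cint01_FTC (F := fun s => k0^-1 * P ((s + j%:~R) * t2)) (cphi j) hF).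
  by rewrite -mulrBr add0r intrD [1%:~R + _]addrC addrC.
set I := cint01 (fun s => fcoef g 0 (s * t2)).
(* Termwise integration: for s in [0, 1] the growth bound on [fcoef a n] at height (s + j) Im tau is
   dominated by a Gaussian in j. *)
have sumI : has_sum (fun j : int => qp tau (n%:~R ^+ 2 / N%:R) * cint01 (fun s => phi ((s + j%:~R) * t2))) I.
  have [S [S0 hS]] := fcoef_growth tau_gt0 M_lt0 a.
  pose c := - (pi * M%:~R / t2 * t2 ^+ 2); pose b := 2 * c + `|2 * pi * n%:~R * t2|.
  have c0 : 0 < c.
    rewrite /c /M mulrNz mulrN !mulNr opprK !mulr_gt0 ?pi_gt0 ?invr_gt0//.
    by rewrite ltr0n.
  pose Q := cnorm (qp tau (n%:~R ^+ 2 / N%:R)).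
  have bS : bsum (fun j : int => Q * (S * expR (`|2 * pi * n%:~R * t2|)) * expR (- (c * `|j%:~R| ^+ 2) + b * `|j%:~R|)).
    by apply: bsumZ (bsum_gauss _ c0); rewrite !mulr_ge0 ?expR_ge0// cnorm_ge0.
  have := @cint01_has_sum R _ _ (fun j s => qp tau (n%:~R ^+ 2 / N%:R) * phi ((s + j%:~R) * t2))
     (fun s => fcoef g 0 (s * t2)) bS (fun j => ccontZ _ (cphi j)) cg.
  under [X in _ -> _ -> has_sum X _]eq_fun do rewrite cint01Z//.
  apply.
    move=> j s /andP[s0 s1]; rewrite cnormM -[leRHS]mulrA ler_wpM2l ?cnorm_ge0//.
    apply: le_trans (hS n _) _; rewrite -[leRHS]mulrA ler_wpM2l// -expRD ler_expR.
    have e1 : pi * M%:~R / t2 * ((s + j%:~R) * t2) ^+ 2 = - (c * (s + j%:~R) ^+ 2).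
      by rewrite /c; ring.
    have A1 : - (c * (s + j%:~R) ^+ 2) <= - (c * `|j%:~R| ^+ 2) + 2 * c * `|j%:~R|.
      have j2 : `|j%:~R : R| ^+ 2 - 2 * `|j%:~R| <= (s + j%:~R) ^+ 2.
        rewrite real_normK ?num_real//; have := ler_norm (- (j%:~R : R)); rewrite normrN.
        have := normr_ge0 (j%:~R : R) => h1 h2.
        have : s * - j%:~R <= `|j%:~R : R|.
          by apply: le_trans (_ : s * `|j%:~R| <= _); [rewrite ler_wpM2l|rewrite ler_piMl].
        have := sqr_ge0 s; nra.
      by have := ler_wpM2l (ltW c0) j2; lra.
    have A2 : 2 * pi * n%:~R * ((s + j%:~R) * t2) <= `|2 * pi * n%:~R * t2| * (1 + `|j%:~R|).
      rewrite mulrA mulrAC; apply: le_trans (ler_norm _) _; rewrite normrM ler_wpM2l//.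
      by apply: le_trans (ler_normD _ _) _; rewrite lerD2r ger0_norm.
    by rewrite e1 /b; move: A1 A2; set A := `|2 * _ * _ * _|; lra.
  move=> s _; apply: has_sum_eq (sumv (s * t2)) => j.
  by rewrite mulrDl.
have sumP := has_sumZ (k0 / qp tau (n%:~R ^+ 2 / N%:R)) sumI.
have IL : k0 / qp tau (n%:~R ^+ 2 / N%:R) * I = L.
  apply: (has_sum_telescope tau_gt0 tau_gt0 P0 PL); apply: has_sum_eq sumP => j.
  by rewrite Ij; field; rewrite k00 qp_neq0.
rewrite -IL /cst; move: k00 (qp_neq0 tau (n%:~R ^+ 2 / N%:R)); rewrite /k0 => k00 q0.
by field.
Qed.

Lemma fcoef_lim0 (a : csec tau M) n : lim_Ny (fcoef a n) 0 /\ lim_y (fcoef a n) 0.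
Proof.
have key (f : R -> C) (S : R) : (forall v, cnorm (f v) <= S * expR v) -> lim_Ny f 0.
  move=> fS e e0; have [A [_ hA]] := exp_small S e0; exists A => v vA.
  by rewrite subr0; exact: le_lt_trans (fS v) (hA v vA).
have [S [_ hS]] := fcoef_growth_exp tau_gt0 M_lt0 a n 1.
have [T [_ hT]] := fcoef_growth_exp tau_gt0 M_lt0 a n (- 1).
split; first by apply: (key _ S) => v; have := hS v; rewrite mul1r.
by apply/lim_NyN; apply: (key _ T) => v; have := hT (- v); rewrite mulrNN mul1r.
Qed.

(** [serre] is computed on the representative [repr], which differs from a by some d-bar t. The
    primitive then changes by a coefficient of t, and this vanishes at both ends. *)
Lemma serre_cls (a : csec tau M) (k : nat) n (P : R -> C) (L : C) :
  (N%:Z %| n + k%:Z)%Z ->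
  (forall v, has_deriv P v ((0 +i* - 2) * fcoef a n v)) -> lim_Ny P 0 -> lim_y P L ->
  serre kappa (cls a) (theta tau N k) = kappa * qp tau (n%:~R ^+ 2 / N%:R) * L.
Proof.
move=> nk dP P0 PL; have [t at_] := (cls_eq (repr (cls a)) a).1 (cls_repr _).
have rE : (repr (cls a) : csec tau M) = (fun z => a z + dzbar t z) :> (C -> C).
  apply/funext => z; have /(congr1 (fun u : csec tau M => (u : C -> C) z)) /= <- := at_.
  by rewrite -[(_ - _) z]/(_ z - _ z) addrC subrK.
have sa := csec_smooth a; have st := csec_smooth t; have pt := @csec_hper _ _ _ t.
have [t1 t1'] := fcoef_lim0 t n.
apply: (@serre_formula (repr (cls a)) k n (fun v => P v + fcoef t n v) L nk).
- move=> v; rewrite rE fcoefD//; last exact: smooth_dzbar.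
  by rewrite mulrDr; apply: has_derivD => //; exact: fcoef_deriv.
- have := lim_NyB P0 (lim_NyZ (- 1) t1); rewrite mulr0 subr0.
  by under [X in lim_Ny X]eq_fun do rewrite mulN1r opprK.
- apply/lim_NyN; move/lim_NyN: PL => PL; move/lim_NyN: t1' => t1'.
  have := lim_NyB PL (lim_NyZ (- 1) t1'); rewrite mulr0 subr0.
  by under [X in lim_Ny X]eq_fun do rewrite mulN1r opprK.
Qed.

(** The pairings with one theta function per residue class determine the limits L n for all n. Equal
    limits make the primitives of the difference vanish at both ends, and [dbar_solve] applies. *)
Lemma serre_inj (y1 y2 : H1 tau M) :
  (forall k : 'I_N, serre kappa y1 (theta tau N k) = serre kappa y2 (theta tau N k)) ->
  y1 = y2.
Proof.
move=> y12; rewrite -[y1]cls_repr -[y2]cls_repr.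
pose a1 : csec tau M := repr y1; pose a2 : csec tau M := repr y2.
have [P1 hP1] := choice (fcoef_primitive tau_gt0 M_lt0 a1).
have [L1 {}hP1] := choice hP1.
have [P2 hP2] := choice (fcoef_primitive tau_gt0 M_lt0 a2).
have [L2 {}hP2] := choice hP2.
have L12 n : L1 n = L2 n.
  have [d1 n1 l1] := hP1 n; have [d2 n2 l2] := hP2 n.
  have nk : (N%:Z %| n + (cmod N0 (- n) : nat)%:Z)%Z.
    have := cmodP tau_gt0 N0 (- n) (cmod N0 (- n)); rewrite eqxx.
    by rewrite -opprD rpredN.
  have := y12 (cmod N0 (- n)); rewrite -[y1]cls_repr -[y2]cls_repr.
  rewrite (serre_cls nk d1 n1 l1) (serre_cls nk d2 n2 l2).
  by apply: mulfI; rewrite mulf_neq0// qp_neq0.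
have E1 n v : has_deriv (fun v => P1 n v - P2 n v) v ((0 +i* - 2) * fcoef (a1 - a2) n v).
  have [d1 _ _] := hP1 n; have [d2 _ _] := hP2 n.
  have s2 : smooth (fun z => - 1 * a2 z) by exact: (smoothM (smooth_cst _) (csec_smooth a2)).
  have fe : (a1 - a2 : csec tau M) = (fun z => a1 z + - 1 * a2 z) :> (C -> C).
    by apply/funext => z; rewrite mulN1r.
  rewrite fe (fcoefD _ _ (csec_smooth a1) s2) (fcoefZ _ _ _ (csec_smooth a2)) mulN1r.
  by rewrite mulrBr; exact: has_derivB.
have E2 n : lim_Ny (fun v => P1 n v - P2 n v) 0.
  have [_ n1 _] := hP1 n; have [_ n2 _] := hP2 n.
  by have := lim_NyB n1 n2; rewrite subrr.
have E3 n : lim_y (fun v => P1 n v - P2 n v) 0.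
  apply/lim_NyN; have [_ _ /lim_NyN n1] := hP1 n; have [_ _ /lim_NyN n2] := hP2 n.
  by have := lim_NyB n1 n2; rewrite L12 subrr.
have [t [dt _]] := dbar_solve tau_gt0 M_lt0 E1 E2 E3.
by apply/cls_eq; exists t; rewrite dt.
Qed.

Lemma dual_basisE (j : nat) (a : csec tau M) (P : int -> R -> C) :
  (forall n v, has_deriv (P n) v ((0 +i* - 2) * fcoef a n v)) ->
  (forall n, lim_Ny (P n) 0) ->
  (forall n, lim_y (P n) (if (N%:Z %| n - j%:Z)%Z then kappa^-1 * qp tau (- (n%:~R ^+ 2 / N%:R)) else 0)) ->
  dual_basis tau kappa N j = cls a.
Proof.
move=> dP P0 PL.
have S k : serre kappa (cls a) (theta tau N k) = if (N %| j + k)%N then 1 else 0.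
  have nk : (N%:Z %| - k%:Z + k%:Z)%Z by rewrite addNr dvdz0.
  rewrite (serre_cls nk (dP _) (P0 _) (PL _)).
  rewrite -opprD rpredN -PoszD -[(N%:Z %| _)%Z]/(N %| k + j)%N addnC.
  case: ifP => _; last by rewrite mulr0.
  by rewrite mulrACA mulfV// mul1r -qpD subrr qp0.
apply: xget_unique => [k|y hy]; first exact: S.
by apply: serre_inj => k; rewrite S hy.
Qed.

End SerreDuality.

(** * Gaussian representatives of the dual basis *)

Section GaussianCdf.
Variable R : realType.
Local Notation C := R[i].
Implicit Types (c v x : R).

Definition gauss c v : R := expR (- (c * v ^+ 2)).

Lemma gauss_ge0 c v : 0 <= gauss c v. Proof. exact: expR_ge0. Qed.

Lemma is_derive_gauss c v : is_derive v 1 (gauss c) (- 2 * c * v * gauss c v).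
Proof.
have d1 : is_derive v 1 (fun x : R => - (c * x ^+ 2)) (- 2 * c * v).
  by apply: is_derive_eq; rewrite /GRing.scale /=; ring.
apply: is_derive_eq (is_derive1_comp (is_derive_expR _) d1) _.
by rewrite mulrC.
Qed.

Lemma continuous_gauss c : continuous (gauss c).
Proof. exact: is_derive_continuous (is_derive_gauss c). Qed.

Lemma gauss_tail c (F : R -> C) (g : C) : 0 < c ->
  (forall v, has_deriv F v (g * (gauss c v)%:C)) -> lim_Ny F 0 ->
  exists K : R, 0 <= K /\ forall v, v <= 0 -> cnorm (F v) <= K * gauss c v.
Proof.
move=> c0 dF F0; have [B [B0 hB]] := gauss_bound 1 0 c0.
exists (2 * (cnorm g * B)); split=> [|v v0]; first by rewrite !mulr_ge0// cnorm_ge0.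
have := @exp_tail R F _ (cnorm g * B * gauss c v * expR (- v)) 1 v ltr01 dF _ F0.
rewrite divr1 mul1r -!mulrA -expRD addNr expR0 mulr1; apply=> x xv.
rewrite cnormM cnorm_real ger0_norm ?gauss_ge0// -[leRHS]mulrA ler_wpM2l ?cnorm_ge0// mul1r.
rewrite /gauss -!mulrA -!expRD.
have -> : - (c * x ^+ 2) = (- (c * (v - x) ^+ 2) + 1 * (v - x)) +
    (- (c * v ^+ 2) + (- v + x) - 2 * c * (v * (x - v))) by ring.
rewrite [leLHS]expRD; apply: (ler_pM (expR_ge0 _) (expR_ge0 _)).
  by have := hB (v - x); rewrite expr0 mulr1 subr_ge0; exact.
by rewrite ler_expR gerDl oppr_le0; apply: mulr_ge0; [rewrite mulr_ge0// ltW|rewrite mulr_le0// subr_le0].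
Qed.

(** chi is a primitive of the Gaussian normalized by the total mass L - l, which is nonzero because
    the primitive is strictly increasing. The estimate at +oo is the one at -oo for v |-> 1 - chi (-
    v). *)
Lemma gauss_cdf c : 0 < c -> exists (g : C) (chi : R -> C) (K : R),
  [/\ g != 0, 0 <= K, forall v, has_deriv chi v (g * (gauss c v)%:C),
      forall v, v <= 0 -> cnorm (chi v) <= K * gauss c v &
      forall v, 0 <= v -> cnorm (1 - chi v) <= K * gauss c v].
Proof.
move=> c0; have [H dH] := primitive_ex (@continuous_gauss c).
pose F v : C := (H v)%:C.
have dF v : has_deriv F v (gauss c v)%:C.
  by split; [exact: dH|exact: is_derive_cst].
have [B [B0 hB]] := gauss_bound 1 0 c0.
have gB v : gauss c v <= B * expR v /\ gauss c v <= B * expR (- v).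
  have := hB `|v| (normr_ge0 v); rewrite expr0 mulr1 mul1r expRD real_normK ?num_real// => h.
  have {}h : gauss c v <= B * expR (- `|v|).
    by rewrite expRN ler_pdivlMr ?expR_gt0.
  have := ler_norm v; have := ler_norm (- v); rewrite normrN => h1 h2.
  by split; apply: le_trans h _; rewrite ler_wpM2l// ler_expR lerNl// opprK.
have [l hl] : exists l, lim_Ny F l.
  apply: (exp_lim_ex (K := B) dF) => x _.
  by rewrite cnorm_real ger0_norm ?gauss_ge0//; exact: (gB x).1.
have dFN v : has_deriv (fun v => F (- v)) v (- (gauss c v)%:C).
  by apply: has_deriv_opp; rewrite /gauss -sqrrN; exact: dF.
have [L hL] : exists L, lim_Ny (fun v => F (- v)) L.
  apply: (exp_lim_ex (K := B) dFN) => x _.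
  by rewrite cnormN cnorm_real ger0_norm ?gauss_ge0//; exact: (gB x).1.
have Hmono x y : x < y -> H x < H y.
  move=> xy; have [|z _ e] := @MVT _ H (gauss c) x y xy (fun z _ => dH z).
    by apply: continuous_subspaceT; exact: is_derive_continuous dH.
  by rewrite -subr_gt0 e mulr_gt0 ?expR_gt0 ?subr_gt0.
have Ll : L - l != 0.
  apply/eqP => /subr0_eq Ll; have e0 : 0 < (H 1 - H (- 1)) / 2.
    by rewrite divr_gt0 ?subr_gt0 ?Hmono//; lra.
  have [A hA] := hl _ e0; have [D hD] := hL _ e0.
  pose v := Num.min (- 2) (Num.min A D).
  have v2 : v <= - 2 by rewrite /v ge_min lexx.
  have vA : v <= A by rewrite /v !ge_min lexx orbT.
  have vD : v <= D by rewrite /v !ge_min lexx !orbT.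
  have := le_lt_trans (Re_le_cnorm _) (hA _ vA); have := le_lt_trans (Re_le_cnorm _) (hD _ vD).
  rewrite Ll /F !ReD !ReN /= => h1 h2.
  have h3 : H v < H (- 1) by apply: Hmono; lra.
  have h4 : H 1 < H (- v) by apply: Hmono; lra.
  move: h1 h2; rewrite !ltr_norml => /andP[_ h1] /andP[h2 _]; lra.
pose g := (L - l)^-1; pose chi v := g * (F v - l).
have dchi v : has_deriv chi v (g * (gauss c v)%:C).
  apply: has_derivZ; rewrite -[(gauss c v)%:C]subr0.
  exact: has_derivB (dF v) (has_deriv_cst l v).
have cst (e : C) : lim_Ny (fun=> e : C) e by move=> x x0; exists 0 => w _; rewrite subrr cnorm0.
have chi0 : lim_Ny chi 0.
  by have := lim_NyZ g (lim_NyB hl (cst l)); rewrite subrr mulr0.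
have chiN0 : lim_Ny (fun v => 1 - chi (- v)) 0.
  have := lim_NyB (cst 1) (lim_NyZ g (lim_NyB hL (cst l))).
  by rewrite /g mulVf// subrr.
have dchiN v : has_deriv (fun v => 1 - chi (- v)) v (g * (gauss c v)%:C).
  rewrite -[g * _]opprK -[- - _]add0r; apply: has_derivB; first exact: has_deriv_cst.
  by apply: has_deriv_opp; rewrite /gauss -sqrrN; exact: dchi.
have [K1 [K10 h1]] := gauss_tail c0 dchi chi0.
have [K2 [K20 h2]] := gauss_tail c0 dchiN chiN0.
exists g, chi, (K1 + K2); split=> //.
- by rewrite invr_eq0.
- by rewrite addr_ge0.
- by move=> v v0; apply: le_trans (h1 v v0) _; rewrite ler_wpM2r ?gauss_ge0// lerDl.
- move=> v v0; have := h2 (- v); rewrite opprK oppr_le0 => /(_ v0) h.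
  by apply: le_trans h _; rewrite /gauss sqrrN ler_wpM2r ?expR_ge0// lerDr.
Qed.

Lemma Cn_snd n : Cn n (fun p : R * R => p.2).
Proof.
have cs : continuous (fun p : R * R => p.2) by move=> p; exact: cvg_snd.
have d1 (p : R * R) : is_derive p (1, 0) (fun p : R * R => p.2) 0.
  by case: p => x y; apply: is_derive_slice1; exact: is_derive_cst.
have d2 (p : R * R) : is_derive p (0, 1) (fun p : R * R => p.2) 1.
  by case: p => x y; apply: is_derive_slice2; exact: is_derive_id.
elim: n => [|n IH]; first exact: (conj cs I).
split; [exact: cs|split] => [p|p||].
- by have [] := d1 p.
- by have [] := d2 p.
- rewrite (_ : 'D_((1, 0) : R * R) _ = fun=> 0 : R); first exact: Cn_cst.
  by apply/funext => p; have [_ ->] := d1 p.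
- rewrite (_ : 'D_((0, 1) : R * R) _ = fun=> 1 : R); first exact: Cn_cst.
  by apply/funext => p; have [_ ->] := d2 p.
Qed.

Lemma Cn_gauss c n : Cn n (fun p : R * R => gauss c p.2).
Proof.
have cs : continuous (fun p : R * R => gauss c p.2).
  move=> p; apply: (@continuous_comp _ _ _ (fun p : R * R => p.2) (gauss c)); first exact: cvg_snd.
  exact: continuous_gauss.
have d1 (p : R * R) : is_derive p (1, 0) (fun p : R * R => gauss c p.2) 0.
  by case: p => x y; exact: (is_derive_slice1 (U := fun p : R * R => gauss c p.2) (is_derive_cst (gauss c y) x 1)).
have d2 (p : R * R) : is_derive p (0, 1) (fun p : R * R => gauss c p.2) (- 2 * c * p.2 * gauss c p.2).
  by case: p => x y; exact: (is_derive_slice2 (U := fun p : R * R => gauss c p.2) (is_derive_gauss c y)).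
elim: n => [|n IH]; first exact: (conj cs I).
split; [exact: cs|split] => [p|p||].
- by have [] := d1 p.
- by have [] := d2 p.
- rewrite (_ : 'D_((1, 0) : R * R) _ = fun=> 0 : R); first exact: Cn_cst.
  by apply/funext => p; have [_ ->] := d1 p.
- rewrite (_ : 'D_((0, 1) : R * R) _ = (fun=> - 2 * c) \* (fun p => p.2) \* (fun p => gauss c p.2)).
    exact: (CnM (CnM (Cn_cst n _) (Cn_snd n)) IH).
  by apply/funext => p; have [_ ->] := d2 p.
Qed.

Lemma smooth_gauss c : smooth (fun z : C => (gauss c (complex.Im z))%:C).
Proof. by move=> n; split; [exact: Cn_gauss|exact: Cn_cst]. Qed.

Lemma smooth_conj (f : C -> C) : smooth f -> smooth (fun z => conjc (f z)).
Proof.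
move=> sf n; have [f1 f2] := sf n; split.
  rewrite (_ : reC _ = reC f)//; apply/funext => p.
  by rewrite /reC; case: (f _).
rewrite (_ : imC _ = (fun=> -1) \* imC f); first exact: (CnM (Cn_cst n _) f2).
by apply/funext => p; rewrite /imC /= mulN1r; case: (f _).
Qed.

Lemma conj_expC (z : C) : conjc (expC z) = expC (conjc z).
Proof. by case: z => a b; rewrite /expC /= cosN sinN mulrN. Qed.

Lemma conj_ee n (z : C) :
  conjc (ee n z) = ee (- n) z * (expR (- (4 * pi * n%:~R * complex.Im z)))%:C.
Proof.
have -> : (expR (- (4 * pi * n%:~R * complex.Im z)))%:C =
    expC (- (4 * pi * n%:~R * complex.Im z))%:C.
  by rewrite /expC /= cos0 sin0 mulr1 mulr0.
rewrite /ee conj_expC -expCD; congr expC; rewrite intrN intrC /pii.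
case: z => x y; rewrite natrC; move: (pi : R) (n%:~R : R) => p m.
by apply/eqP; rewrite eq_complex /=; apply/andP; split; apply/eqP; ring.
Qed.

Lemma cint01_conj (f : R -> C) : ccont f -> cint01 (fun x => conjc (f x)) = conjc (cint01 f).
Proof.
move=> [_ f2]; rewrite /cint01 -[RHS]/(_ +i* (- _)); congr (_ +i* _).
  by apply: eq_int01 => x _; case: (f x).
rewrite -mulN1r -int01Z//; apply: eq_int01 => x _.
by rewrite mulN1r; case: (f x).
Qed.

Lemma fcoef_conj (f : C -> C) n v : smooth f ->
  fcoef (fun z => conjc (f z)) n v =
  (expR (4 * pi * n%:~R * v))%:C * conjc (fcoef f (- n) v).
Proof.
move=> sf; have cf : ccont (fun x => f (x +i* v) * ee (- - n) (x +i* v)).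
  exact: ccont_mulee.
rewrite /fcoef -cint01_conj// -cint01Z; last first.
  case: cf => c1 c2; split.
    rewrite (_ : (fun t => _) = fun x => complex.Re (f (x +i* v) * ee (- - n) (x +i* v)))//.
    by apply/funext => t; case: (_ * _).
  rewrite (_ : (fun t => _) = - fun x => complex.Im (f (x +i* v) * ee (- - n) (x +i* v))).
    by move=> x; apply: continuousN; exact: c2.
  by apply/funext => t; rewrite [RHS]/(- _); case: (_ * _).
apply: eq_cint01 => x _; rewrite opprK.
have -> (a b : C) : conjc (a * b) = conjc a * conjc b.
  by case: a b => [a1 a2] [b1 b2]; rewrite /= !mulCE /=; congr (_ +i* _); ring.
rewrite conj_ee -[complex.Im _]/v.
have e1 (A : R) : (expR A)%:C * (expR (- A))%:C = 1 :> C.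
  rewrite expRN; apply/eqP; rewrite eq_complex /= !mulr0 !mul0r subr0 addr0 eqxx andbT.
  by rewrite mulfV// gt_eqF// expR_gt0.
rewrite -[LHS]mulr1 -(e1 (4 * pi * n%:~R * v)).
by move: (f _)^*%C (ee _ _) (_%:C) (_%:C) => F E a b; ring.
Qed.

End GaussianCdf.

Section GaussianLimits.
Variable R : realType.
Local Notation C := R[i].

Lemma gauss_le1 (c v : R) : 0 <= c -> gauss c v <= 1.
Proof. by move=> c0; rewrite /gauss -expR0 ler_expR oppr_le0 mulr_ge0// sqr_ge0. Qed.

Lemma cnorm_cdf (c K : R) (chi : R -> C) v : 0 <= c -> 0 <= K ->
  (forall v, v <= 0 -> cnorm (chi v) <= K * gauss c v) ->
  (forall v, 0 <= v -> cnorm (1 - chi v) <= K * gauss c v) -> cnorm (chi v) <= K + 1.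
Proof.
move=> c0 K0 chi0 chi1; have [v0|v0] := leP v 0.
  apply: le_trans (chi0 v v0) _; apply: (@le_trans _ _ K); last by rewrite lerDl.
  by rewrite ler_piMr// gauss_le1.
have := cnormB 1 (1 - chi v); rewrite opprB addrCA subrr addr0 cnorm1 => h.
apply: le_trans h _; rewrite addrC lerD2r; apply: le_trans (chi1 v (ltW v0)) _.
by rewrite ler_piMr// gauss_le1.
Qed.

Lemma gauss_lim_Ny (c K : R) (f : R -> C) (l : C) : 0 < c -> 0 <= K ->
  (forall v, v <= 0 -> cnorm (f v - l) <= K * gauss c v) -> lim_Ny f l.
Proof.
move=> c0 K0 hf e e0; have [B [B0 hB]] := gauss_bound 1 0 c0.
have [A [A0 hA]] := exp_small (K * B) e0; exists A => v vA.
have v0 := le_trans vA A0; apply: le_lt_trans (hA v vA); apply: le_trans (hf v v0) _.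
have := hB (- v); rewrite expr0 mulr1 mul1r oppr_ge0 => /(_ v0).
rewrite expRD sqrrN => h1; rewrite -mulrA ler_wpM2l//.
by rewrite -ler_pdivrMr ?expR_gt0// -expRN.
Qed.

Lemma lim_Ny_le (f : R -> C) (l : C) (B : R) : (forall v, cnorm (f v) <= B) ->
  lim_Ny f l -> cnorm l <= B.
Proof.
move=> fB fl; rewrite leNgt; apply/negP => lB.
have [|A hA] := fl (cnorm l - B); first by rewrite subr_gt0.
have := hA A (lexx _); have := cnormB (f A) (f A - l).
by rewrite opprB addrCA subrr addr0; have := fB A; lra.
Qed.

Lemma has_sum_lim_Ny (I : choiceType) (M : I -> R) (x : I -> R -> C) (S : R -> C)
    (l : I -> C) (s : C) :
  bsum M -> (forall i v, cnorm (x i v) <= M i) -> (forall i, lim_Ny (x i) (l i)) ->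
  (forall v, has_sum (x ^~ v) (S v)) -> has_sum l s -> lim_Ny S s.
Proof.
move=> bM xM xl xS ls e e0.
have near1 (P : R -> Prop) : (forall v, P v) -> ninfty_nbhs R P.
  by move=> hP; exists 0; split=> [|w _]; [exact: num_real|exact: hP].
have xl' i : ctends (ninfty_nbhs R) (fun v => x i v) (l i).
  move=> d d0; have [A hA] := xl i d d0; exists A; split; first exact: num_real.
  by move=> w /ltW; exact: hA.
have [B [_ hB]] := has_sum_ctends (x := fun v i => x i v) bM
  (near1 _ (fun v i => xM i v)) (fun i => lim_Ny_le (xM i) (xl i)) xl' (near1 _ xS) ls e0.
by exists (B - 1) => v vB; apply: hB; lra.
Qed.

End GaussianLimits.

(** * Representatives of the Serre dual basis *)

Section DualRepresentative.
Variables (R : realType) (tau kappa : R[i]).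
Local Notation C := R[i].
Local Notation t2 := (complex.Im tau).
Hypothesis tau_gt0 : 0 < t2.
Hypothesis kappa_neq0 : kappa != 0.
Variables (N : nat) (N0 : (0 < N)%N).
Implicit Types (z : C) (v : R) (n : int).

Lemma conj_qp (r : R) : conjc (qp tau r) = qp tau (- r) * (expR (- (2 * pi * t2 * r)))%:C.
Proof.
have -> : (expR (- (2 * pi * t2 * r)))%:C = expC (- (2 * pi * t2 * r))%:C.
  by rewrite /expC /= cos0 sin0 mulr1 mulr0.
rewrite /qp conj_expC -expCD; congr expC; rewrite /pii.
case: (tau) => x y /=; move: (pi : R) => p.
by apply/eqP; rewrite eq_complex /=; apply/andP; split; apply/eqP; ring.
Qed.

Lemma conjcM (a b : C) : conjc (a * b) = conjc a * conjc b.
Proof. by case: a b => [a1 a2] [b1 b2]; rewrite /= !mulCE /=; congr (_ +i* _); ring. Qed.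

Definition dual_cst (j : nat) n : C :=
  if (N%:Z %| n - j%:Z)%Z then kappa^-1 * qp tau (- (n%:~R ^+ 2 / N%:R)) else 0.

(** exp (- c y^2) with this rate is the weight of the invariant Hermitian metric on L(N): multiplied
    by it, the conjugate of a section of L(N) becomes a section of L(-N). *)
Definition dual_gauss_rate : R := 2 * pi * N%:R / t2.
Local Notation c := dual_gauss_rate.
Let NR0 : (N%:R : R) != 0. Proof. by rewrite pnatr_eq0 -lt0n. Qed.
Let t20 : t2 != 0. Proof. by rewrite gt_eqF. Qed.

(* The representative [a j] is a Gaussian in Im z times the conjugate of
   F_{N,-j}; the primitives of its coefficients are translates of [chi]. *)
Lemma dual_rep : exists (g : C) (chi : R -> C) (K : R) (a : nat -> csec tau (- N%:Z)),
  [/\ 0 <= K, forall v, has_deriv chi v (g * (gauss c v)%:C),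
      forall v, v <= 0 -> cnorm (chi v) <= K * gauss c v &
      forall v, 0 <= v -> cnorm (1 - chi v) <= K * gauss c v] /\
  [/\ forall j, cls (a j) = dual_basis tau kappa N j & forall j n v,
    (0 +i* - 2) * fcoef (a j) n v =
    dual_cst j n * (g * (gauss c (v - n%:~R * t2 / N%:R))%:C)].
Proof.
have c0 : 0 < c by rewrite /c divr_gt0// !mulr_gt0 ?pi_gt0 ?ltr0n.
have [g [chi [K [g0 K0 dchi chi0 chi1]]]] := gauss_cdf c0.
suff /choice[a ha] : forall j : nat, exists a : csec tau (- N%:Z),
    cls a = dual_basis tau kappa N j /\ forall n v, (0 +i* - 2) * fcoef a n v =
    dual_cst j n * (g * (gauss c (v - n%:~R * t2 / N%:R))%:C).
  by exists g, chi, K, a; split; [split|split=> [j|j n v]; have [] := ha j].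
move=> j.
have m20 : (0 +i* - 2 : C) != 0 by rewrite eq_complex /= eqxx oppr_eq0 pnatr_eq0.
(* The factor w absorbs the - 2 i of [fcoef_deriv] and the trivialization kappa, so that the limits
   at +oo are those asked for by [dual_basisE]. Conjugation negates frequencies, hence the index k =
   - j mod N. *)
pose w : C := g / (kappa * (0 +i* - 2)); pose k := cmod N0 (- j%:Z).
pose th : C -> C := fun z => conjc (theta tau N k z).
pose h : C -> C := fun z => (gauss c (complex.Im z))%:C * th z.
have sth : smooth th by exact: (smooth_conj (H0_smooth _)).
have sh : smooth h by exact: (smoothM (smooth_gauss c) sth).
have sf : smooth (fun z => w * h z) by exact: (smoothM (smooth_cst w) sh).
have hp : hper (fun z => w * h z).
  by move=> z; rewrite /h /th csec_hper; congr (_ * (((gauss c _)%:C) * _)); rewrite ImD addr0.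
have qper z : w * h (z + tau) = w * h z * automorphy tau (- N%:Z) 1 z.
  rewrite -mulrA; congr (_ * _); rewrite /h /th csec_qper conjcM ImD -[RHS]mulrA.
  rewrite mulrCA [RHS]mulrCA; congr (_ * _).
  rewrite !automorphyE conjcM conj_qp conj_ee !mulNr !opprK !mulr1 !intrN !mulNr !opprK mulrN opprK mulrN.
  rewrite expr1n !mulr1; set q := qp _ _; set e := ee _ _.
  have -> : gauss c (complex.Im z) =
    gauss c (complex.Im z + t2) * expR (2 * pi * t2 * N%:~R) * expR (4 * pi * N%:~R * complex.Im z).
    by rewrite /gauss -!expRD /c; congr expR; field.
  by rewrite !mulNr !opprK !rmorphM /=; move: (_%:C) (_%:C) (_%:C) => A B D; ring.
pose a : csec tau (- N%:Z) := CSec (section_mk sf hp qper).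
have fa n v : (0 +i* - 2) * fcoef a n v = dual_cst j n * (g * (gauss c (v - n%:~R * t2 / N%:R))%:C).
  have -> : fcoef a n v = w * fcoef h n v by exact: (fcoefZ w n v sh).
  have -> : fcoef h n v = (gauss c v)%:C * fcoef th n v.
    rewrite /fcoef -cint01Z; last exact: ccont_mulee.
    by apply: eq_cint01 => x _; rewrite mulrA.
  rewrite fcoef_conj; last exact: H0_smooth.
  rewrite theta_fcoef// /theta_coef /dual_cst.
  have -> : (N%:Z %| - n - k%:Z)%Z = (N%:Z %| n - j%:Z)%Z.
    have := cmodP tau_gt0 N0 (- j%:Z) k; rewrite eqxx => jk.
    rewrite (_ : - n - k%:Z = (- j%:Z - k%:Z) - (n - j%:Z)); last by lia.
    by rewrite rpredBl// rpredN.
  case: ifP => _; last by rewrite conjc0 !mulr0 mul0r.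
  rewrite conj_qp mulrNz sqrrN.
  have -> : gauss c (v - n%:~R * t2 / N%:R) = gauss c v * expR (4 * pi * n%:~R * v) *
      expR (- (2 * pi * t2 * (n%:~R ^+ 2 / N%:R))).
    by rewrite /gauss -!expRD /c; congr expR; field; rewrite NR0 t20.
  rewrite !rmorphM /= /w; move: (_%:C) (_%:C) (_%:C) (qp _ _) => A B D E.
  by field; rewrite m20 kappa_neq0.
have da n v : has_deriv (fun v => dual_cst j n * chi (v - n%:~R * t2 / N%:R)) v
      ((0 +i* - 2) * fcoef a n v).
  by rewrite fa; apply: has_derivZ; apply: (has_deriv_shift (f := chi)); exact: dchi.
have lim0 : lim_Ny chi 0.
  by apply: (gauss_lim_Ny c0 K0) => v v0; rewrite subr0; exact: chi0.
have lim1 : lim_Ny (fun v => chi (- v)) 1.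
  apply: (gauss_lim_Ny c0 K0) => v v0; rewrite -cnormN opprB.
  by have := chi1 (- v); rewrite oppr_ge0 /gauss sqrrN; exact.
exists a; split=> //; apply/esym; apply: (dual_basisE tau_gt0 kappa_neq0 N0 da) => n.
- rewrite -[X in lim_Ny _ X](mulr0 (dual_cst j n)); apply: lim_NyZ.
  exact: (lim_Ny_shift (f := chi) (- (n%:~R * t2 / N%:R)) lim0).
- rewrite (_ : (if _ then _ else _) = dual_cst j n * 1); last by rewrite mulr1.
  apply/lim_NyN; apply: lim_NyZ.
  under [X in lim_Ny X]eq_fun do rewrite -opprD.
  exact: (lim_Ny_shift (f := fun v => chi (- v)) (n%:~R * t2 / N%:R) lim1).
Qed.

End DualRepresentative.

(** * The triple Massey product *)

Lemma sum_only (V : nmodType) (I : finType) (F : I -> V) (i0 : I) :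
  (forall i, i != i0 -> F i = 0) -> \sum_i F i = F i0.
Proof. by move=> F0; rewrite (bigD1 i0)//= big1 ?addr0// => i /F0. Qed.

Section ProductSolver.
Variables (R : realType) (tau kappa : R[i]).
Local Notation C := R[i].
Local Notation t2 := (complex.Im tau).
Hypothesis tau_gt0 : 0 < t2.
Variables (N1 N : nat) (N1_gt0 : (0 < N1)%N) (N_gt0 : (0 < N)%N).
Hypothesis N1N : (N1 < N)%N.
Local Notation c := (dual_gauss_rate tau N).
Variables (g : C) (chi : R -> C) (K : R) (a : nat -> csec tau (- N%:Z)).
Hypothesis K_ge0 : 0 <= K.
Hypothesis dchi : forall v, has_deriv chi v (g * (gauss c v)%:C).
Hypothesis chi0 : forall v, v <= 0 -> cnorm (chi v) <= K * gauss c v.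
Hypothesis chi1 : forall v, 0 <= v -> cnorm (1 - chi v) <= K * gauss c v.
Hypothesis fa : forall j n v, (0 +i* - 2) * fcoef (a j) n v =
  dual_cst tau kappa N j n * (g * (gauss c (v - n%:~R * t2 / N%:R))%:C).
Variable E : 'I_N1 -> 'I_N -> C.

Let c_gt0 : 0 < c.
Proof. by rewrite /dual_gauss_rate divr_gt0// !mulr_gt0 ?pi_gt0 ?ltr0n. Qed.

(** Up to kappa^-1, the factor in front of the m-th translate of chi in the p-th primitive of the
    product. As chi tends to 1 at +oo, the sum over m is the obstruction to exactness. *)
Definition prod_weight (p m : int) : C := E (cmod N1_gt0 m) (cmod N_gt0 (p - m)) *
  qp tau (m%:~R ^+ 2 / N1%:R - (p - m)%:~R ^+ 2 / N%:R).

Lemma theta_dual_sum m n :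
  \sum_i \sum_j E i j * (theta_coef tau N1 i m * dual_cst tau kappa N j n) =
  kappa^-1 * (E (cmod N1_gt0 m) (cmod N_gt0 n) *
    qp tau (m%:~R ^+ 2 / N1%:R - n%:~R ^+ 2 / N%:R)).
Proof.
rewrite (sum_only (i0 := cmod N1_gt0 m)); last first.
  move=> i im; apply: big1 => j _.
  by rewrite /theta_coef (cmodP tau_gt0 N1_gt0) (negbTE im) mul0r mulr0.
rewrite (sum_only (i0 := cmod N_gt0 n)); last first.
  by move=> i im; rewrite /dual_cst (cmodP tau_gt0 N_gt0) (negbTE im) !mulr0.
rewrite /theta_coef /dual_cst !(cmodP tau_gt0) !eqxx qpD.
by move: (E _ _) (qp _ _) (qp _ _) => A B D; ring.
Qed.

Definition prod_fun (z : C) : C := \sum_i \sum_j E i j * (a j z * theta tau N1 i z).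

Lemma prod_fcoef p v : has_sum (fun m => kappa^-1 * prod_weight p m *
    (g * (gauss c (v - (p - m)%:~R * t2 / N%:R))%:C))
  ((0 +i* - 2) * fcoef prod_fun p v).
Proof.
have sij (i : 'I_N1) (j : 'I_N) : smooth (fun z => a j z * theta tau N1 i z).
  exact: (smoothM (csec_smooth _) (H0_smooth _)).
have sij' (i : 'I_N1) (j : 'I_N) : smooth (fun z => E i j * (a j z * theta tau N1 i z)).
  exact: (smoothM (smooth_cst _) (sij i j)).
have -> : fcoef prod_fun p v =
    \sum_i \sum_j E i j * fcoef (fun z => a j z * theta tau N1 i z) p v.
  rewrite /prod_fun fcoef_sum; last by move=> i; exact: smooth_sum.
  apply: eq_bigr => i _; rewrite fcoef_sum//.
  by apply: eq_bigr => j _; rewrite fcoefZ.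
rewrite mulr_sumr.
have H (i : 'I_N1) : has_sum (fun m => \sum_j (0 +i* - 2) * (E i j * (theta_coef tau N1 i m * fcoef (a j) (p - m) v)))
    ((0 +i* - 2) * \sum_j E i j * fcoef (fun z => a j z * theta tau N1 i z) p v).
  rewrite mulr_sumr; apply: has_sum_fin => j.
  do 2 apply: has_sumZ; exact: fcoef_mul_theta (csec_smooth _).
apply: has_sum_eq (has_sum_fin _ H) => m.
rewrite /prod_weight -theta_dual_sum mulr_suml; apply: eq_bigr => i _.
rewrite mulr_suml; apply: eq_bigr => j _.
rewrite [LHS]mulrCA [X in _ * X = _]mulrCA fa -[RHS]mulrA; congr (_ * _).
by rewrite -[RHS]mulrA.
Qed.

(** Because N1 < N, the coefficient 1/N1 - 1/N of m^2 in the exponent is positive, and for fixed p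
    the weights decay like a Gaussian in m. *)
Lemma prod_weight_bsum p : bsum (fun m => cnorm (prod_weight p m)).
Proof.
pose al := pi * t2 * (N1%:R^-1 - N%:R^-1); pose be := 2 * pi * t2 * `|p%:~R| / N%:R.
have al0 : 0 < al.
  rewrite /al !mulr_gt0 ?pi_gt0// subr_gt0 ltf_pV2 ?ltr_nat// posrE ltr0n//.
pose Em := \sum_i \sum_j cnorm (E i j).
have Em0 : 0 <= Em by rewrite sumr_ge0// => i _; rewrite sumr_ge0// => j _; exact: cnorm_ge0.
have EE i j : cnorm (E i j) <= Em.
  rewrite /Em (bigD1 i)//= (bigD1 j)//= -addrA lerDl addr_ge0//; first by rewrite sumr_ge0// => *; exact: cnorm_ge0.
  by rewrite sumr_ge0// => ? _; rewrite sumr_ge0// => *; exact: cnorm_ge0.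
apply: bsumW (bsumZ (k := Em * expR (pi * t2 * p%:~R ^+ 2 / N%:R)) _ (bsum_gauss be al0)) _.
  by rewrite mulr_ge0// expR_ge0.
move=> m; rewrite cnorm_ge0 /= cnormM -mulrA; apply: ler_pM; rewrite ?cnorm_ge0//.
rewrite cnorm_qp -expRD ler_expR /al /be intrB real_normK ?num_real//.
have NR0 : (N%:R : R) != 0 by rewrite pnatr_eq0 -lt0n.
have N1R0 : (N1%:R : R) != 0 by rewrite pnatr_eq0 -lt0n.
have h : p%:~R * m%:~R <= `|p%:~R : R| * `|m%:~R| by rewrite -normrM ler_norm.
have h' : 0 <= 2 * pi * t2 / N%:R * (`|p%:~R| * `|m%:~R| + p%:~R * m%:~R).
  apply: mulr_ge0; first by rewrite divr_ge0// !mulr_ge0 ?pi_ge0// ltW.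
  have := ler_norm (- (p%:~R * m%:~R : R)); rewrite normrN normrM; lra.
rewrite -subr_ge0; apply: le_trans h' _; rewrite le_eqVlt; apply/orP; left; apply/eqP.
by field; rewrite NR0.
Qed.

Hypothesis weight0 : forall p, has_sum (prod_weight p) 0.

(** The primitives are series of translates of chi, dominated by the weights. Tannery's theorem at
    both ends gives 0 at -oo and, at +oo, the sum of the weights, which [weight0] makes vanish. *)
Lemma product_solve (M : int) (A : csec tau M) : M < 0 -> (A : C -> C) = prod_fun ->
  exists t : csec tau M, dbar t = A /\ forall p v,
    has_sum (fun m => kappa^-1 * prod_weight p m * chi (v - (p - m)%:~R * t2 / N%:R))
      (fcoef t p v).
Proof.
move=> M0 AE.
have lim0 : lim_Ny chi 0.
  by apply: (gauss_lim_Ny c_gt0 K_ge0) => v v0; rewrite subr0; exact: chi0.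
have lim1 : lim_Ny (fun v => chi (- v)) 1.
  apply: (gauss_lim_Ny c_gt0 K_ge0) => v v0; rewrite -cnormN opprB.
  by have := chi1 (v := - v); rewrite oppr_ge0 /gauss sqrrN; exact.
have bM p (k : R) : 0 <= k -> bsum (fun m => k * cnorm (kappa^-1 * prod_weight p m)).
  move=> k0; have := bsumZ (mulr_ge0 k0 (cnorm_ge0 kappa^-1)) (prod_weight_bsum p).
  by under eq_fun do rewrite -mulrA -cnormM.
pose f p m v := kappa^-1 * prod_weight p m * chi (v - (p - m)%:~R * t2 / N%:R).
have K1 : 0 <= K + 1 by rewrite addr_ge0.
have fM p m v : cnorm (f p m v) <= (K + 1) * cnorm (kappa^-1 * prod_weight p m).
  by rewrite cnormM mulrC ler_wpM2r ?cnorm_ge0// (cnorm_cdf _ (ltW c_gt0) K_ge0 chi0 chi1).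
have hs p v : exists s, has_sum (f p ^~ v) s.
  exact: has_sum_ex (bM p _ K1) (fM p ^~ v).
have exP p : exists Pp : R -> C, forall v, has_sum (f p ^~ v) (Pp v).
  by have [Pp hPp] := choice (hs p); exists Pp.
have [P hP] := choice exP.
have dP p v : has_deriv (P p) v ((0 +i* - 2) * fcoef A p v).
  apply: (has_sum_deriv (bM p _ (cnorm_ge0 g))
    (f' := fun m v => kappa^-1 * prod_weight p m * (g * (gauss c (v - (p - m)%:~R * t2 / N%:R))%:C))
    (f := f p) _ _ (fun t _ => hP p t)).
  - by move=> m t; apply: has_derivZ; apply: (has_deriv_shift (f := chi)); exact: dchi.
  - move=> m t _; rewrite cnormM mulrC ler_wpM2r ?cnorm_ge0// cnormM.
    by rewrite cnorm_real ger0_norm ?gauss_ge0// ler_piMr ?cnorm_ge0// gauss_le1// ltW.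
  - by rewrite AE; exact: prod_fcoef.
have P0 p : lim_Ny (P p) 0.
  apply: (has_sum_lim_Ny (bM p _ K1) (fM p) _ (hP p) (@has_sum0 R _)) => m.
  rewrite -[X in lim_Ny _ X](mulr0 (kappa^-1 * prod_weight p m)); apply: lim_NyZ.
  exact: (lim_Ny_shift (f := chi) (- ((p - m)%:~R * t2 / N%:R)) lim0).
have P1 p : lim_y (P p) 0.
  have s0 : has_sum (fun m => kappa^-1 * prod_weight p m * 1) 0.
    by rewrite -(mulr0 kappa^-1); apply: has_sum_eq (has_sumZ kappa^-1 (weight0 p)) => m; rewrite mulr1.
  apply/lim_NyN.
  apply: (has_sum_lim_Ny (bM p _ K1) (fun m v => fM p m (- v)) _ (fun v => hP p (- v)) s0) => m.
  apply: lim_NyZ; under [X in lim_Ny X]eq_fun do rewrite -opprD.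
  exact: (lim_Ny_shift (f := fun v => chi (- v)) ((p - m)%:~R * t2 / N%:R) lim1).
have [t [dt ft]] := dbar_solve tau_gt0 M0 dP P0 P1.
by exists t; split=> // p v; rewrite ft; exact: hP.
Qed.

End ProductSolver.

(** * Uniqueness of the Massey value *)

Section MasseyUniqueness.
Variables (R : realType) (tau : R[i]).
Local Notation C := R[i].
Hypothesis tau_gt0 : 0 < complex.Im tau.

Lemma csec_addE (N : int) (s t : csec tau N) w : (s + t) w = s w + t w.
Proof. by []. Qed.

Lemma csec_scaleE (N : int) (k : C) (s : csec tau N) w : (k *: s) w = k * s w.
Proof. by []. Qed.

Lemma csec_sumE (N : int) (I : finType) (s : I -> csec tau N) w :
  (\sum_i s i) w = \sum_i s i w.
Proof. by elim/big_ind2: _ => // x1 y1 x2 y2 <- <-. Qed.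

Lemma H0_addE (N : int) (s t : H0 tau N) w : (s + t) w = s w + t w.
Proof. by []. Qed.

Lemma H0_scaleE (N : int) (k : C) (s : H0 tau N) w : (k *: s) w = k * s w.
Proof. by []. Qed.

Lemma csec_eqP (N : int) (s t : csec tau N) : (forall w, s w = t w) -> s = t.
Proof. by move=> st; apply/val_inj/funext. Qed.

Lemma dbar_inj (N : int) : N < 0 -> injective (@dbar R tau N).
Proof.
move=> N0 s t st; have h : s - t \in @is_holomorphic R tau N.
  by apply/eqP; rewrite linearB /= st subrr.
have := H0_neg tau_gt0 (HolSec h) N0 => e.
apply: csec_eqP => w; apply/eqP; rewrite -subr_eq0; apply/eqP.
exact: (congr1 (fun f : C -> C => f w) e).
Qed.

Lemma clsZ (N : int) (k : C) (s : csec tau N) : cls (k *: s) = k *: cls s.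
Proof. by rewrite -H1_scale_cls. Qed.

Lemma cls_dbar (N : int) (t : csec tau N) : cls (dbar t) = 0.
Proof.
have <- : cls (0 : csec tau N) = 0.
  by apply: (addrI (cls (0 : csec tau N))); rewrite -clsD !addr0.
by apply/cls_eq; exists t; rewrite subr0.
Qed.

Lemma bilinear_eval_r (N M : int) (w : C) :
  bilinear_map (fun (s : csec tau N) (z : H0 tau M) => z w *: s).
Proof.
split=> [z k s t|s k y z]; first by rewrite scalerDr !scalerA mulrC.
by rewrite H0_addE H0_scaleE scalerDl scalerA.
Qed.

Lemma bilinear_eval_l (N M : int) (w : C) :
  bilinear_map (fun (z : H0 tau M) (s : csec tau N) => z w *: s).
Proof.
split=> [s k y z|z k s t]; last by rewrite scalerDr !scalerA mulrC.
by rewrite H0_addE H0_scaleE scalerDl scalerA.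
Qed.

Lemma dbar_hol_mul (N M : int) (v : H0 tau N) (q : csec tau M) w :
  dbar (csec_mul v q) w = v w * dbar q w.
Proof.
rewrite /= dzbarM; [|exact/smooth_cderivable/H0_smooth|exact/smooth_cderivable/csec_smooth].
by rewrite dbar_H0 mul0r add0r.
Qed.

Lemma dbar_mul_hol (N M : int) (v : H0 tau N) (q : csec tau M) w :
  dbar (csec_mul q v) w = dbar q w * v w.
Proof.
rewrite /= dzbarM; [|exact/smooth_cderivable/csec_smooth|exact/smooth_cderivable/H0_smooth].
by rewrite dbar_H0 mulr0 addr0.
Qed.

Section Values.
Variables (d1 d2 d : int) (I : finType).
Variables (x : I -> H0 tau d1) (y : I -> H1 tau (- d)) (z : I -> H0 tau d2).
Hypothesis d1d : d1 - d < 0.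
Hypothesis d2d : - d + d2 < 0.

(** Composing a bilinear map with [cls] kills the exact factors d-bar t_j and d-bar s_k, so the data
    defining a Massey value already witness membership in K. *)
Lemma massey_value_in_K r : is_massey_value x y z r -> in_K x y z.
Proof.
move=> [yt [yty [J [J' [t [z' [x' [s [H1 H2 _]]]]]]]]]; split=> W B [Bl Br].
  have := H1 W (fun u v => B (cls u) v) _.
  under eq_bigr do rewrite -m2l_cls yty; move=> ->; last first.
    split=> [v k u u'|u]; last exact: Br.
    by rewrite clsD clsZ; exact: Bl.
  apply: big1 => j _; rewrite cls_dbar.
  by have := Bl (z' j) (- 1) 0 0; rewrite scaler0 addr0 scaleN1r addNr.
have := H2 W (fun u v => B u (cls v)) _.
under eq_bigr do rewrite -m2r_cls yty; move=> ->; last first.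
  split=> [v|u k v v']; first exact: Bl.
  by rewrite clsD clsZ; exact: Br.
apply: big1 => j _; rewrite cls_dbar.
by have := Br (x' j) (- 1) 0 0; rewrite scaler0 addr0 scaleN1r addNr.
Qed.

(* The tensor identities are tested on the bilinear maps (s, z) |-> z(w) s, after
   which the injectivity of d-bar in negative degree determines r at w. *)
Lemma massey_value_unique r r' :
  is_massey_value x y z r -> is_massey_value x y z r' -> r = r'.
Proof.
move=> [yt [yty [J [J' [t [z' [x' [s [H1 H2 H3]]]]]]]]].
move=> [yt2 [yty2 [J2 [J2' [t2 [z2 [x2 [s2 [G1 G2 G3]]]]]]]]].
have /choice[u hu] p : exists u, yt2 p - yt p = dbar u.
  by apply/cls_eq; rewrite yty2 yty.
have ytE p w : yt2 p w = yt p w + dbar (u p) w.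
  by rewrite -hu csec_addE addrC -[(- yt p) w]/(- yt p w) subrK.
(* Replacing the representatives by yt + d-bar u changes both sums in r by the same section, the sum
   of the x u z, which cancels in the difference. *)
have E1 w : \sum_j t2 j w * z2 j w = \sum_j t j w * z' j w + \sum_p x p w * u p w * z p w.
  have A : \sum_j z2 j w *: t2 j = \sum_j z' j w *: t j + \sum_p z p w *: csec_mul (x p) (u p).
    apply: (dbar_inj d1d); rewrite linearD !linear_sum /=.
    under eq_bigr do rewrite linearZ; under [in RHS]eq_bigr do rewrite linearZ.
    under [X in _ = _ + X]eq_bigr do rewrite linearZ /=.
    rewrite /= -(G1 _ _ (bilinear_eval_r _ _ w)) -(H1 _ _ (bilinear_eval_r _ _ w)) -big_split /=.
    apply: eq_bigr => p _; apply: csec_eqP => w'.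
    rewrite csec_addE !csec_scaleE dbar_hol_mul /= -mulrDr; congr (_ * _).
    by rewrite -[LHS]/(x p w' * yt2 p w') ytE mulrDr.
  have := congr1 (fun q : csec tau (d1 - d) => q w) A; rewrite csec_addE !csec_sumE.
  under eq_bigr do rewrite csec_scaleE mulrC; move=> ->; congr (_ + _).
    by apply: eq_bigr => j _; rewrite csec_scaleE mulrC.
  by apply: eq_bigr => j _; rewrite csec_scaleE mulrC.
have E2 w : \sum_j x2 j w * s2 j w = \sum_j x' j w * s j w + \sum_p x p w * u p w * z p w.
  have A : \sum_j x2 j w *: s2 j = \sum_j x' j w *: s j + \sum_p x p w *: csec_mul (u p) (z p).
    apply: (dbar_inj d2d); rewrite linearD !linear_sum /=.
    under eq_bigr do rewrite linearZ; under [in RHS]eq_bigr do rewrite linearZ.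
    under [X in _ = _ + X]eq_bigr do rewrite linearZ /=.
    rewrite /= -(G2 _ _ (bilinear_eval_l _ _ w)) -(H2 _ _ (bilinear_eval_l _ _ w)) -big_split /=.
    apply: eq_bigr => p _; apply: csec_eqP => w'.
    rewrite csec_addE !csec_scaleE dbar_mul_hol /= -mulrDr; congr (_ * _).
    by rewrite -[LHS]/(yt2 p w' * z p w') ytE mulrDl.
  have := congr1 (fun q : csec tau (- d + d2) => q w) A; rewrite csec_addE !csec_sumE.
  under eq_bigr do rewrite csec_scaleE; move=> ->; congr (_ + _).
  by apply: eq_bigr => j _; rewrite csec_scaleE -mulrA.
apply/val_inj/csec_eqP => w; rewrite [LHS]H3 [RHS]G3 E1 E2.
by rewrite opprD addrACA subrr addr0.
Qed.

Lemma masseyE r : is_massey_value x y z r -> massey x y z = r.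
Proof. by move=> hr; apply: xget_unique => // r' /massey_value_unique; exact. Qed.

End Values.
End MasseyUniqueness.

(** * The estimate behind absolute convergence *)

Section CdfDomination.
Variable R : realType.
Local Notation C := R[i].
Variables (c K : R) (chi : R -> C).
Hypothesis c_gt0 : 0 < c.
Hypothesis K_ge0 : 0 <= K.
Hypothesis chi0 : forall v, v <= 0 -> cnorm (chi v) <= K * gauss c v.
Hypothesis chi1 : forall v, 0 <= v -> cnorm (1 - chi v) <= K * gauss c v.

(* The indefinite exponent is compensated by the Gaussian tail of [chi] when
   Z and Z + O have the same sign; when they do not, [(Z + O) ^+ 2 <= O ^+ 2]. *)
Lemma cdf_dom (q h al be ga de Z O : R) (b : bool) :
  0 <= q -> 0 < h -> 0 <= ga -> 0 <= de -> c * h ^+ 2 = 2 * q * ga -> ga + de <= al -> ga + de <= be ->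
  (if b then 0 <= Z else Z <= 0) ->
  expR (- (q * (al * Z ^+ 2 + be * O ^+ 2 - ga * (Z + O) ^+ 2))) *
    cnorm (chi (h * (Z + O)) - b%:R) <=
  (K + 2) * (expR (- (q * de * Z ^+ 2)) * expR (- (q * de * O ^+ 2))).
Proof.
move=> q0 h0 ga0 de0 ch gal gbe bZ.
have ZO0 : 0 <= Z ^+ 2 /\ 0 <= O ^+ 2 by rewrite !sqr_ge0.
have [Z0 O0] := ZO0.
have same : cnorm (chi (h * (Z + O)) - b%:R) <= K * gauss c (h * (Z + O)) ->
    expR (- (q * (al * Z ^+ 2 + be * O ^+ 2 - ga * (Z + O) ^+ 2))) *
    cnorm (chi (h * (Z + O)) - b%:R) <=
    (K + 2) * (expR (- (q * de * Z ^+ 2)) * expR (- (q * de * O ^+ 2))).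
  move=> hb; apply: le_trans (ler_wpM2l (expR_ge0 _) hb) _.
  rewrite mulrCA; apply: ler_pM; rewrite ?mulr_ge0 ?expR_ge0//; first by rewrite lerDl.
  (* By [ch] the tail is exp (- 2 q ga (Z + O)^2): half of it already cancels the indefinite term of
     the exponent. *)
  rewrite /gauss exprMn [c * _]mulrA ch -!expRD ler_expR.
  have h1 : 0 <= (al - de) * Z ^+ 2 by rewrite mulr_ge0//; lra.
  have h2 : 0 <= (be - de) * O ^+ 2 by rewrite mulr_ge0//; lra.
  have h3 : 0 <= ga * (Z + O) ^+ 2 by rewrite mulr_ge0// sqr_ge0.
  have := mulr_ge0 q0 h1; have := mulr_ge0 q0 h2; have := mulr_ge0 q0 h3; lra.
have opp : (Z + O) ^+ 2 <= O ^+ 2 ->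
    expR (- (q * (al * Z ^+ 2 + be * O ^+ 2 - ga * (Z + O) ^+ 2))) *
    cnorm (chi (h * (Z + O)) - b%:R) <=
    (K + 2) * (expR (- (q * de * Z ^+ 2)) * expR (- (q * de * O ^+ 2))).
  move=> ZO; rewrite mulrC -expRD; apply: ler_pM; rewrite ?cnorm_ge0 ?expR_ge0//.
    apply: le_trans (cnormB _ _) _; rewrite (_ : 2 = 1 + 1)// addrA; apply: lerD.
      exact: (cnorm_cdf _ (ltW c_gt0) K_ge0 chi0 chi1).
    by case: (b); rewrite ?cnorm1 ?cnorm0.
  rewrite ler_expR.
  have h1 : 0 <= (al - de) * Z ^+ 2 by rewrite mulr_ge0//; lra.
  have h2 : 0 <= (be - de - ga) * O ^+ 2 by rewrite mulr_ge0//; lra.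
  have h3 : 0 <= ga * (O ^+ 2 - (Z + O) ^+ 2) by rewrite mulr_ge0// subr_ge0.
  have := mulr_ge0 q0 h1; have := mulr_ge0 q0 h2; have := mulr_ge0 q0 h3; lra.
case: b bZ same opp => bZ same opp; have [zo|zo] := leP 0 (Z + O).
- by apply: same; rewrite -cnormN opprB; apply: chi1; rewrite mulr_ge0// ltW.
- by apply: opp; nra.
- by apply: opp; nra.
- by apply: same; rewrite subr0; apply: chi0; rewrite mulr_ge0_le0// ltW.
Qed.

End CdfDomination.

Section TripleSums.
Variables (V : nmodType) (I J K : finType) (F : I -> J -> K -> V).

Lemma sum_triple_k : \sum_(p : I * J * K) F p.1.1 p.1.2 p.2 = \sum_k \sum_i \sum_j F i j k.
Proof.
rewrite -(pair_bigA _ (fun (p : I * J) k => F p.1 p.2 k)) exchange_big.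
by apply: eq_bigr => k _; rewrite -(pair_bigA _ (fun i j => F i j k)).
Qed.

Lemma sum_triple_i : \sum_(p : I * J * K) F p.1.1 p.1.2 p.2 = \sum_i \sum_k \sum_j F i j k.
Proof. by rewrite sum_triple_k exchange_big. Qed.

End TripleSums.

Section LinearSums.
Variables (K : fieldType) (U V : lmodType K) (f : U -> V).
Hypothesis f_lin : linear f.

Lemma linear_prop0 : f 0 = 0.
Proof. by have := f_lin (- 1) 0 0; rewrite scaler0 addr0 scaleN1r addNr. Qed.

Lemma linear_prop_sum (I : finType) (u : I -> U) : f (\sum_i u i) = \sum_i f (u i).
Proof.
apply: (big_morph f) => [x y|]; last exact: linear_prop0.
by have := f_lin 1 x y; rewrite !scale1r.
Qed.

End LinearSums.

(** * Explicit solutions for a tensor with vanishing weights *)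

Section MasseyValue.
Variables (R : realType) (kappa : R[i]).
Local Notation C := R[i].
Hypothesis kappa_neq0 : kappa != 0.
Variables (d d1 d2 : nat).
Hypotheses (d_gt0 : (0 < d)%N) (d1_gt0 : (0 < d1)%N) (d2_gt0 : (0 < d2)%N).
Hypotheses (d1d : (d1 < d)%N) (d2d : (d2 < d)%N) (dd : (d < d1 + d2)%N).
Variable cc : 'I_d1 -> 'I_d -> 'I_d2 -> C.

(** Degrees such as d1 - d + d2 and d1 + d2 - d are equal but not convertible; it suffices to
    transport the underlying function. *)
Lemma csec_cast (tau : C) (N N' : int) (s : csec tau N) : N = N' ->
  exists s' : csec tau N', (s' : C -> C) = s.
Proof. by move=> <-; exists s. Qed.

Lemma fcoefB (f h : C -> C) n v : smooth f -> smooth h ->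
  fcoef (fun z => f z - h z) n v = fcoef f n v - fcoef h n v.
Proof.
move=> sf sh; have sh' : smooth (fun z => - 1 * h z) by exact: (smoothM (smooth_cst _) sh).
have -> : (fun z => f z - h z) = (fun z => f z + - 1 * h z).
  by apply/funext => z; rewrite mulN1r.
by rewrite (fcoefD _ _ sf sh') (fcoefZ _ _ _ sh) mulN1r.
Qed.

Section FixedTau.
Variable tau : C.
Local Notation t2 := (complex.Im tau).
Hypothesis tau_gt0 : 0 < t2.
Hypothesis weight1 : forall (k : 'I_d2) p,
  has_sum (prod_weight tau d1_gt0 d_gt0 (fun i j => cc i j k) p) 0.
Hypothesis weight2 : forall (i : 'I_d1) p,
  has_sum (prod_weight tau d2_gt0 d_gt0 (fun k j => cc i j k) p) 0.
Local Notation rate := (dual_gauss_rate tau d).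

(** Grouping the tensor by its last factor gives one d-bar equation for each k, and by its first
    factor one for each i; [product_solve] solves them with the same chi. The two sums of products
    have equal d-bar, so their difference r is holomorphic. *)
Lemma massey_value_ex : exists (chi : R -> C) (K : R)
    (t : 'I_d2 -> csec tau (d1%:Z + - d%:Z)) (s : 'I_d1 -> csec tau (- d%:Z + d2%:Z))
    (r : H0 tau (d1%:Z + d2%:Z - d%:Z)),
  [/\ 0 <= K, forall v, v <= 0 -> cnorm (chi v) <= K * gauss rate v &
      forall v, 0 <= v -> cnorm (1 - chi v) <= K * gauss rate v] /\
  [/\ is_massey_value (massey_x cc tau) (massey_y kappa tau) (massey_z tau) r,
      forall k p v, has_sum (fun m => kappa^-1 *
        prod_weight tau d1_gt0 d_gt0 (fun i j => cc i j k) p m *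
        chi (v - (p - m)%:~R * t2 / d%:R)) (fcoef (t k) p v),
      forall i p v, has_sum (fun m => kappa^-1 *
        prod_weight tau d2_gt0 d_gt0 (fun k j => cc i j k) p m *
        chi (v - (p - m)%:~R * t2 / d%:R)) (fcoef (s i) p v)
    & forall w, r w = \sum_(k < d2) t k w * theta tau d2 k w - \sum_(i < d1) theta tau d1 i w * s i w].
Proof.
have [g [chi [K [a [[K0 dchi chi0 chi1] [acls fa]]]]]] := dual_rep tau_gt0 kappa_neq0 d_gt0.
exists chi, K.
have M1 : d1%:Z + - d%:Z < 0 by rewrite subr_lt0 ltz_nat.
have M2 : - d%:Z + d2%:Z < 0 by rewrite addrC subr_lt0 ltz_nat.
pose A k : csec tau (d1%:Z + - d%:Z) := \sum_(i < d1) \sum_(j < d) cc i j k *: csec_mul (theta tau d1 i) (a j).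
pose B i : csec tau (- d%:Z + d2%:Z) := \sum_(k < d2) \sum_(j < d) cc i j k *: csec_mul (a j) (theta tau d2 k).
have AE k : (A k : C -> C) = prod_fun a (fun i j => cc i j k).
  apply/funext => z; rewrite /A /prod_fun csec_sumE; apply: eq_bigr => i _.
  rewrite csec_sumE; apply: eq_bigr => j _; rewrite csec_scaleE; congr (_ * _).
  exact: mulrC.
have BE i : (B i : C -> C) = prod_fun a (fun k j => cc i j k).
  apply/funext => z; rewrite /B /prod_fun csec_sumE; apply: eq_bigr => k _.
  by rewrite csec_sumE; apply: eq_bigr => j _; rewrite csec_scaleE.
have [t ht] := choice (fun k => product_solve tau_gt0 d1d K0 dchi chi0 chi1 fa (weight1 k) M1 (AE k)).
have [s hs] := choice (fun i => product_solve tau_gt0 d2d K0 dchi chi0 chi1 fa (weight2 i) M2 (BE i)).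
have [r1 r1E] : exists r1 : csec tau (d1%:Z + d2%:Z - d%:Z),
    (r1 : C -> C) = \sum_(k < d2) csec_mul (t k) (theta tau d2 k).
  by apply: csec_cast; rewrite addrAC.
have [r2 r2E] : exists r2 : csec tau (d1%:Z + d2%:Z - d%:Z),
    (r2 : C -> C) = \sum_(i < d1) csec_mul (theta tau d1 i) (s i).
  by apply: csec_cast; rewrite [- _ + _]addrC addrA.
have rhol : r1 - r2 \in @is_holomorphic R tau (d1%:Z + d2%:Z - d%:Z).
  apply/eqP; rewrite linearB; apply/eqP; rewrite subr_eq0; apply/eqP; apply: csec_eqP => w.
  have -> : dbar r1 w = dbar (\sum_(k < d2) csec_mul (t k) (theta tau d2 k)) w by rewrite /= r1E.
  have -> : dbar r2 w = dbar (\sum_(i < d1) csec_mul (theta tau d1 i) (s i)) w by rewrite /= r2E.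
  rewrite !linear_sum !csec_sumE.
  transitivity (\sum_(k < d2) \sum_(i < d1) \sum_(j < d) cc i j k * (theta tau d1 i w * a j w) * theta tau d2 k w).
    apply: eq_bigr => k _; rewrite dbar_mul_hol (ht k).1 /A csec_sumE mulr_suml.
    apply: eq_bigr => i _; rewrite csec_sumE mulr_suml.
    by apply: eq_bigr => j _; rewrite csec_scaleE.
  rewrite exchange_big; apply: eq_bigr => i _; rewrite dbar_hol_mul (hs i).1 /B csec_sumE mulr_sumr.
  apply: eq_bigr => k _; rewrite csec_sumE mulr_sumr.
  apply: eq_bigr => j _; rewrite csec_scaleE.
  rewrite -[csec_mul _ _ w]/(a j w * theta tau d2 k w).
  by move: (cc _ _ _) (theta _ _ _ w) (a j w) (theta _ _ _ w) => x1 x2 x3 x4; ring.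
exists t, s, (HolSec rhol); split; first by [].
have rE w : (r1 - r2) w = \sum_(k < d2) t k w * theta tau d2 k w - \sum_(i < d1) theta tau d1 i w * s i w.
  rewrite csec_addE -[(- r2) w]/(- (r2 w)) r1E r2E !csec_sumE.
  by congr (_ - _); apply: eq_bigr.
split=> [|k|i|//]; [|exact: (ht k).2|exact: (hs i).2].
exists (fun p : 'I_d1 * 'I_d * 'I_d2 => a p.1.2); split; first by move=> p; exact: acls.
exists 'I_d2, 'I_d1, t, (fun k : 'I_d2 => theta tau d2 k), (fun i : 'I_d1 => theta tau d1 i), s.
split=> [W Bi [Bl Br]|W Bi [Bl Br]|//].
  rewrite (sum_triple_k (fun i j k => Bi (csec_mul (cc i j k *: theta tau d1 i) (a j)) (theta tau d2 k))).
  apply: eq_bigr => k _; rewrite (ht k).1 /A (linear_prop_sum (Bl _)).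
  apply: eq_bigr => i _; rewrite (linear_prop_sum (Bl _)).
  apply: eq_bigr => j _; congr (Bi _ _); apply: csec_eqP => w.
  by rewrite csec_scaleE mulrA.
rewrite (sum_triple_i (fun i j k => Bi (cc i j k *: theta tau d1 i) (csec_mul (a j) (theta tau d2 k)))).
apply: eq_bigr => i _; rewrite (hs i).1 /B (linear_prop_sum (Br _)).
apply: eq_bigr => k _; rewrite (linear_prop_sum (Br _)).
apply: eq_bigr => j _.
have sc (k0 : C) u v : Bi (k0 *: u) v = Bi u (k0 *: v).
  have := Bl v k0 u 0; rewrite (linear_prop0 (Bl v)) !addr0 => ->.
  by have := Br u k0 v 0; rewrite (linear_prop0 (Br u)) !addr0 => ->.
exact: sc.
Qed.

End FixedTau.
End MasseyValue.

(** * Coefficients of the Massey product as indefinite series *)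

Section MasseySeries.
Variables (R : realType) (kappa tau : R[i]).
Local Notation C := R[i].
Local Notation t2 := (complex.Im tau).
Hypothesis tau_gt0 : 0 < t2.
Hypothesis kappa_neq0 : kappa != 0.
Variable d : nat.
Hypothesis d_gt0 : (0 < d)%N.

(* The iterated sum giving the coefficient need not converge as a double sum; since
   the inner sums of the weights vanish, [chi] may be replaced by [chi - b l],
   which makes the double sum absolutely convergent for a suitable sign b. *)
Lemma iterated_coef (n1 n2 : nat) (n1_gt0 : (0 < n1)%N) (n2_gt0 : (0 < n2)%N)
    (E : 'I_n2 -> 'I_n1 -> 'I_d -> C) (t : 'I_n2 -> C -> C) (chi : R -> C)
    (s : int) (v : R) (b : int -> bool) (Mb : int * int -> R) :
  let x l m := qp tau (l%:~R ^+ 2 / n2%:R) *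
    (kappa^-1 * prod_weight tau n1_gt0 d_gt0 (E (cmod n2_gt0 l)) (s - l) m *
      (chi (v - (s - l - m)%:~R * t2 / d%:R) - (b l)%:R)) in
  (forall k, smooth (t k)) ->
  (forall k p, has_sum (prod_weight tau n1_gt0 d_gt0 (E k) p) 0) ->
  (forall k p, has_sum (fun m => kappa^-1 * prod_weight tau n1_gt0 d_gt0 (E k) p m *
      chi (v - (p - m)%:~R * t2 / d%:R)) (fcoef (t k) p v)) ->
  bsum Mb -> (forall l m, cnorm (x l m) <= Mb (l, m)) ->
  has_sum (fun p : int * int => x p.1 p.2)
    (fcoef (fun w => \sum_(k < n2) t k w * theta tau n2 k w) s v).
Proof.
move=> x st w0 ft bM xM.
have [T hT] : exists T, has_sum (fun p : int * int => x p.1 p.2) T.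
  by apply: (has_sum_ex bM) => -[l m]; exact: xM.
pose r l := qp tau (l%:~R ^+ 2 / n2%:R) * fcoef (t (cmod n2_gt0 l)) (s - l) v.
have hr : has_sum r (fcoef (fun w => \sum_(k < n2) t k w * theta tau n2 k w) s v).
  rewrite fcoef_sum; last by move=> k; exact: (smoothM (st k) (H0_smooth _)).
  have H (k : 'I_n2) := fcoef_mul_theta tau_gt0 n2_gt0 k s v (st k).
  apply: has_sum_eq (has_sum_fin _ H) => l.
  rewrite (sum_only (i0 := cmod n2_gt0 l)); last first.
    by move=> k kl; rewrite /theta_coef (cmodP tau_gt0 n2_gt0) (negbTE kl) mul0r.
  by rewrite /theta_coef (cmodP tau_gt0 n2_gt0) eqxx.
have hx l : has_sum (x l) (r l).
  have hz := has_sumB (ft (cmod n2_gt0 l) (s - l))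
    (has_sumZ ((b l)%:R * kappa^-1) (w0 (cmod n2_gt0 l) (s - l))).
  rewrite mulr0 subr0 in hz; apply: has_sumZ; apply: has_sum_eq hz => m.
  by rewrite [RHS]mulrBr [X in _ = _ - X]mulrC [X in _ = _ - X]mulrA.
by rewrite (has_sum_unique hr (has_sum_fubini bM xM hx hT)).
Qed.

Variables (d1 d2 : nat).
Hypotheses (d1_gt0 : (0 < d1)%N) (d2_gt0 : (0 < d2)%N).
Hypotheses (d1d : (d1 < d)%N) (d2d : (d2 < d)%N) (dd : (d < d1 + d2)%N).
Variable cc : 'I_d1 -> 'I_d -> 'I_d2 -> C.
Hypothesis weight1 : forall (k : 'I_d2) p,
  has_sum (prod_weight tau d1_gt0 d_gt0 (fun i j => cc i j k) p) 0.
Hypothesis weight2 : forall (i : 'I_d1) p,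
  has_sum (prod_weight tau d2_gt0 d_gt0 (fun k j => cc i j k) p) 0.

Local Notation d0 := (d1 + d2 - d)%N.
Let d0_gt0 : (0 < d0)%N. Proof. by rewrite subn_gt0. Qed.
Let D0E : d%:R = d1%:R + d2%:R - d0%:R :> R.
Proof. by rewrite natrB ?(ltnW dd)// natrD; ring. Qed.
Let D_gt0 : 0 < d%:R :> R. Proof. by rewrite ltr0n. Qed.
Let D0_gt0 : 0 < d0%:R :> R. Proof. by rewrite ltr0n. Qed.
Let D1_gt0 : 0 < d1%:R :> R. Proof. by rewrite ltr0n. Qed.
Let D2_gt0 : 0 < d2%:R :> R. Proof. by rewrite ltr0n. Qed.

(** For e = d1 or d2, this is d0 times the displacement of m from the coordinate s e / d0 of the
    critical point of the exponent, scaled to stay integral. *)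
Definition shift_idx (e : nat) (s m : int) : int := d0%:Z * m - s * e%:Z.
Local Notation X s m := (shift_idx d1 s m).
Local Notation Y s l := (shift_idx d2 s l).

Definition massey_form (x y : R) : R :=
  (x ^+ 2 / d1%:R + y ^+ 2 / d2%:R - (x + y) ^+ 2 / d%:R) / d0%:R ^+ 2.

Definition massey_term (s m l : int) : C :=
  kappa^-1 * cc (cmod d1_gt0 m) (cmod d_gt0 (s - m - l)) (cmod d2_gt0 l) *
  qp tau (massey_form (X s m)%:~R (Y s l)%:~R).

Let XR s m : (X s m)%:~R = d0%:R * m%:~R - s%:~R * d1%:R :> R.
Proof. by rewrite /shift_idx intrB !intrM. Qed.
Let YR s m : (Y s m)%:~R = d0%:R * m%:~R - s%:~R * d2%:R :> R.
Proof. by rewrite /shift_idx intrB !intrM. Qed.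

(** Expansion of the exponent at its critical point, where its value is s^2/d0; this value is
    removed by the normalization of F_{d0,s}, see [coefE]. *)
Lemma massey_formE (s m l : int) : massey_form (X s m)%:~R (Y s l)%:~R =
  m%:~R ^+ 2 / d1%:R + l%:~R ^+ 2 / d2%:R - (s - m - l)%:~R ^+ 2 / d%:R - s%:~R ^+ 2 / d0%:R.
Proof.
rewrite /massey_form XR YR !intrB; have := gt_eqF D_gt0; rewrite D0E => /negbT Dn.
by field; rewrite Dn !gt_eqF.
Qed.

Let Em := \sum_i \sum_j \sum_k cnorm (cc i j k).
Let ccE i j k : cnorm (cc i j k) <= Em.
Proof.
rewrite /Em (bigD1 i)//= (bigD1 j)//= (bigD1 k)//= -!addrA lerDl.
by rewrite !addr_ge0// sumr_ge0// => ? _; rewrite ?sumr_ge0// => *; rewrite ?sumr_ge0// => *; exact: cnorm_ge0.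
Qed.
Let Em_ge0 : 0 <= Em.
Proof. by do 3 (apply: sumr_ge0 => ? _); exact: cnorm_ge0. Qed.

Lemma massey_series (s : 'I_d0) :
  in_K (massey_x cc tau) (massey_y kappa tau) (massey_z tau) /\
  has_sum (fun p : int * int => massey_term (s : nat)%:Z p.1 p.2 *
      ((0 <= X (s : nat)%:Z p.1)%R%:R - (0 < Y (s : nat)%:Z p.2)%R%:R)) (MP kappa cc s tau).
Proof.
have [chi [K [t [u [r [[K0 chi0 chi1] [rV ft fu rE]]]]]]] :=
  massey_value_ex kappa_neq0 d1d d2d tau_gt0 weight1 weight2.
split; first exact: massey_value_in_K rV.
have M1 : d1%:Z - d%:Z < 0 by rewrite subr_lt0 ltz_nat.
have M2 : - d%:Z + d2%:Z < 0 by rewrite addrC subr_lt0 ltz_nat.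
rewrite /MP (masseyE tau_gt0 M1 M2 rV).
set S : int := (s : nat)%:Z.
pose q := pi * t2 / d0%:R ^+ 2; pose h := t2 / (d0%:R * d%:R).
(* The margin left by d1 < d and d2 < d; it becomes the rate of the Gaussian majorant in X and in
   Y. *)
pose de := Num.min (d1%:R^-1 - d%:R^-1) (d2%:R^-1 - d%:R^-1) : R.
have q0 : 0 < q by rewrite /q divr_gt0 ?exprn_gt0// mulr_gt0 ?pi_gt0.
have h0 : 0 < h by rewrite /h divr_gt0// mulr_gt0.
have de0 : 0 < de by rewrite /de lt_min !subr_gt0 !ltf_pV2 ?posrE// !ltr_nat d1d.
have de1 : d%:R^-1 + de <= d1%:R^-1.
  by rewrite addrC -lerBrDr /de ge_min lexx.
have de2 : d%:R^-1 + de <= d2%:R^-1.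
  by rewrite addrC -lerBrDr /de ge_min lexx orbT.
have ga0 : 0 <= d%:R^-1 :> R by rewrite invr_ge0 ltW.
have ch : dual_gauss_rate tau d * h ^+ 2 = 2 * q * d%:R^-1.
  by rewrite /dual_gauss_rate /h /q; field; rewrite !gt_eqF.
have c0 : 0 < dual_gauss_rate tau d.
  by rewrite /dual_gauss_rate divr_gt0// !mulr_gt0 ?pi_gt0.
(* A coefficient of a holomorphic section may be computed at any height; at this one the argument of
   chi is the homogeneous form h (X + Y). *)
pose v : R := - (S%:~R * t2 / d0%:R).
have arg m l : v - (S - m - l)%:~R * t2 / d%:R = h * ((X S m)%:~R + (Y S l)%:~R).
  rewrite XR YR !intrB /v /h; have := gt_eqF D_gt0; rewrite D0E => /negbT Dn.
  by field; rewrite Dn gt_eqF.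
pose W m l := qp tau (S%:~R ^+ 2 / d0%:R) * massey_term S m l.
pose Mb (p : int * int) := cnorm kappa^-1 * Em * (K + 2) *
  (expR (- (q * de * (X S p.1)%:~R ^+ 2)) * expR (- (q * de * (Y S p.2)%:~R ^+ 2))).
have bX (e : nat) : bsum (fun m => expR (- (q * de * (shift_idx e S m)%:~R ^+ 2)) : R).
  have qd : 0 < q * de by rewrite mulr_gt0.
  have inj : injective (shift_idx e S).
    by move=> m m' /addIr /mulfI; apply; rewrite eqz_nat -lt0n.
  apply: (bsumW (bsum_comp inj (bsum_gauss 0 qd))) => m.
  by rewrite expR_ge0 /= mul0r addr0 real_normK ?num_real.
have bM : bsum Mb.
  apply: bsumZ (bsum_pair (bX d1) (bX d2)).
  by rewrite !mulr_ge0 ?cnorm_ge0// addr_ge0.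
have WM m l (b : C) : expR (- (q * (d1%:R^-1 * (X S m)%:~R ^+ 2 + d2%:R^-1 * (Y S l)%:~R ^+ 2 -
     d%:R^-1 * ((X S m)%:~R + (Y S l)%:~R) ^+ 2))) * cnorm b <= (K + 2) *
     (expR (- (q * de * (X S m)%:~R ^+ 2)) * expR (- (q * de * (Y S l)%:~R ^+ 2))) ->
   cnorm (W m l * b) <= Mb (m, l).
  move=> hb; rewrite /W /Mb /massey_term !cnormM !cnorm_qp -[leRHS]mulrA /=.
  have eqb : expR (- (q * (d1%:R^-1 * (X S m)%:~R ^+ 2 + d2%:R^-1 * (Y S l)%:~R ^+ 2 -
     d%:R^-1 * ((X S m)%:~R + (Y S l)%:~R) ^+ 2))) =
     expR (- (pi * t2 * massey_form (X S m)%:~R (Y S l)%:~R)).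
    by congr expR; rewrite /massey_form /q; field; rewrite !gt_eqF.
  rewrite eqb in hb.
  have e1 : expR (- (pi * t2 * (S%:~R ^+ 2 / d0%:R))) <= 1.
    rewrite -expR0 ler_expR oppr_le0 mulr_ge0 ?divr_ge0 ?sqr_ge0 ?(ltW D0_gt0)//.
    by rewrite mulr_ge0 ?pi_ge0 ?(ltW tau_gt0).
  set A := expR (- (pi * t2 * (_ / _))) in e1 *; set G := expR (- (pi * t2 * massey_form _ _)) in hb *.
  set k := cnorm kappa^-1; set e := cnorm (cc _ _ _).
  have k0 : 0 <= k by exact: cnorm_ge0.
  have e0 : 0 <= e by exact: cnorm_ge0.
  have G0 : 0 <= G by exact: expR_ge0.
  have -> : A * (k * e * G) * cnorm b = A * (k * e * (G * cnorm b)) by ring.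
  apply: le_trans (_ : k * e * (G * cnorm b) <= _).
    by rewrite ler_piMl// !mulr_ge0// cnorm_ge0.
  rewrite -[leRHS]mulrA -[leLHS]mulrA; apply: ler_pM; rewrite ?mulr_ge0 ?cnorm_ge0//.
  by apply: ler_pM; rewrite ?mulr_ge0 ?cnorm_ge0// ccE.
have WE m l : W m l = kappa^-1 * cc (cmod d1_gt0 m) (cmod d_gt0 (S - m - l)) (cmod d2_gt0 l) *
    qp tau (m%:~R ^+ 2 / d1%:R + l%:~R ^+ 2 / d2%:R - (S - m - l)%:~R ^+ 2 / d%:R).
  have e (x y : R) : x + (y - x) = y by rewrite addrC subrK.
  by rewrite /W /massey_term massey_formE mulrCA -qpD e.
have E1 l m (b : C) : qp tau (l%:~R ^+ 2 / d2%:R) *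
    (kappa^-1 * prod_weight tau d1_gt0 d_gt0 (fun i j => cc i j (cmod d2_gt0 l)) (S - l) m *
      (chi (v - (S - l - m)%:~R * t2 / d%:R) - b)) =
    W m l * (chi (h * ((X S m)%:~R + (Y S l)%:~R)) - b).
  have e (x y z : R) : x + y - z = y + (x - z) by ring.
  have -> : S - l - m = S - m - l by rewrite addrAC.
  rewrite WE /prod_weight arg e qpD (_ : S - l - m = S - m - l); last by rewrite addrAC.
  by move: (cc _ _ _) (qp _ _) (qp _ _) (chi _) => x1 x2 x3 x4; ring.
have E2 m l (b : C) : qp tau (m%:~R ^+ 2 / d1%:R) *
    (kappa^-1 * prod_weight tau d2_gt0 d_gt0 (fun k j => cc (cmod d1_gt0 m) j k) (S - m) l *
      (chi (v - (S - m - l)%:~R * t2 / d%:R) - b)) =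
    W m l * (chi (h * ((X S m)%:~R + (Y S l)%:~R)) - b).
  have e (x y z : R) : x + y - z = x + (y - z) by ring.
  rewrite WE /prod_weight arg e qpD.
  by move: (cc _ _ _) (qp _ _) (qp _ _) (chi _) => x1 x2 x3 x4; ring.
(* Here l is the outer index, so the subtracted sign may depend on Y only; in [H2] it depends on X
   only. Where X or Y is 0 the estimate allows either value of the sign. *)
have H1 : has_sum (fun p : int * int => W p.1 p.2 * (chi (h * ((X S p.1)%:~R + (Y S p.2)%:~R)) - (0 < Y S p.2)%R%:R))
    (fcoef (fun w => \sum_(k < d2) t k w * theta tau d2 k w) S v).
  pose sw (p : int * int) := (p.2, p.1).
  have swK : cancel sw sw by case.
  have swI : injective sw by exact: can_inj swK.
  apply: (has_sum_bij (h := sw) swK swK).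
  have hM l m : cnorm (qp tau (l%:~R ^+ 2 / d2%:R) *
      (kappa^-1 * prod_weight tau d1_gt0 d_gt0 (fun i j => cc i j (cmod d2_gt0 l)) (S - l) m *
      (chi (v - (S - l - m)%:~R * t2 / d%:R) - (0 < Y S l)%R%:R))) <= Mb (sw (l, m)).
    rewrite E1; apply: WM; rewrite [Z in expR Z](_ : _ = - (q * (d2%:R^-1 * (Y S l)%:~R ^+ 2 +
      d1%:R^-1 * (X S m)%:~R ^+ 2 - d%:R^-1 * ((Y S l)%:~R + (X S m)%:~R) ^+ 2))); last by ring.
    rewrite [(X S m)%:~R + _]addrC [expR _ * expR _ in leRHS]mulrC.
    apply: (cdf_dom c0 K0 chi0 chi1 _ (ltW q0) h0 ga0 (ltW de0) ch de2 de1).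
    by case: ifP => hY; [rewrite ler0z ltW|rewrite lerz0 leNgt hY].
  have H := iterated_coef (E := fun k i j => cc i j k)
    (fun k => csec_smooth (t k)) weight1 (fun k p => ft k p v) (bsum_comp swI bM) hM.
  apply: has_sum_eq H => p; exact: E1.
have H2 : has_sum (fun p : int * int => W p.1 p.2 * (chi (h * ((X S p.1)%:~R + (Y S p.2)%:~R)) - (0 <= X S p.1)%R%:R))
    (fcoef (fun w => \sum_(i < d1) u i w * theta tau d1 i w) S v).
  have hM m l : cnorm (qp tau (m%:~R ^+ 2 / d1%:R) *
      (kappa^-1 * prod_weight tau d2_gt0 d_gt0 (fun k j => cc (cmod d1_gt0 m) j k) (S - m) l *
      (chi (v - (S - m - l)%:~R * t2 / d%:R) - (0 <= X S m)%R%:R))) <= Mb (m, l).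
    rewrite E2; apply: WM.
    apply: (cdf_dom c0 K0 chi0 chi1 _ (ltW q0) h0 ga0 (ltW de0) ch de1 de2).
    by case: ifP => hX; [rewrite ler0z|rewrite lerz0 ltW// ltNge hX].
  have H := iterated_coef (E := fun i k j => cc i j k)
    (fun i => csec_smooth (u i)) weight2 (fun k p => fu k p v) bM hM.
  apply: has_sum_eq H => p; exact: E2.
have rS : fcoef r S v = fcoef (fun w => \sum_(k < d2) t k w * theta tau d2 k w) S v -
    fcoef (fun w => \sum_(i < d1) u i w * theta tau d1 i w) S v.
  rewrite -fcoefB; last 2 first.
  - by apply: smooth_sum => k; exact: (smoothM (csec_smooth _) (H0_smooth _)).
  - by apply: smooth_sum => k; exact: (smoothM (csec_smooth _) (H0_smooth _)).
  have -> : (r : C -> C) = (fun z => \sum_(k < d2) t k z * theta tau d2 k z -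
      \sum_(i < d1) u i z * theta tau d1 i z) => //.
  by apply/funext => w; rewrite rE; congr (_ - _); apply: eq_bigr => i _; rewrite mulrC.
have dE : d1%:Z + d2%:Z - d%:Z = d0%:Z by rewrite -subzn ?(ltnW dd).
have [r' r'E] : exists r' : H0 tau d0%:Z, (r' : C -> C) = r by rewrite -dE; exists r.
rewrite -r'E coefE// (H0_fcoef_cst r' S 0 v) r'E rS mulrC.
apply: has_sum_eq (has_sumZ _ (has_sumB H1 H2)) => p; rewrite -mulrBr opprB addrC addrA subrK.
by rewrite /W !mulrA -qpD addNr qp0 mul1r.
Qed.

End MasseySeries.

(** * Rational lattices *)

Section RationalLattices.

Lemma clear_denoms (rs : seq rat) : exists2 K : nat, (0 < K)%N &
  forall r, r \in rs -> r * K%:R \is a Num.int.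
Proof.
elim: rs => [|r rs [K K0 hK]]; first by exists 1%N.
exists (K * `|denq r|)%N; first by rewrite muln_gt0 K0 absz_gt0 denq_neq0.
move=> x; rewrite inE natrM => /orP[/eqP ->|/hK xK]; last first.
  by rewrite mulrA rpredM// rpred_nat.
have -> : (`|denq r|%N%:R : rat) = (denq r)%:~R.
  by rewrite -[LHS]/((`|denq r|%N%:Z)%:~R) absz_denq.
by rewrite mulrCA -numqE rpredM ?rpred_nat// rpred_int.
Qed.

Lemma pair_mulrz (v : rat * rat) (m : int) : v *~ m = (v.1 * m%:~R, v.2 * m%:~R).
Proof.
by apply: injective_projections; rewrite /= mulrzr ?(raddfMz fst) ?(raddfMz snd).
Qed.

Lemma lattice_comb (v w : rat * rat) (m n : int) :
  v *~ m + w *~ n = (v.1 * m%:~R + w.1 * n%:~R, v.2 * m%:~R + w.2 * n%:~R).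
Proof. by rewrite !pair_mulrz. Qed.

(** If the determinant vanished, (w.2, v.2) and (w.1, v.1) would give rational relations between v
    and w; cleared of denominators they are integral, hence trivial, and v = w = 0. *)
Lemma lattice_det (v w : rat * rat) :
  (forall m n : int, v *~ m + w *~ n = 0 -> m = 0 /\ n = 0) ->
  v.1 * w.2 - v.2 * w.1 != 0.
Proof.
move=> ind; apply/eqP => det0.
have [K K0 hK] := clear_denoms [:: v.1; v.2; w.1; w.2].
have KR : (K%:R : rat) != 0 by rewrite pnatr_eq0 -lt0n.
have key (x y : rat) : x * K%:R \is a Num.int -> y * K%:R \is a Num.int ->
    v.1 * x - w.1 * y = 0 -> v.2 * x - w.2 * y = 0 -> x = 0 /\ y = 0.
  move=> /intrP[m xm] /intrP[n yn] e1 e2.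
  have [|m0 n0] := ind m (- n).
    rewrite lattice_comb intrN -xm -yn; apply: injective_projections => /=.
    - have -> : v.1 * (x * K%:R) + w.1 * - (y * K%:R) = (v.1 * x - w.1 * y) * K%:R by ring.
      by rewrite e1 mul0r.
    - have -> : v.2 * (x * K%:R) + w.2 * - (y * K%:R) = (v.2 * x - w.2 * y) * K%:R by ring.
      by rewrite e2 mul0r.
  split; apply: (mulIf KR); rewrite mul0r.
    by rewrite xm m0.
  by rewrite yn; move: n0 => /eqP; rewrite oppr_eq0 => /eqP ->.
have in4 x : x \in [:: v.1; v.2; w.1; w.2] -> x * K%:R \is a Num.int by exact: hK.
have [||||w2 v2] := key w.2 v.2.
- by apply: in4; rewrite !inE eqxx !orbT.
- by apply: in4; rewrite !inE eqxx !orbT.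
- by rewrite -det0; ring.
- by ring.
have [||||w1 v1] := key w.1 v.1.
- by apply: in4; rewrite !inE eqxx !orbT.
- by apply: in4; rewrite !inE eqxx ?orbT.
- by ring.
- by rewrite v2 w2; ring.
have [|//] := ind 1 0.
by rewrite lattice_comb v1 v2 w1 w2 !mul0r addr0.
Qed.

(** Cramer's rule: K clears the denominators of the inverse of the basis matrix. *)
Lemma lattice_contains (L : set (rat * rat)) : is_lattice L -> exists2 D : nat, (0 < D)%N &
  forall x y, x \is a Num.int -> y \is a Num.int -> L (x * D%:R, y * D%:R).
Proof.
move=> [v [w [/lattice_det det0 ->]]]; set D := _ - _ in det0.
have [K K0 hK] := clear_denoms [:: v.1 / D; v.2 / D; w.1 / D; w.2 / D].
exists K => // x y xi yi.
have /intrP[m em] : x * (w.2 / D * K%:R) - y * (w.1 / D * K%:R) \is a Num.int.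
  by rewrite rpredB// rpredM// hK// !inE eqxx !orbT.
have /intrP[n en] : y * (v.1 / D * K%:R) - x * (v.2 / D * K%:R) \is a Num.int.
  by rewrite rpredB// rpredM// hK// !inE eqxx ?orbT.
exists m, n; rewrite lattice_comb -em -en.
by apply: injective_projections => /=; move: det0; rewrite /D => det0; field.
Qed.

Lemma lattice_denom (L : set (rat * rat)) : is_lattice L -> exists2 D : nat, (0 < D)%N &
  forall p, L p -> p.1 * D%:R \is a Num.int /\ p.2 * D%:R \is a Num.int.
Proof.
move=> [v [w [_ ->]]].
have [K K0 hK] := clear_denoms [:: v.1; v.2; w.1; w.2].
exists K => // p [m [n ->]]; rewrite lattice_comb /=.
have in4 x z : x \in [:: v.1; v.2; w.1; w.2] -> x * z%:~R * K%:R \is a Num.int.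
  by move=> /hK h; rewrite mulrAC rpredM// rpred_int.
by split; rewrite mulrDl rpredD// in4// !inE eqxx ?orbT.
Qed.

Lemma int_gt0_nat (r : rat) : 0 < r -> r \is a Num.int -> exists2 n : nat, (0 < n)%N & n%:R = r.
Proof.
move=> r0 /intrP[[n|n] rn]; last by rewrite rn ltr0z in r0.
by exists n; rewrite ?rn//; rewrite rn ltr0z in r0.
Qed.

End RationalLattices.

(** * The Massey system of an admissible pair *)

Section AntisymmetricWeights.
Variable R : realType.
Local Notation C := R[i].

Lemma cmod_dvd (N : nat) (N0 : (0 < N)%N) (n : int) :
  exists q : int, n = (cmod N0 n : nat)%:Z + N%:Z * q.
Proof.
have h : 0 < complex.Im ((0 : R) +i* 1) by exact: ltr01.
have := cmodP h N0 n (cmod N0 n); rewrite eqxx => /dvdzP[q nq].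
by exists q; rewrite mulrC -nq addrC subrK.
Qed.

Lemma anti_sum (w : int -> C) (q : int) : bsum (fun m => cnorm (w m)) ->
  (forall m, w (- m - q) = - w m) -> has_sum w 0.
Proof.
move=> bw wq; have [T hT] := has_sum_ex bw (fun m => lexx _).
pose h (m : int) := - m - q.
have hK : cancel h h by move=> m; rewrite /h opprB opprK addrC addKr.
have hT' : has_sum w (- T).
  by apply: (has_sum_bij (h := h) hK hK); apply: has_sum_eq (has_sumN hT) => m; rewrite wq.
have := has_sum_unique hT hT'; move/eqP; rewrite -subr_eq0 opprK -mulr2n mulrn_eq0 /= => /eqP T0.
by rewrite T0 in hT.
Qed.

(** The equation q d = n1 (2 p + q) says that the reflection m |-> - m - q preserves the exponent
    m^2/n1 - (p - m)^2/d. An integral q is asked for only if F is nonzero somewhere, since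
    integrality will be deduced from the support of f. *)
Lemma anti_weight (tau : C) (n1 d : nat) (n1_gt0 : (0 < n1)%N) (d_gt0 : (0 < d)%N)
    (E : 'I_n1 -> 'I_d -> C) (p : int) (F : int -> C) :
  0 < complex.Im tau -> (n1 < d)%N ->
  (forall m, E (cmod n1_gt0 m) (cmod d_gt0 (p - m)) = F m) ->
  (forall m, F m != 0 -> exists2 q : int, q * d%:Z = n1%:Z * (2 * p + q) &
    forall m, F (- m - q) = - F m) ->
  has_sum (prod_weight tau n1_gt0 d_gt0 E p) 0.
Proof.
move=> tau_gt0 n1d EF Fq.
have wE m : prod_weight tau n1_gt0 d_gt0 E p m =
    F m * qp tau (m%:~R ^+ 2 / n1%:R - (p - m)%:~R ^+ 2 / d%:R) by rewrite /prod_weight EF.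
have [[m0 Fm0]|F0] := EM (exists m, F m != 0).
  have [q qE FN] := Fq _ Fm0.
  apply: (anti_sum (q := q) (prod_weight_bsum tau_gt0 n1_gt0 d_gt0 n1d E p)) => m.
  rewrite !wE FN mulNr; congr (- (_ * qp tau _)).
  have qR : q%:~R * d%:R = n1%:R * (2 * p%:~R + q%:~R) :> R.
    by have := congr1 (fun z : int => z%:~R : R) qE; rewrite !(intrM, intrD) -!pmulrn.
  have dR : (d%:R : R) != 0 by rewrite pnatr_eq0 -lt0n.
  have nR : (n1%:R : R) != 0 by rewrite pnatr_eq0 -lt0n.
  apply/eqP; rewrite -subr_eq0; apply/eqP.
  transitivity ((2 * m%:~R + q%:~R) * (q%:~R * d%:R - n1%:R * (2 * p%:~R + q%:~R)) / (n1%:R * d%:R) : R).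
    by rewrite !(intrB, intrN); field; rewrite dR.
  by rewrite qR subrr mulr0 mul0r.
apply: has_sum_eq (@has_sum0 R _) => m; rewrite wE.
have [->|Fm] := eqVneq (F m) 0; first by rewrite mul0r.
by case: F0; exists m.
Qed.

End AntisymmetricWeights.

Lemma idx_cancel (m s l : int) : m + (s - m - l) + l = s.
Proof. ring. Qed.

(** * Constants of the Massey system and comparison with Theta *)

Section ThetaConstruction.
Variables (R : realType) (kappa : R[i]).
Local Notation C := R[i].
Hypothesis kappa_neq0 : kappa != 0.
Variables (a b c : rat) (f : rat * rat -> C).
Hypotheses (a_gt0 : 0 < a) (b_gt0 : 0 < b) (c_gt0 : 0 < c).
Hypothesis fA : forall m n, f (- m - 2 * b / a * n, n) = - f (m, n).
Hypothesis fB : forall m n, f (m, - (2 * b / c) * m - n) = - f (m, n).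
Variables (M d d1 d2 : nat) (e0 e1 e2 : rat).
Hypotheses (M_gt0 : (0 < M)%N).
Hypotheses (d_gt0 : (0 < d)%N) (d1_gt0 : (0 < d1)%N) (d2_gt0 : (0 < d2)%N).
Hypotheses (d1d : (d1 < d)%N) (d2d : (d2 < d)%N) (dd : (d < d1 + d2)%N).
Hypotheses (e1E : e1 = b ^+ 2 / (a + b)) (e2E : e2 = b ^+ 2 / (b + c)).
Hypotheses (e0E : e0 = e1 + e2 - b) (e0_gt0 : 0 < e0).
(* These degrees make the quadratic form of the Massey series equal to Q:
   a = mu^2 (1/d1 - 1/d), b = mu^2 / d and c = mu^2 (1/d2 - 1/d) for mu = b M. *)
Hypotheses (dE : d%:R = b * M%:R ^+ 2) (d1E : d1%:R = e1 * M%:R ^+ 2)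
  (d2E : d2%:R = e2 * M%:R ^+ 2).
Local Notation mu := (b * M%:R).
Hypothesis f_supp : forall x y, f (x, y) != 0 ->
  x * mu \is a Num.int /\ y * mu \is a Num.int.
(** Up to sign and the factor M, the displacements of the coordinates of [point] when m, n or l
    grows by d1, d or d2. Periodicity of f under them makes the constants depend on residue classes
    only. *)
Let rs := [:: e1 / e0; e2 / e0; e1 * (e0 - e1) / (e0 * b); e1 * e2 / (e0 * b);
              e2 * (e0 - e2) / (e0 * b)].
Hypothesis f_per : forall r r' x y (k k' : int), r \in rs -> r' \in rs ->
  f (x + k%:~R * (r * M%:R), y + k'%:~R * (r' * M%:R)) = f (x, y).

Local Notation d0 := (d1 + d2 - d)%N.

Let d0E : d0%:R = e0 * M%:R ^+ 2.
Proof. by rewrite natrB ?(ltnW dd)// natrD dE d1E d2E e0E; ring. Qed.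
Let MR : (M%:R : rat) != 0. Proof. by rewrite pnatr_eq0 -lt0n. Qed.
Let an : a != 0. Proof. by rewrite gt_eqF. Qed.
Let bn : b != 0. Proof. by rewrite gt_eqF. Qed.
Let cn : c != 0. Proof. by rewrite gt_eqF. Qed.
Let e0n : e0 != 0. Proof. by rewrite gt_eqF. Qed.
Let abn : a + b != 0. Proof. by rewrite gt_eqF// addr_gt0. Qed.
Let bcn : b + c != 0. Proof. by rewrite gt_eqF// addr_gt0. Qed.
Let mun : mu != 0. Proof. by rewrite mulf_neq0. Qed.

(* With X = d0 m - s d1 and Y = d0 l - s d2 this is (X, - Y) / (d0 mu). *)
Definition point (s m l : int) : rat * rat :=
  ((m%:~R - s%:~R * (e1 / e0)) / mu, - ((l%:~R - s%:~R * (e2 / e0)) / mu)).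

(* Each point of the support of f is [point s m l] for exactly one pair (m, l) if
   s is good, and for none otherwise. *)
Definition good (s : int) : bool :=
  (s%:~R * (e1 / e0) \is a Num.int) && (s%:~R * (e2 / e0) \is a Num.int).
Definition ngood : nat := \sum_(s < d0) good (s : nat)%:Z.

Lemma ngood_gt0 : (0 < ngood)%N.
Proof.
have d0_gt0 : (0 < d0)%N by rewrite subn_gt0.
rewrite /ngood (bigD1 (Ordinal d0_gt0))//= /good !mul0r.
by rewrite !rpred0.
Qed.

(** The factor kappa cancels the kappa^-1 of the dual basis; the division by [ngood] compensates for
    each good s contributing the same full series. *)
Definition coef_fun (m n l : int) : C := kappa / ngood%:R * f (point (m + n + l) m l).
Definition massey_coef (i : 'I_d1) (j : 'I_d) (k : 'I_d2) : C :=
  coef_fun (i : nat)%:Z (j : nat)%:Z (k : nat)%:Z.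

Let f_shift s m l s' m' l' (r r' : rat) (k k' : int) : r \in rs -> r' \in rs ->
  (point s' m' l').1 = (point s m l).1 + k%:~R * (r * M%:R) ->
  (point s' m' l').2 = (point s m l).2 + k'%:~R * (r' * M%:R) ->
  f (point s' m' l') = f (point s m l).
Proof.
move=> hr hr' h1 h2; rewrite [in LHS](surjective_pairing (point s' m' l')) h1 h2.
by rewrite f_per// -surjective_pairing.
Qed.

Lemma coef_fun_per1 m n l (q : int) : coef_fun (m + d1%:Z * q) n l = coef_fun m n l.
Proof.
congr (_ * _); apply: (f_shift (k := q) (k' := q)
  (r := e1 * (e0 - e1) / (e0 * b)) (r' := e1 * e2 / (e0 * b))).
- by rewrite !inE eqxx !orbT.
- by rewrite !inE eqxx !orbT.
- by rewrite /= !(intrD, intrM) -!pmulrn d1E; field; rewrite ?e0n ?bn ?MR.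
- by rewrite /= !(intrD, intrM) -!pmulrn d1E; field; rewrite ?e0n ?bn ?MR.
Qed.

Lemma coef_fun_per m n l (q : int) : coef_fun m (n + d%:Z * q) l = coef_fun m n l.
Proof.
congr (_ * _); apply: (f_shift (k := - q) (k' := q) (r := e1 / e0) (r' := e2 / e0)).
- by rewrite !inE eqxx.
- by rewrite !inE eqxx !orbT.
- by rewrite /= intrN !(intrD, intrM) -!pmulrn dE; field; rewrite ?e0n ?bn ?MR.
- by rewrite /= !(intrD, intrM) -!pmulrn dE; field; rewrite ?e0n ?bn ?MR.
Qed.

Lemma coef_fun_per2 m n l (q : int) : coef_fun m n (l + d2%:Z * q) = coef_fun m n l.
Proof.
congr (_ * _); apply: (f_shift (k := - q) (k' := - q)
  (r := e1 * e2 / (e0 * b)) (r' := e2 * (e0 - e2) / (e0 * b))).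
- by rewrite !inE eqxx !orbT.
- by rewrite !inE eqxx !orbT.
- by rewrite /= intrN !(intrD, intrM) -!pmulrn d2E; field; rewrite ?e0n ?bn ?MR.
- by rewrite /= intrN !(intrD, intrM) -!pmulrn d2E; field; rewrite ?e0n ?bn ?MR.
Qed.

Lemma massey_coefE m n l :
  massey_coef (cmod d1_gt0 m) (cmod d_gt0 n) (cmod d2_gt0 l) = coef_fun m n l.
Proof.
have [q1 h1] := cmod_dvd R d1_gt0 m; have [q h] := cmod_dvd R d_gt0 n.
have [q2 h2] := cmod_dvd R d2_gt0 l.
rewrite [in RHS]h1 [in RHS]h [in RHS]h2.
by rewrite coef_fun_per1 coef_fun_per coef_fun_per2.
Qed.

Let cmod_ord (N : nat) (N0 : (0 < N)%N) (k : 'I_N) : cmod N0 (k : nat)%:Z = k.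
Proof.
have h : 0 < complex.Im ((0 : R) +i* 1) by exact: ltr01.
by have := cmodP h N0 (k : nat)%:Z k; rewrite subrr dvdz0 => /esym/eqP.
Qed.

(** With k fixed, A acts on [point S m k] as m |-> - m - q with q = 2 b p / a. Integrality of q
    comes from the support: where f is nonzero it is also nonzero at the image under A, and both
    first coordinates lie in mu^-1 Z. *)
Lemma coef_weight1 (tau : C) (k : 'I_d2) p : 0 < complex.Im tau ->
  has_sum (prod_weight tau d1_gt0 d_gt0 (fun i j => massey_coef i j k) p) 0.
Proof.
move=> tau_gt0; pose S : int := p + (k : nat)%:Z.
apply: (anti_weight (F := fun m => kappa / ngood%:R * f (point S m (k : nat)%:Z)) tau_gt0 d1d).
  by move=> m; rewrite -(cmod_ord d2_gt0 k) massey_coefE cmod_ord /coef_fun addrCA subrr addr0.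
move=> m0 /eqP fm0.
have {}fm0 : f (point S m0 (k : nat)%:Z) != 0.
  by apply/eqP => f0; case: fm0; rewrite f0 mulr0.
(* By this identity the reflection depends on S and k only through p = S - k. *)
have rel : e1 = b / a * (e2 - e0).
  by rewrite e0E e1E; field; rewrite an abn.
have [x0 _] := f_supp fm0.
have fm1 : f (- (point S m0 (k : nat)%:Z).1 - 2 * b / a * (point S m0 (k : nat)%:Z).2,
    (point S m0 (k : nat)%:Z).2) != 0 by rewrite fA oppr_eq0 -surjective_pairing.
have [x1 _] := f_supp fm1.
have /intrP[q qE] : 2 * b / a * p%:~R \is a Num.int.
  have z0 : S%:~R * (e1 / e0) \is a Num.int.
    rewrite -[X in X \is a _](subKr m0%:~R); apply: rpredB; first exact: rpred_int.
    by move: x0; rewrite /= divfK.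
  rewrite (_ : 2 * b / a * p%:~R = - m0%:~R - S%:~R * (e1 / e0) -
      (- (point S m0 (k : nat)%:Z).1 - 2 * b / a * (point S m0 (k : nat)%:Z).2) * mu).
    by do 2 (apply: rpredB => //); rewrite rpredN rpred_int.
  by rewrite /= !intrD rel; field; rewrite ?an ?e0n ?bn ?MR.
exists q.
  apply: (@intr_inj rat); rewrite !(intrM, intrD) -!pmulrn dE d1E -qE e1E.
  by field; rewrite an abn.
move=> m; rewrite -mulrN; congr (_ * _); rewrite [in RHS](surjective_pairing (point S m _)) -fA.
congr f; apply: injective_projections => //=.
by rewrite !(intrB, intrN, intrD) -qE rel; field; rewrite ?an ?e0n ?bn ?MR.
Qed.

(** The mirror image of [coef_weight1]: with i fixed, B reflects l |-> - l - q with q = 2 b p /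
    c. *)
Lemma coef_weight2 (tau : C) (i : 'I_d1) p : 0 < complex.Im tau ->
  has_sum (prod_weight tau d2_gt0 d_gt0 (fun k j => massey_coef i j k) p) 0.
Proof.
move=> tau_gt0; pose S : int := p + (i : nat)%:Z.
apply: (anti_weight (F := fun l => kappa / ngood%:R * f (point S (i : nat)%:Z l)) tau_gt0 d2d).
  move=> l; rewrite -(cmod_ord d1_gt0 i) massey_coefE cmod_ord /coef_fun.
  by rewrite -addrA subrK addrC.
move=> m0 /eqP fm0.
have {}fm0 : f (point S (i : nat)%:Z m0) != 0.
  by apply/eqP => f0; case: fm0; rewrite f0 mulr0.
have rel : e2 = b / c * (e1 - e0).
  by rewrite e0E e2E; field; rewrite ?cn ?bcn.
have [_ x0] := f_supp fm0.
have fm1 : f ((point S (i : nat)%:Z m0).1, - (2 * b / c) * (point S (i : nat)%:Z m0).1 -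
    (point S (i : nat)%:Z m0).2) != 0 by rewrite fB oppr_eq0 -surjective_pairing.
have [_ x1] := f_supp fm1.
have /intrP[q qE] : 2 * b / c * p%:~R \is a Num.int.
  have z0 : S%:~R * (e2 / e0) \is a Num.int.
    rewrite -[X in X \is a _](subKr m0%:~R); apply: rpredB; first exact: rpred_int.
    by move: x0; rewrite /= mulNr divfK// rpredN.
  rewrite (_ : 2 * b / c * p%:~R = - m0%:~R - S%:~R * (e2 / e0) +
      (- (2 * b / c) * (point S (i : nat)%:Z m0).1 - (point S (i : nat)%:Z m0).2) * mu).
    by rewrite rpredD// rpredB// rpredN rpred_int.
  by rewrite /= !intrD rel; field; rewrite ?cn ?e0n ?bn ?MR.
exists q.
  apply: (@intr_inj rat); rewrite !(intrM, intrD) -!pmulrn dE d2E -qE e2E.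
  by field; rewrite cn bcn.
move=> m; rewrite -mulrN; congr (_ * _); rewrite [in RHS](surjective_pairing (point S _ m)) -fB.
congr f; apply: injective_projections => //=.
by rewrite !(intrB, intrN, intrD) -qE rel; field; rewrite ?cn ?e0n ?bn ?MR.
Qed.

Lemma massey_coef_series (tau : C) (s : 'I_d0) : 0 < complex.Im tau ->
  in_K (massey_x massey_coef tau) (massey_y kappa tau) (massey_z tau) /\
  has_sum (fun p : int * int =>
      massey_term kappa tau d_gt0 d1_gt0 d2_gt0 massey_coef (s : nat)%:Z p.1 p.2 *
      ((0 <= shift_idx d d1 d2 d1 (s : nat)%:Z p.1)%R%:R -
       (0 < shift_idx d d1 d2 d2 (s : nat)%:Z p.2)%R%:R))
    (MP kappa massey_coef s tau).
Proof.
move=> tau_gt0; apply: massey_series => //.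
- by move=> k p; exact: coef_weight1.
- by move=> i p; exact: coef_weight2.
Qed.

Lemma massey_coef_universal : universal_massey_system kappa massey_coef.
Proof.
have d0_gt0 : (0 < d0)%N by rewrite subn_gt0.
by move=> tau /(massey_coef_series (Ordinal d0_gt0))[].
Qed.

Section FixedTau.
Variable tau : C.
Local Notation t2 := (complex.Im tau).
Hypothesis tau_gt0 : 0 < t2.

(** The common form of all [point s m l] once the shifts by s are integral. The minus sign turns the
    cross term - 2 u t / d into + 2 b x y. *)
Definition grid (p : int * int) : rat * rat := (p.1%:~R / mu, - (p.2%:~R / mu)).
Definition grid_term (p : int * int) : C :=
  f (grid p) * qp tau (ratr (quadratic_form a b c (grid p))).

Let mu_gt0 : 0 < mu. Proof. by rewrite mulr_gt0// ltr0n. Qed.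
Let muV_gt0 : 0 < mu^-1. Proof. by rewrite invr_gt0. Qed.

Lemma grid_formE (u t : int) : quadratic_form a b c (grid (u, t)) =
  u%:~R ^+ 2 / d1%:R + t%:~R ^+ 2 / d2%:R - (u%:~R + t%:~R) ^+ 2 / d%:R.
Proof.
rewrite /quadratic_form /= dE d1E d2E e1E e2E; field.
by rewrite ?an ?bn ?cn ?MR ?abn ?bcn.
Qed.

Lemma shift_idxE (e : nat) (r : rat) (s m u : int) : e%:R = r * M%:R ^+ 2 ->
  m%:~R - s%:~R * (r / e0) = u%:~R -> shift_idx d d1 d2 e s m = d0%:Z * u.
Proof.
move=> eE h; apply: (@intr_inj rat); rewrite /shift_idx !(intrB, intrM) -!pmulrn -h d0E eE.
by field.
Qed.

Lemma massey_term_grid (s m l u t : int) :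
  m%:~R - s%:~R * (e1 / e0) = u%:~R -> l%:~R - s%:~R * (e2 / e0) = t%:~R ->
  massey_term kappa tau d_gt0 d1_gt0 d2_gt0 massey_coef s m l *
      ((0 <= shift_idx d d1 d2 d1 s m)%R%:R - (0 < shift_idx d d1 d2 d2 s l)%R%:R) =
  ngood%:R^-1 * (grid_term (u, t) * ((0 <= u)%R%:R - (0 < t)%R%:R)).
Proof.
move=> mu_ lt_.
have d0_gt0 : 0 < d0%:Z by rewrite ltz_nat subn_gt0.
rewrite /massey_term (shift_idxE d1E mu_) (shift_idxE d2E lt_).
rewrite pmulr_rge0// pmulr_rgt0// massey_coefE /coef_fun.
rewrite idx_cancel.
have -> : point s m l = grid (u, t) by rewrite /point /grid mu_ lt_.
have -> : massey_form d d1 d2 (d0%:Z * u)%:~R (d0%:Z * t)%:~R =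
    ratr (quadratic_form a b c (grid (u, t))) :> R.
  rewrite grid_formE !(rmorphB, rmorphD, rmorphXn, rmorphM) /= !fmorphV /= !ratr_int !ratr_nat.
  rewrite /massey_form -!pmulrn.
  by field; rewrite !pnatr_eq0 -!lt0n d_gt0 d1_gt0 d2_gt0 subn_gt0 dd.
rewrite /grid_term; move: (qp _ _) (f _) (_ - _) => x1 x2 x3.
have ng0 : (ngood%:R : C) != 0 by rewrite pnatr_eq0 -lt0n ngood_gt0.
by field; rewrite kappa_neq0 ng0.
Qed.

(** For good s, translating (m, l) by the integers s e1/e0 and s e2/e0 gives a series that no longer
    depends on s; for other s no [point s m l] meets the support of f. *)
Lemma massey_series_grid (s : 'I_d0) :
  has_sum (fun p : int * int => (good (s : nat)%:Z)%:R *
      (ngood%:R^-1 * (grid_term p * ((0 <= p.1)%R%:R - (0 < p.2)%R%:R))))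
    (MP kappa massey_coef s tau).
Proof.
have [_ H] := massey_coef_series s tau_gt0; set S : int := (s : nat)%:Z in H *.
have [gS|ngS] := boolP (good S).
  have /andP[/intrP[z1 h1] /intrP[z2 h2]] := gS.
  pose h (p : int * int) := (p.1 - z1, p.2 - z2).
  pose h' (p : int * int) := (p.1 + z1, p.2 + z2).
  have hK : cancel h h' by move=> [x y]; rewrite /h /h' /= !subrK.
  have h'K : cancel h' h by move=> [x y]; rewrite /h /h' /= !addrK.
  apply: (has_sum_bij (h := h) hK h'K); apply: has_sum_eq H => -[m l] /=.
  by rewrite mul1r; apply: massey_term_grid; rewrite ?h1 ?h2 intrB.
have M0 : MP kappa massey_coef s tau = 0.
  apply: (has_sum_unique H); apply: has_sum_eq (@has_sum0 R _) => -[m l] /=.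
  rewrite /massey_term massey_coefE /coef_fun idx_cancel.
  have [->|f0] := eqVneq (f (point S m l)) 0; first by rewrite !(mulr0, mul0r).
  have [x0 y0] := f_supp f0; case/negP: ngS; apply/andP; split.
    rewrite -[X in X \is a _](subKr m%:~R); apply: rpredB; first exact: rpred_int.
    by move: x0; rewrite divfK.
  rewrite -[X in X \is a _](subKr l%:~R); apply: rpredB; first exact: rpred_int.
  by move: y0; rewrite mulNr divfK// rpredN.
by rewrite M0; apply: has_sum_eq (@has_sum0 R _) => p; rewrite mul0r.
Qed.

Lemma massey_total : has_sum (fun p : int * int => grid_term p * ((0 <= p.1)%R%:R - (0 < p.2)%R%:R))
  (\sum_(s < d0) MP kappa massey_coef s tau).
Proof.
apply: has_sum_eq (has_sum_fin _ massey_series_grid) => p.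
rewrite -mulr_suml -natr_sum mulrA mulfV ?mul1r//.
by rewrite pnatr_eq0 -lt0n ngood_gt0.
Qed.

(** Where u t <= 0 the cross term of Q is nonnegative, so Q dominates the definite form a x^2 + c
    y^2. On the grid f is bounded, its values being fixed multiples of the finitely many
    [massey_coef]. *)
Lemma grid_term_bound : exists2 N : int * int -> R, bsum N &
  forall p, (p.1 * p.2 <= 0)%R -> cnorm (grid_term p) <= N p.
Proof.
pose F := \sum_(p : 'I_d1 * 'I_d * 'I_d2) cnorm (ngood%:R / kappa * massey_coef p.1.1 p.1.2 p.2).
have F0 : 0 <= F by apply: sumr_ge0 => p _; exact: cnorm_ge0.
have fF p : cnorm (f (grid p)) <= F.
  have -> : f (grid p) = ngood%:R / kappa *
      massey_coef (cmod d1_gt0 p.1) (cmod d_gt0 (- p.1 - p.2)) (cmod d2_gt0 p.2).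
    rewrite massey_coefE /coef_fun -[- p.1]sub0r idx_cancel.
    have -> : point 0 p.1 p.2 = grid p by rewrite /point /grid !mul0r !subr0.
    have ng0 : (ngood%:R : C) != 0 by rewrite pnatr_eq0 -lt0n ngood_gt0.
    by move: (f _) => x; field; rewrite kappa_neq0 ng0.
  rewrite /F (bigD1 (cmod d1_gt0 p.1, cmod d_gt0 (- p.1 - p.2), cmod d2_gt0 p.2))// lerDl.
  by apply: sumr_ge0 => q _; exact: cnorm_ge0.
pose al : R := pi * t2 * ratr (a / mu ^+ 2); pose be : R := pi * t2 * ratr (c / mu ^+ 2).
have al0 : 0 < al.
  have am : 0 < a / mu ^+ 2 by rewrite divr_gt0// exprn_gt0.
  by rewrite /al mulr_gt0 ?ltr0q// mulr_gt0 ?pi_gt0.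
have be0 : 0 < be.
  have cm : 0 < c / mu ^+ 2 by rewrite divr_gt0// exprn_gt0.
  by rewrite /be mulr_gt0 ?ltr0q// mulr_gt0 ?pi_gt0.
exists (fun p => F * (expR (- (al * `|p.1%:~R| ^+ 2) + 0 * `|p.1%:~R|) *
    expR (- (be * `|p.2%:~R| ^+ 2) + 0 * `|p.2%:~R|))).
  by apply: bsumZ => //; exact: (bsum_pair (bsum_gauss 0 al0) (bsum_gauss 0 be0)).
move=> [u t] /= ut; rewrite cnormM; apply: ler_pM; rewrite ?cnorm_ge0//.
rewrite cnorm_qp -expRD ler_expR !mul0r !addr0 -opprD lerN2 !real_normK ?num_real//.
have h : (a / mu ^+ 2) * u%:~R ^+ 2 + (c / mu ^+ 2) * t%:~R ^+ 2 <= quadratic_form a b c (grid (u, t)).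
  have -> : quadratic_form a b c (grid (u, t)) = a / mu ^+ 2 * u%:~R ^+ 2 + c / mu ^+ 2 * t%:~R ^+ 2 +
      2 * b / mu ^+ 2 * - (u * t)%:~R.
    by rewrite /quadratic_form intrM /=; field; rewrite ?bn ?MR.
  rewrite lerDl mulr_ge0//; first by rewrite divr_ge0 ?exprn_ge0 ?mulr_ge0// ltW.
  by rewrite oppr_ge0 lerz0.
have E (x y : rat) : ratr (x * u%:~R ^+ 2 + y * t%:~R ^+ 2) =
    ratr x * u%:~R ^+ 2 + ratr y * t%:~R ^+ 2 :> R.
  by rewrite !(rmorphD, rmorphXn, rmorphM) /= !ratr_int.
rewrite -(ler_rat R) E in h.
have pt0 : 0 <= pi * t2 by rewrite mulr_ge0 ?pi_ge0 ?(ltW tau_gt0).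
by have := ler_wpM2l pt0 h; rewrite mulrDr !mulrA.
Qed.

Lemma grid_inj : injective grid.
Proof.
move=> [u t] [u' t'] [] /(mulIf _) h1 /oppr_inj /(mulIf _) h2.
congr (_, _); apply: (@intr_inj rat).
- by apply: h1; rewrite invr_neq0.
- by apply: h2; rewrite invr_neq0.
Qed.

Lemma grid_supp p : f p != 0 -> exists q, p = grid q.
Proof.
case: p => x y /f_supp[/intrP[u xu] /intrP[t yt]].
exists (u, - t); apply: injective_projections; rewrite /= -?xu ?intrN -?yt.
  by rewrite mulfK.
by rewrite mulNr opprK mulfK.
Qed.

(** [Theta] consists of two separate sums over Q^2; each converges absolutely by [grid_term_bound]
    and reduces to the grid, outside which f vanishes. Their difference is the single signed series
    of [massey_total]. *)
Lemma ThetaE : Theta a b c f tau = \sum_(s < d0) MP kappa massey_coef s tau.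
Proof.
have [N bN hN] := grid_term_bound.
pose P (p : int * int) : C := if (0 <= p.1) && (p.2 <= 0) then grid_term p else 0.
pose Q (p : int * int) : C := if (p.1 < 0) && (0 < p.2) then grid_term p else 0.
have [bN0 _] := bN.
have [s1 h1] : exists s, has_sum P s.
  apply: (has_sum_ex bN) => p; rewrite /P; case: ifP => [/andP[p1 p2]|_]; last by rewrite cnorm0.
  by apply: hN; rewrite mulr_ge0_le0.
have [s2 h2] : exists s, has_sum Q s.
  apply: (has_sum_ex bN) => p; rewrite /Q; case: ifP => [/andP[p1 p2]|_]; last by rewrite cnorm0.
  by apply: hN; rewrite mulr_le0_ge0// ltW.
have s12 : s1 - s2 = \sum_(s < d0) MP kappa massey_coef s tau.
  apply: has_sum_unique massey_total; apply: has_sum_eq (has_sumB h1 h2) => p.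
  rewrite /P /Q.
  by case: (leP 0 p.1) => _; case: (ltP 0 p.2) => _; rewrite /= ?subrr ?subr0 ?sub0r ?mulr0 ?mulr1 ?mulrN1.
have termE p : f p * expC (2 * pii R * ratr (quadratic_form a b c p / 2) * tau) =
    f p * qp tau (ratr (quadratic_form a b c p)).
  congr (_ * expC _).
  rewrite -[ratr (quadratic_form a b c p / 2)](fmorph_rat (real_complex R)).
  have e (x : rat) : 2 * (ratr (x / 2) : R)%:C = (ratr x)%:C :> C.
    have -> : ratr (x / 2) = ratr x / 2 :> R by rewrite fmorph_div /= ratr_nat.
    by rewrite natrC -rmorphM /= mulrC divfK// pnatr_eq0.
  by rewrite /= -(e (quadratic_form _ _ _ _)); move: (_%:C) => y; ring.
rewrite /Theta -s12; congr (_ - _); apply: has_sum_csum.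
  apply: (has_sum_inj grid_inj) => [p np|].
    case: ifP => // _; have [->|/grid_supp[q pq]] := eqVneq (f p) 0; first by rewrite mul0r.
    by case: np; exists q.
  apply: has_sum_eq h1 => -[u t]; rewrite /P termE /=.
  by rewrite pmulr_lge0// oppr_ge0 pmulr_lle0// ler0z lerz0.
apply: (has_sum_inj grid_inj) => [p np|].
  case: ifP => // _; have [->|/grid_supp[q pq]] := eqVneq (f p) 0; first by rewrite mul0r.
  by case: np; exists q.
apply: has_sum_eq h2 => -[u t]; rewrite /Q termE /=.
by rewrite pmulr_llt0// oppr_lt0 pmulr_lgt0// ltrz0 ltr0z.
Qed.

End FixedTau.
End ThetaConstruction.

Theorem theorem1p3 (R : realType) (kappa : R[i]) (kappa_neq0 : kappa != 0)
    (a b c : rat) (f : rat * rat -> R[i]) :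
  admissible a b c f ->
  exists d d1 d2 : nat,
    [/\ (0 < d)%N, (0 < d1)%N & (0 < d2)%N] /\
    [/\ (d1 < d)%N, (d2 < d)%N & (d < d1 + d2)%N] /\
    exists cc : 'I_d1 -> 'I_d -> 'I_d2 -> R[i],
      universal_massey_system kappa cc /\
      forall tau : R[i], 0 < complex.Im tau ->
        Theta a b c f tau = \sum_(l < d1 + d2 - d) MP kappa cc l tau.
Proof.
move=> [[a0 b0 c0 disc] [[L1 [L2 [[l1 l2 _] [supp per]]]] fA fB]].
have [D0 D0_gt0 hD0] := lattice_contains l1.
have [D1 D1_gt0 hD1] := lattice_denom l2.
pose e1 := b ^+ 2 / (a + b); pose e2 := b ^+ 2 / (b + c); pose e0 := e1 + e2 - b.
have ab0 : 0 < a + b by rewrite addr_gt0.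
have bc0 : 0 < b + c by rewrite addr_gt0.
have e1_gt0 : 0 < e1 by rewrite divr_gt0// exprn_gt0.
have e2_gt0 : 0 < e2 by rewrite divr_gt0// exprn_gt0.
have e0_gt0 : 0 < e0.
  (* The discriminant condition enters here, as the positivity of d0. *)
  have -> : e0 = b * (b ^+ 2 - a * c) / ((a + b) * (b + c)).
    by rewrite /e0 /e1 /e2; field; rewrite !gt_eqF.
  by rewrite divr_gt0 ?mulr_gt0// subr_gt0.
pose rs := [:: e1 / e0; e2 / e0; e1 * (e0 - e1) / (e0 * b); e1 * e2 / (e0 * b);
              e2 * (e0 - e2) / (e0 * b)].
have [K K_gt0 hK] := clear_denoms [:: b, e1, e2 & rs].
(* K makes b, e1, e2 and the displacements integral, D1 clears the denominators of the support, and
   D0 moves the displacements into the period lattice. *)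
pose M := (D0 * D1 * K)%N.
have M_gt0 : (0 < M)%N by rewrite !muln_gt0 D0_gt0 D1_gt0.
have MR : 0 < M%:R :> rat by rewrite ltr0n.
have sq e : e \in [:: b, e1, e2 & rs] -> 0 < e ->
    exists2 n : nat, (0 < n)%N & n%:R = e * M%:R ^+ 2.
  move=> /hK eK e_gt0; apply: int_gt0_nat; first by rewrite mulr_gt0// exprn_gt0.
  rewrite (_ : e * M%:R ^+ 2 = e * K%:R * (D0 * D1 * M)%:R).
    by rewrite rpredM// rpred_nat.
  by rewrite /M !natrM; ring.
have [|//|d d_gt0 dE] := sq b; first by rewrite inE eqxx.
have [|//|d1 d1_gt0 d1E] := sq e1; first by rewrite !inE eqxx orbT.
have [|//|d2 d2_gt0 d2E] := sq e2; first by rewrite !inE eqxx !orbT.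
have M2 : 0 < M%:R ^+ 2 :> rat by rewrite exprn_gt0.
have d1d : (d1 < d)%N.
  rewrite -(ltr_nat rat) d1E dE ltr_pM2r// /e1 ltr_pdivrMr// expr2 ltr_pM2l//.
  by rewrite ltrDr.
have d2d : (d2 < d)%N.
  rewrite -(ltr_nat rat) d2E dE ltr_pM2r// /e2 ltr_pdivrMr// expr2 ltr_pM2l//.
  by rewrite ltrDl.
have dd : (d < d1 + d2)%N.
  by rewrite -(ltr_nat rat) natrD d1E d2E dE -mulrDl ltr_pM2r// -subr_gt0.
have f_supp x y : f (x, y) != 0 ->
    x * (b * M%:R) \is a Num.int /\ y * (b * M%:R) \is a Num.int.
  move=> /supp /hD1[/= xi yi].
  have bK : b * K%:R \is a Num.int by apply: hK; rewrite inE eqxx.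
  have E z : z * (b * M%:R) = z * D1%:R * (b * K%:R) * D0%:R by rewrite /M !natrM; ring.
  by rewrite !E; split; rewrite rpredM ?rpred_nat// rpredM.
have f_per r r' x y (k k' : int) : r \in rs -> r' \in rs ->
    f (x + k%:~R * (r * M%:R), y + k'%:~R * (r' * M%:R)) = f (x, y).
  move=> hr hr'.
  have rK q : q \in rs -> q * K%:R \is a Num.int.
    by move=> qs; apply: hK; rewrite !inE in qs *; rewrite qs !orbT.
  have E (q : rat) (j : int) : j%:~R * (q * M%:R) = j%:~R * (q * K%:R * D1%:R) * D0%:R.
    by rewrite /M !natrM; ring.
  rewrite -[LHS]/(f ((x, y) + (k%:~R * (r * M%:R), k'%:~R * (r' * M%:R)))) per// !E.
  by apply: hD0; rewrite rpredM ?rpred_int// rpredM ?rpred_nat// rK.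
exists d, d1, d2; split=> //; split=> //.
exists (massey_coef kappa b f M e0 e1 e2); split.
  exact: (massey_coef_universal kappa_neq0 a0 b0 c0 fA fB M_gt0 d_gt0 d1_gt0 d2_gt0
    d1d d2d dd erefl erefl erefl e0_gt0 dE d1E d2E f_supp f_per).
move=> tau tau_gt0.
exact: (ThetaE kappa_neq0 a0 b0 c0 fA fB M_gt0 d_gt0 d1_gt0 d2_gt0
  d1d d2d dd erefl erefl erefl e0_gt0 dE d1E d2E f_supp f_per tau_gt0).
Qed.
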